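(* Let $U\subset\mathbf{R}^n$ be an open set, and suppose that the nonnegative measurable function $w$ satisfies a weak reverse Hölder inequality in $U$, i.e. there exist constants $q>1$ and $B_U>0$ such that $$\Bigl(\frac1{|B(x,r)|}\int_{B(x,r)}w^q\,dy\Bigr)^{1/q}\le B_U\,\frac1{|B(x,2r)|}\int_{B(x,2r)}w\,dy\quad\text{for all balls }B(x,2r)\subset U.$$ Then $w$ is doubling in $U$ if and only if $\log(w)\in BMO(U)$. In particular, suppose $w$ satisfies the weak reverse Hölder inequality above and $$\frac1{|B(x,s)|}\int_{B(x,s)}\Bigl|\log w(y)-\frac1{|B(x,s)|}\int_{B(x,s)}\log w(z)\,dz\Bigr|^2dy\le D_U\quad\text{for all balls }B(x,2s)\subset U.$$ Then there is a constant $C(B_U,D_U)>0$ such that for any ball $B(x,4r)\subset U$ $$\frac1{|B(x,2r)|}\int_{B(x,2r)}w\,dy\le C(B_U,D_U)\,\frac1{|B(x,r)|}\int_{B(x,r)}w\,dy,$$ where $B_U$ is the constant from the weak reverse Hölder inequality.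
   Context: $B(x,r)$ is the ball with centre $x$ and radius $r$. A nonnegative measurable function $w$ is doubling in $U$ if there is a constant $A_U>0$ with $\frac1{|B(x,2r)|}\int_{B(x,2r)}w\,dy\le A_U\frac1{|B(x,r)|}\int_{B(x,r)}w\,dy$ for all balls $B(x,4r)\subset U$. $f\in BMO(U)$ means there is a positive constant $D_U$ such that $\frac1{|B(x,r)|}\int_{B(x,r)}\bigl|f(y)-\frac1{|B(x,r)|}\int_{B(x,r)}f(z)\,dz\bigr|^2dy\le D_U$ for every ball $B(x,2r)\subset U$.
   Formalization: w is assumed locally integrable in U and, for the equivalence, not a.e. zero on any connected component of U (w = 0 is doubling but log w = -∞ is not in BMO); the constant C(B_U,D_U) may also depend on q and n, as it must. *)

(* Defs.v *)
From HB Require Import structures.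
From mathcomp Require Import all_boot all_order all_algebra.
From mathcomp Require Import all_classical all_reals all_analysis.

Set Implicit Arguments.
Unset Strict Implicit.
Unset Printing Implicit Defensive.

Import Order.TTheory GRing.Theory Num.Theory.
Import numFieldNormedType.Exports.

Local Open Scope classical_set_scope.
Local Open Scope ring_scope.

(* R^n with its Borel sets, given as the sigma-algebra generated by the       *)
(* coordinates (as for n.-tuple in MathComp-Analysis).                        *)
Definition borelRn (R : realType) (n : nat) : Type := 'rV[R]_n.

Section borel.
Context {R : realType} {n : nat}.

HB.instance Definition _ := Pointed.copy (borelRn R n) 'rV[R]_n.

Let coord (i : 'I_n) (x : borelRn R n) : R := (x : 'rV[R]_n) 0 i.

Let coord_set0 : g_sigma_preimage coord set0.
Proof. exact: sigma_algebra0. Qed.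

Let coord_setC A : g_sigma_preimage coord A -> g_sigma_preimage coord (~` A).
Proof. exact: sigma_algebraC. Qed.

Let coord_bigcup (F : (set (borelRn R n))^nat) :
  (forall i, g_sigma_preimage coord (F i)) ->
  g_sigma_preimage coord (\bigcup_i (F i)).
Proof. exact: sigma_algebra_bigcup. Qed.

HB.instance Definition _ := @isMeasurable.Build default_measure_display
  (borelRn R n) (g_sigma_preimage coord) coord_set0 coord_setC coord_bigcup.

Lemma measurable_coord (i : 'I_n) :
  measurable_fun [set: borelRn R n] (fun x => (x : 'rV[R]_n) 0 i).
Proof.
move=> _ Y mY; rewrite setTI; apply: sub_sigma_algebra => /=.
rewrite -bigcup_seq/=; exists i => /=; first by rewrite mem_index_enum.
by exists Y => //; rewrite setTI.
Qed.

Lemma measurable_fun_coordP d (T : measurableType d) (f : T -> borelRn R n) :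
  (forall i, measurable_fun setT (fun t => (f t : 'rV[R]_n) 0 i)) ->
  measurable_fun setT f.
Proof.
move=> mf.
have sub : g_sigma_preimage (fun i => coord i \o f) `<=` measurable.
  apply: smallest_sub; first exact: sigma_algebra_measurable.
  rewrite -bigcup_seq; apply: bigcup_sub => i _ A [B mB <-].
  exact: mf.
move=> _ A mA; apply: sub; rewrite g_sigma_preimage_comp.
by exists A.
Qed.

End borel.

Section cons.
Context {R : realType} {n : nat}.
Local Open Scope ereal_scope.

Definition consRn (p : measurableTypeR R * borelRn R n) : borelRn R n.+1 :=
  row_mx (p.1%:M : 'rV[R]_1) (p.2 : 'rV[R]_n).

Definition tailRn (v : borelRn R n.+1) : borelRn R n :=
  (\row_j (v : 'rV[R]_n.+1) ord0 (lift ord0 j) : 'rV[R]_n).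

Lemma consRn0 p : (consRn p : 'rV[R]_n.+1) ord0 ord0 = p.1.
Proof.
have -> : ord0 = lshift n (ord0 : 'I_1) by apply: val_inj.
by rewrite /consRn (row_mxEl (p.1%:M : 'rV[R]_1) (p.2 : 'rV[R]_n)) mxE eqxx.
Qed.

Lemma consRnS p (j : 'I_n) :
  (consRn p : 'rV[R]_n.+1) ord0 (lift ord0 j) = (p.2 : 'rV[R]_n) ord0 j.
Proof.
have -> : lift ord0 j = rshift 1 j by apply: val_inj.
by rewrite /consRn (row_mxEr (p.1%:M : 'rV[R]_1) (p.2 : 'rV[R]_n)).
Qed.

Lemma consRnK p : tailRn (consRn p) = p.2.
Proof. by apply/rowP => j; rewrite mxE consRnS. Qed.

Lemma measurable_consRn : measurable_fun setT consRn.
Proof.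
apply: measurable_fun_coordP => i.
have [j ->|->] := unliftP ord0 i.
  under eq_fun do rewrite consRnS.
  exact: (measurableT_comp (measurable_coord j) measurable_snd).
under eq_fun do rewrite consRn0.
exact: measurable_fst.
Qed.

Lemma measurable_tailRn : measurable_fun setT tailRn.
Proof.
apply: measurable_fun_coordP => i; rewrite /tailRn.
under eq_fun do rewrite mxE.
exact: measurable_coord.
Qed.

Variable m : {sigma_finite_measure set (borelRn R n) -> \bar R}.

Definition cons_measure : set (borelRn R n.+1) -> \bar R :=
  pushforward (lebesgue_measure \x m) consRn.

Let cons_measure0 : cons_measure set0 = 0.
Proof. by rewrite /cons_measure /pushforward preimage_set0 measure0. Qed.

Let cons_measure_ge0 A : 0 <= cons_measure A.
Proof. by apply: measure_ge0; exact: measurable_consRn. Qed.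

Let cons_measure_sigma_additive : semi_sigma_additive cons_measure.
Proof.
apply: measure_semi_sigma_additive; exact: measurable_consRn.
Qed.

HB.instance Definition _ := isMeasure.Build _ _ _ cons_measure
  cons_measure0 cons_measure_ge0 cons_measure_sigma_additive.

Definition setXRn (A : set (measurableTypeR R)) (B : set (borelRn R n)) :
  set (borelRn R n.+1) := [set v | A ((v : 'rV[R]_n.+1) ord0 ord0) /\ B (tailRn v)].

Lemma measurable_setXRn A B :
  measurable A -> measurable B -> measurable (setXRn A B).
Proof.
move=> mA mB.
have -> : setXRn A B =
  (setT `&` (fun v => (v : 'rV[R]_n.+1) ord0 ord0) @^-1` A) `&`
  (setT `&` tailRn @^-1` B) by rewrite !setTI.
apply: measurableI; first exact: (measurable_coord ord0 measurableT mA).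
exact: (measurable_tailRn measurableT mB).
Qed.

Lemma cons_measureX A B : measurable A -> measurable B ->
  cons_measure (setXRn A B) = lebesgue_measure A * m B.
Proof.
move=> mA mB; rewrite /cons_measure /pushforward -product_measure1E//.
congr product_measure1; apply/seteqP; split => p;
  by rewrite /setXRn /= consRn0 consRnK.
Qed.

Let cons_measure_sigma_finite : sigma_finite setT cons_measure.
Proof.
have /sigma_finiteP[F [TF ndF Foo]] := sigma_finiteT (@lebesgue_measure R).
have /sigma_finiteP[G [TG ndG Goo]] := sigma_finiteT m.
exists (fun k => setXRn (F k) (G k)).
  apply/esym; rewrite -subTset => v _.
  have : setT (v ord0 ord0) by [].
  have : setT (tailRn v) by [].
  rewrite TF TG => -[i _ Gi] [j _ Fj].
  exists (maxn i j) => //; split.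
  - by move: Fj; exact/subsetPset/ndF/leq_maxr.
  - by move: Gi; exact/subsetPset/ndG/leq_maxl.
move=> k; have [? ?] := Foo k; have [? ?] := Goo k.
split; first exact: measurable_setXRn.
by rewrite cons_measureX// lte_mul_pinfty// ge0_fin_numE.
Qed.

HB.instance Definition _ := Measure_isSigmaFinite.Build _ _ _ cons_measure
  cons_measure_sigma_finite.

End cons.

(* n-dimensional Lebesgue measure on the Borel sets of R^n: the n-fold        *)
(* product of the Lebesgue measure on R.                                      *)
Fixpoint borel_lebesgue (R : realType) (n : nat) :
    {sigma_finite_measure set (borelRn R n) -> \bar R} :=
  match n with
  | 0 => dirac ((0 : 'rV[R]_0) : borelRn R 0)
  | k.+1 => cons_measure (borel_lebesgue R k)
  end.

(* R^n with its Lebesgue measurable sets (the completion of the Borel sets)   *)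
(* and with the topology of row vectors, which is the Euclidean topology.     *)
(* The metric balls of 'rV[R]_n are those of the sup norm: use eball instead. *)
Definition Rn (R : realType) (n : nat) : Type :=
  caratheodory_type (mu_ext (borel_lebesgue R n)).

HB.instance Definition _ (R : realType) (n : nat) :=
  PointedTopological.copy (Rn R n) 'rV[R]_n.
HB.instance Definition _ (R : realType) (n : nat) :=
  Measurable.copy (Rn R n) (caratheodory_type (mu_ext (borel_lebesgue R n))).

Definition lebesgueRn (R : realType) (n : nat) : set (Rn R n) -> \bar R :=
  @completed_measure_extension _ _ _ (borel_lebesgue R n).

HB.instance Definition _ (R : realType) (n : nat) :=
  Measure.on (@lebesgueRn R n).
HB.instance Definition _ (R : realType) (n : nat) :=
  Measure_isSigmaFinite.Build _ _ _ (@lebesgueRn R n)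
    (completed_measure_extension_sigma_finite
       (sigma_finiteT (borel_lebesgue R n))).

Section box.
Context {R : realType}.

Definition box {n : nat} (a b : 'rV[R]_n) : set (borelRn R n) :=
  [set x : 'rV[R]_n | forall i, a ord0 i < x ord0 i <= b ord0 i].

Let tail {n : nat} (a : 'rV[R]_n.+1) : 'rV[R]_n := tailRn (a : borelRn R n.+1).

Let boxS {n : nat} (a b : 'rV[R]_n.+1) :
  box a b = setXRn `]a ord0 ord0, b ord0 ord0] (box (tail a) (tail b)).
Proof.
apply/seteqP; split => [v ab|v [v0 vS] i].
  by split; [have := ab ord0; rewrite /= in_itv|move=> i; rewrite !mxE; exact: ab].
have [j ->|->] := unliftP ord0 i; last by move: v0; rewrite /= in_itv.
by have := vS j; rewrite !mxE.
Qed.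

Let measurable_box {n : nat} (a b : 'rV[R]_n) : measurable (box a b).
Proof.
elim: n a b => [|n IH] a b; last by rewrite boxS; exact: measurable_setXRn.
by rewrite (_ : box a b = setT)//; apply/seteqP; split => // x _ [].
Qed.

Lemma lebesgueRn_box {n : nat} (a b : 'rV[R]_n) :
  (forall i, a ord0 i <= b ord0 i) ->
  lebesgueRn (box a b : set (Rn R n)) =
  (\prod_(i < n) (b ord0 i - a ord0 i))%:E.
Proof.
rewrite /lebesgueRn /completed_measure_extension measurable_mu_extE;
  last exact: measurable_box.
elim: n a b => [|n IH] a b ab.
  by rewrite big_ord0 /= /dirac indicE mem_set// => -[].
rewrite boxS [LHS]cons_measureX// IH; last by move=> i; rewrite !mxE.
rewrite lebesgue_measure_itv/= lte_fin big_ord_recl EFinM.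
congr (_ * _%:E)%E; last by apply: eq_bigr => i _; rewrite !mxE.
have := ab ord0; rewrite le_eqVlt => /predU1P[->|->]; last by rewrite EFinB.
by rewrite ltxx subrr.
Qed.

End box.

Section definitions.
Context {R : realType} {n : nat}.
Local Notation mu := (@lebesgueRn R n).
Implicit Types (U A : set (Rn R n)) (x : Rn R n) (w : Rn R n -> R).
Implicit Types (f : Rn R n -> \bar R).
Local Open Scope ereal_scope.

Definition eball x (r : R) : set (Rn R n) :=
  [set y | Num.sqrt (\sum_(i < n)
    ((y : 'rV[R]_n) ord0 i - (x : 'rV[R]_n) ord0 i) ^+ 2) < r]%R.

Definition avg A f : \bar R := (mu A)^-1 * \int[mu]_(y in A) f y.

Definition doubling_with U w (A : R) : Prop :=
  forall x (r : R), (0 < r)%R -> eball x (4 * r) `<=` U ->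
    avg (eball x (2 * r)) (EFin \o w) <= A%:E * avg (eball x r) (EFin \o w).

Definition doubling U w : Prop := exists2 A : R, (0 < A)%R & doubling_with U w A.

(* In \bar R one has -oo + +oo = -oo, so that the left-hand side is +oo       *)
(* whenever f is not integrable over the ball, in particular when f = -oo on  *)
(* a non-null subset of it.                                                   *)
Definition BMO_with U f (D : R) : Prop :=
  forall x (r : R), (0 < r)%R -> eball x (2 * r) `<=` U ->
    avg (eball x r) (fun y => `|f y - avg (eball x r) f| ^+ 2) <= D%:E.

Definition BMO U f : Prop := exists2 D : R, (0 < D)%R & BMO_with U f D.

Definition weak_reverse_Holder U w (q B : R) : Prop :=
  forall x (r : R), (0 < r)%R -> eball x (2 * r) `<=` U ->
    avg (eball x r) (fun y => (w y `^ q)%:E) `^ q^-1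
      <= B%:E * avg (eball x (2 * r)) (EFin \o w).

(* log w takes the value -oo where w = 0, whereas ln 0 = 0. *)
Definition log w : Rn R n -> \bar R := fun y => lne (w y)%:E.

Definition loc_integrable U w : Prop :=
  forall K, K `<=` U -> compact K -> \int[mu]_(y in K) `|w y|%:E < +oo.

(* w does not vanish almost everywhere on a connected component of U. *)
Definition nonvanishing U w : Prop :=
  forall x, U x -> 0 < \int[mu]_(y in connected_component U x) (w y)%:E.

End definitions.

(* Main.v *)
(* With m Lebesgue measure and W(A) the integral of w over A, the weak reverse
   Hoelder inequality says that W is small on small parts of a ball, relative to
   the concentric double ball.  No John-Nirenberg inequality is needed.

   If log w has bounded mean oscillation c(B) then, by Chebyshev, w lies between
   exp (c(B) - t) and exp (c(B) + t) off a small part of B.  Hence the c's of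
   comparable balls differ by a bounded amount, W(B) is at least a multiple of
   exp (c(B)) m(B), and the reverse Hoelder inequality absorbs the exceptional
   set: covering by balls of half the radius and iterating leaves an error term
   2^-j W(V), which vanishes in the limit.

   Conversely, let w be doubling.  A clopen argument on components shows that W
   is positive on balls.  Bisect a cube Q repeatedly along longest sides: each
   half keeps a proportion u of the W-mass, while a subset of a box with a small
   proportion of its m-mass carries at most a quarter of its W-mass.  A stopping
   time argument then shows that { w < u^j W(Q)/(2 m(Q)) } has measure at most
   (1 - d)^j m(Q).  These tails make (log w - log (W(Q)/m(Q)))^2 integrable on Q
   with the right bound, and doubling compares the averages over the boundedly
   many small cubes that cover a given ball. *)
From HB Require Import structures.
Require Import Defs.
From mathcomp Require Import all_boot all_order all_algebra.
From mathcomp Require Import all_classical all_reals all_analysis.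
From mathcomp Require Import measurable_realfun.
From mathcomp Require Import ring lra.
Import Order.TTheory GRing.Theory Num.Theory.
Import numFieldNormedType.Exports.
Set Implicit Arguments.
Unset Strict Implicit.
Unset Printing Implicit Defensive.
Local Open Scope classical_set_scope.
Local Open Scope ring_scope.

(** * Euclidean balls *)

Section euclidean_norm.
Context {R : realType} {n : nat}.
Implicit Types u v : 'rV[R]_n.

(** A ball cannot be cut into smaller balls, so the stopping time runs on boxes, and doubling
    transfers mass between a box and the balls inside and around it. Zeros of [w] are the delicate
    point: [log w] is [-oo] there and its distance to any real centre is infinite. In one direction
    a BMO bound forces the averages to be finite. In the other, the tail bounds for all j force { w
    = 0 } to be null; they rest on [w] having positive mass on every ball, and this is where
    [nonvanishing] enters: a weight that vanishes almost everywhere on a component is trivially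
    doubling there, while its logarithm is [-oo]. The stopping time sees only finitely many
    generations. The sublevel set is reached by approximating it in measure by finite unions of
    boxes, not by differentiating averages at points. Most estimates concern real-valued additive
    functions, namely m and W restricted to a ball or box with compact closure in U, where both are
    finite. All constants are fixed before U and [w]. *)

Definition enorm v : R := Num.sqrt (\sum_(i < n) v ord0 i ^+ 2).

Lemma enorm_ge0 v : 0 <= enorm v. Proof. exact: sqrtr_ge0. Qed.

Lemma sumsq_ge0 v : 0 <= \sum_(i < n) v ord0 i ^+ 2.
Proof. by apply: sumr_ge0 => i _; exact: sqr_ge0. Qed.

Lemma sqr_enorm v : enorm v ^+ 2 = \sum_(i < n) v ord0 i ^+ 2.
Proof. by rewrite sqr_sqrtr// sumsq_ge0. Qed.

Lemma enormZ a v : enorm (a *: v) = `|a| * enorm v.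
Proof.
rewrite /enorm; under eq_bigr do rewrite mxE exprMn.
by rewrite -mulr_sumr sqrtrM ?sqr_ge0// sqrtr_sqr.
Qed.

Lemma enormN v : enorm (- v) = enorm v.
Proof. by rewrite -scaleN1r enormZ normrN1 mul1r. Qed.

Lemma enorm0 : enorm 0 = 0.
Proof. by rewrite -(scale0r 0) enormZ normr0 mul0r. Qed.

Lemma enorm_coord v i : `|v ord0 i| <= enorm v.
Proof.
rewrite -sqrtr_sqr ler_wsqrtr// (bigD1 i)//= lerDl.
by apply: sumr_ge0 => j _; exact: sqr_ge0.
Qed.

(** The sum of the squares of |v| u_i - |u| v_i equals 2 |u| |v| (|u| |v| - u.v). Null vectors are
    treated beforehand because |u| |v| is divided out. *)
Lemma cauchy_schwarz u v :
  \sum_(i < n) u ord0 i * v ord0 i <= enorm u * enorm v.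
Proof.
have [v0|v0] := eqVneq (enorm v) 0.
  rewrite v0 mulr0 big1// => i _.
  have := enorm_coord v i; rewrite v0 normr_le0 => /eqP ->.
  by rewrite mulr0.
have [u0|u0] := eqVneq (enorm u) 0.
  rewrite u0 mul0r big1// => i _.
  have := enorm_coord u i; rewrite u0 normr_le0 => /eqP ->.
  by rewrite mul0r.
have vp : 0 < enorm v by rewrite lt_def v0 enorm_ge0.
have up : 0 < enorm u by rewrite lt_def u0 enorm_ge0.
have : 0 <= \sum_(i < n) (enorm v * u ord0 i - enorm u * v ord0 i) ^+ 2.
  by apply: sumr_ge0 => i _; exact: sqr_ge0.
under eq_bigr => i _.
  rewrite (_ : _ ^+ 2 = enorm v ^+ 2 * u ord0 i ^+ 2 +
    enorm u ^+ 2 * v ord0 i ^+ 2 -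
    (2 * enorm u * enorm v) * (u ord0 i * v ord0 i)); first by over.
  by ring.
rewrite big_split /= big_split /= sumrN -!mulr_sumr -!sqr_enorm.
set S := \sum_(i < n) _.
have -> : enorm v ^+ 2 * enorm u ^+ 2 + enorm u ^+ 2 * enorm v ^+ 2 -
  2 * enorm u * enorm v * S = (enorm u * enorm v) * (2 * (enorm u * enorm v - S)) by ring.
by rewrite pmulr_rge0 ?mulr_gt0// pmulr_rge0// subr_ge0.
Qed.

Lemma enormD u v : enorm (u + v) <= enorm u + enorm v.
Proof.
rewrite -ler_sqr ?nnegrE ?addr_ge0 ?enorm_ge0// sqr_enorm.
under eq_bigr do rewrite mxE sqrrD.
rewrite big_split /= big_split /= -!sqr_enorm sqrrD lerD2r lerD2l.
by rewrite sumrMnl lerMn2r/= cauchy_schwarz.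
Qed.

Lemma enorm_distD u v w : enorm (u - w) <= enorm (u - v) + enorm (v - w).
Proof. by rewrite (_ : u - w = (u - v) + (v - w)) ?enormD// addrA subrK. Qed.

Lemma enormB u v : enorm (u - v) = enorm (v - u).
Proof. by rewrite -enormN opprB. Qed.

(* The bound [n t] instead of [sqrt n t] spares square roots. *)
Lemma enorm_le v (t : R) : (forall i, `|v ord0 i| <= t) -> enorm v <= n%:R * t.
Proof.
move=> vt; case: (posnP n) => [n0|n0].
  rewrite /enorm big1 ?sqrtr0; last by case=> k kn; exfalso; move: kn; rewrite n0.
  by rewrite n0 mul0r.
have t0 : 0 <= t by exact: le_trans (vt (Ordinal n0)).
rewrite -ler_sqr ?nnegrE ?mulr_ge0 ?enorm_ge0// sqr_enorm.
apply: (@le_trans _ _ (\sum_(i < n) t ^+ 2)).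
  by apply: ler_sum => i _; rewrite -real_normK ?num_real// ler_sqr ?nnegrE.
rewrite sumr_const card_ord -[leLHS]mulr_natl exprMn; apply: ler_wpM2r; first exact: sqr_ge0.
by rewrite -natrX ler_nat leq_pmulr.
Qed.

End euclidean_norm.

Section balls.
Context {R : realType} {n : nat}.
Implicit Types (x y z : Rn R n) (r s : R).

Definition eudist x y : R := enorm ((y : 'rV[R]_n) - (x : 'rV[R]_n)).

Lemma eballE x r y : eball x r y <-> eudist x y < r.
Proof.
rewrite /eball /eudist /enorm /=; under eq_bigr do idtac.
suff -> : \sum_(i < n) ((y : 'rV[R]_n) - x) ord0 i ^+ 2 =
  \sum_(i < n) ((y : 'rV[R]_n) ord0 i - (x : 'rV[R]_n) ord0 i) ^+ 2 by [].
by apply: eq_bigr => i _; rewrite !mxE.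
Qed.

Lemma eudist_ge0 x y : 0 <= eudist x y. Proof. exact: enorm_ge0. Qed.

Lemma eudistC x y : eudist x y = eudist y x. Proof. exact: enormB. Qed.

Lemma eudistxx x : eudist x x = 0. Proof. by rewrite /eudist subrr enorm0. Qed.

Lemma eudist_triangle x y z : eudist x z <= eudist x y + eudist y z.
Proof. by rewrite addrC; exact: enorm_distD. Qed.

Lemma eball_center x r : 0 < r -> eball x r x.
Proof. by move=> r0; apply/eballE; rewrite eudistxx. Qed.

Lemma eball_subset x y r s : eudist x y + s <= r -> eball y s `<=` eball x r.
Proof.
move=> h z /eballE yz; apply/eballE.
by rewrite (le_lt_trans (eudist_triangle x y z))// (lt_le_trans _ h)// ltrD2l.
Qed.

Lemma eball_le x r s : r <= s -> eball x r `<=` eball x s.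
Proof. by move=> rs; apply: eball_subset; rewrite eudistxx add0r. Qed.

(* The centres are chosen inside the ball, so that the small balls stay in    *)
(* a controlled neighbourhood of it; a scaled grid supplies them.             *)
Lemma eball_cover (l : R) : 0 < l -> exists L : nat, forall x r, 0 < r ->
  exists z : 'I_L -> Rn R n, (forall i, eball x r (z i)) /\
    eball x r `<=` \bigcup_i eball (z i) (l * r).
Proof.
move=> l0.
(* This makes [n] grid steps of length r / (N + 1) shorter than half the radius [l * r]. *)
have [N nN] : exists N : nat, (2 * n.+1)%:R < l * N.+1%:R.
  exists (Num.truncn ((2 * n.+1)%:R / l)).
  rewrite mulrC -ltr_pdivrMr//; apply: truncnS_gt; exact: divr_ge0 (ltW l0).
exists #|{ffun 'I_n -> 'I_(2 * N.+1).+1}| => x r r0.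
pose g (f : {ffun 'I_n -> 'I_(2 * N.+1).+1}) : Rn R n :=
  \row_i ((x : 'rV[R]_n) ord0 i + r * ((f i)%:R / N.+1%:R - 1)).
(* A grid point close to the ball may lie outside it, so it is replaced by a point of the ball
   within [l / 2 * r] of it; the triangle inequality then costs the other half of [l * r]. Grid
   points far from the ball are sent to [x]. *)
pose z f := if pselect (exists y, eball x r y /\ eball (g f) (l / 2 * r) y) is left e
  then projT1 (cid e) else x.
exists (fun i => z (enum_val i)); split.
  move=> i; rewrite /z; case: pselect => [e|_]; last exact: eball_center.
  by case: (projT2 (cid e)).
move=> y xy.
have N0 : 0 < N.+1%:R :> R by [].
pose u i : R := ((y : 'rV[R]_n) ord0 i - (x : 'rV[R]_n) ord0 i) / r + 1.
have uB i : 0 <= u i <= 2.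
  have : `|((y : 'rV[R]_n) ord0 i - (x : 'rV[R]_n) ord0 i) / r| <= 1.
    rewrite normrM normfV (gtr0_norm r0) ler_pdivrMr// mul1r.
    move/eballE: xy => /ltW; apply: le_trans.
    by have := enorm_coord ((y : 'rV[R]_n) - x) i; rewrite !mxE.
  by rewrite ler_norml /u => /andP[? ?]; apply/andP; split; lra.
pose t i := Num.truncn (u i * N.+1%:R).
have u0 i : 0 <= u i * N.+1%:R by rewrite mulr_ge0//; case/andP: (uB i).
have tB i : (t i < (2 * N.+1).+1)%N.
  rewrite ltnS -(ler_nat R) (@le_trans _ _ (u i * N.+1%:R)) ?truncn_le//.
  by rewrite natrM ler_wpM2r//; case/andP: (uB i).
pose f : {ffun 'I_n -> 'I_(2 * N.+1).+1} := [ffun i => Ordinal (tB i)].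
have gy : eudist (g f) y < l / 2 * r.
  apply: (@le_lt_trans _ _ (n%:R * (r / N.+1%:R))).
    apply: enorm_le => i; rewrite !mxE ffunE /=.
    have -> : y ord0 i = (x : 'rV[R]_n) ord0 i + r * (u i - 1).
      by rewrite /u; field; rewrite gt_eqF.
    have -> : (x : 'rV[R]_n) ord0 i + r * (u i - 1) -
      ((x : 'rV[R]_n) ord0 i + r * ((t i)%:R / N.+1%:R - 1)) =
      r / N.+1%:R * (u i * N.+1%:R - (t i)%:R).
      by field; rewrite nat1r lt0r_neq0.
    have /andP[t1 t2] := truncn_itv (u0 i).
    rewrite normrM gtr0_norm ?divr_gt0// ler_piMr ?divr_ge0 ?ltW//.
    by rewrite ger0_norm ?subr_ge0// ltrBlDl natr1.
  rewrite mulrA ltr_pdivrMr// mulrAC -subr_gt0.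
  have -> : l / 2 * N.+1%:R * r - n%:R * r = r * (l * N.+1%:R - 2 * n%:R) / 2 by field.
  rewrite divr_gt0// mulr_gt0// subr_gt0 (le_lt_trans _ nN)//.
  by rewrite natrM ler_wpM2l// ler_nat.
exists (enum_rank f) => //=.
rewrite enum_rankK /z; case: pselect => [e|]; last first.
  by case; exists y; split => //; apply/eballE.
case: (projT2 (cid e)) => _ /eballE h; apply/eballE.
rewrite (le_lt_trans (eudist_triangle _ (g f) _))// eudistC.
by rewrite (_ : l * r = l / 2 * r + l / 2 * r) ?ltrD//; field.
Qed.

End balls.

(** * Open sets, measurability and volume of Euclidean balls *)

Section topology_measure.
Context {R : realType} {n : nat}.
Implicit Types (x y z : Rn R n) (r s : R) (U : set (Rn R n)).
Local Notation mu := (@lebesgueRn R n).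

Lemma open_eball_subset U x : open U -> U x ->
  exists2 r, 0 < r & eball x r `<=` U.
Proof.
move=> oU Ux.
have : nbhs (x : 'rV[R]_n) U by exact: open_nbhs_nbhs.
move=> /nbhs_ballP[e /= e0 h]; exists e => // y /eballE xy; apply: h.
split => // i j; rewrite (ord1 i) /ball /=.
have := enorm_coord ((y : 'rV[R]_n) - x) j; rewrite !mxE distrC => h.
exact: le_lt_trans h xy.
Qed.

Lemma eball_subset_openP U :
  (forall x, U x -> exists2 r, 0 < r & eball x r `<=` U) -> open U.
Proof.
move=> h; suff : open (U : set 'rV[R]_n) by [].
rewrite openE => x /h[r r0 xU].
apply/nbhs_ballP; exists (r / n.+1%:R) => /=; first by rewrite divr_gt0.
move=> y xy; apply: xU; apply/eballE.
apply: (@le_lt_trans _ _ (n%:R * (r / n.+1%:R))).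
  apply: enorm_le => i; have := xy.2 ord0 i; rewrite !mxE /ball /= distrC.
  exact: ltW.
by rewrite mulrA ltr_pdivrMr// mulrC ltr_pM2l// ltr_nat.
Qed.

Lemma open_eball x r : open (eball x r).
Proof.
apply: eball_subset_openP => y xy; exists (r - eudist x y).
  by rewrite subr_gt0; apply/eballE.
by apply: eball_subset; rewrite addrC subrK.
Qed.

Lemma measurable_coordRn (i : 'I_n) :
  measurable_fun setT (fun y : Rn R n => (y : 'rV[R]_n) ord0 i).
Proof.
move=> mT Y mY; apply: sub_caratheodory; apply: sub_sigma_algebra.
exact: (measurable_coord i measurableT mY).
Qed.

Lemma measurable_eball x r : measurable (eball x r).
Proof.
have [r0|r0] := leP r 0.
  rewrite (_ : eball x r = set0)//; apply/seteqP; split => // y /eballE.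
  by move=> /lt_le_trans - /(_ _ r0); rewrite ltNge eudist_ge0.
pose f := fun y : Rn R n =>
  (\sum_(i < n) ((y : 'rV[R]_n) ord0 i - (x : 'rV[R]_n) ord0 i) ^+ 2)%R.
have mf : measurable_fun setT f.
  apply: measurable_sum => i; apply: measurable_funX.
  by apply: measurable_funB; [exact: measurable_coordRn|exact: measurable_cst].
rewrite (_ : eball x r = setT `&` f @^-1` `]-oo, r ^+ 2[%classic); last first.
  have f0 y : 0 <= f y by apply: sumr_ge0 => i _; exact: sqr_ge0.
  apply/seteqP; split => y; rewrite /eball /= in_itv /= -/(f y).
    move=> h; split => //; rewrite -(sqr_sqrtr (f0 y)) ltr_sqr ?nnegrE ?sqrtr_ge0//.
    exact: ltW.
  move=> [_ h]; rewrite -ltr_sqr ?nnegrE ?sqrtr_ge0//; last exact: ltW.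
  by rewrite sqr_sqrtr.
by apply: mf => //; exact: measurable_itv.
Qed.

Lemma measurable_boxRn (a b : 'rV[R]_n) : measurable (box a b : set (Rn R n)).
Proof.
rewrite (_ : box a b = \bigcap_(i in [set: 'I_n])
   (setT `&` (fun y : Rn R n => (y : 'rV[R]_n) ord0 i) @^-1`
     `]a ord0 i, b ord0 i]%classic)); last first.
  apply/seteqP; split => [y h i _|y h i]; first by split => //=; rewrite in_itv; exact: h.
  by have [_] := h i I; rewrite /= in_itv.
apply: fin_bigcap_measurable => // i _.
by apply: measurable_coordRn => //; exact: measurable_itv.
Qed.

Let qpt (q : {ffun 'I_n -> rat}) : Rn R n := \row_i ratr (q i).

(** The countable base behind the covering property below: rational centres and radii 1 / (k +
    1). *)
Lemma rat_eball U x : open U -> U x ->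
  exists q k, eball (qpt q) k.+1%:R^-1 x /\ eball (qpt q) k.+1%:R^-1 `<=` U.
Proof.
move=> oU Ux; have [r r0 rU] := open_eball_subset oU Ux.
have [k hk] : exists k : nat, 2 / r < k.+1%:R.
  by exists (Num.truncn (2 / r)); apply: truncnS_gt; rewrite divr_ge0// ltW.
have k0 : 0 < k.+1%:R^-1 :> R by rewrite invr_gt0.
have d0 : 0 < k.+1%:R^-1 / n.+1%:R :> R by rewrite divr_gt0.
have xd i : (x : 'rV[R]_n) ord0 i < (x : 'rV[R]_n) ord0 i + k.+1%:R^-1 / n.+1%:R.
  by rewrite ltrDl.
pose q : {ffun 'I_n -> rat} := [ffun i =>
  projT1 (cid (rat_in_itvoo (xd i)))].
have xq : eudist (qpt q) x < k.+1%:R^-1.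
  apply: (@le_lt_trans _ _ (n%:R * (k.+1%:R^-1 / n.+1%:R))).
    apply: enorm_le => i; rewrite !mxE ffunE; case: cid => /= a.
    rewrite in_itv/= => /andP[h1 h2].
    by rewrite distrC ger0_norm ?subr_ge0 1?ltW// ltrBlDl.
  by rewrite mulrA ltr_pdivrMr// mulrC ltr_pM2l// ltr_nat.
exists q, k; split; first exact/eballE.
apply: subset_trans rU; apply: eball_subset; rewrite eudistC.
have : 2 * k.+1%:R^-1 < r by rewrite ltr_pdivrMr// mulrC -ltr_pdivrMr.
move: xq; set c := k.+1%:R^-1; lra.
Qed.

(* A form of the Lindelof property. *)
Lemma open_measurable_ind U (P : set (Rn R n) -> Prop) : P set0 ->
  (forall F : nat -> set (Rn R n), (forall k, P (F k)) -> P (\bigcup_k F k)) ->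
  open U ->
  (forall x, U x -> exists2 V, open V & V x /\
      forall y s, eball y s `<=` V -> eball y s `<=` U -> P (eball y s)) -> P U.
Proof.
move=> P0 Pcup oU h.
pose G (i : {ffun 'I_n -> rat} * nat) := eball (qpt i.1) i.2.+1%:R^-1.
pose F k := if unpickle k is Some i then
   (if pselect (P (G i) /\ G i `<=` U) is left _ then G i else set0) else set0.
have -> : U = \bigcup_k F k.
  apply/seteqP; split => [x Ux|x [k _]]; last first.
    by rewrite /F; case: unpickle => // i; case: pselect => // -[_ ]; exact.
  have [V oV [Vx hV]] := h x Ux.
  have [q [k [qx qV]]] := rat_eball (openI oV oU) (conj Vx Ux).
  exists (pickle (q, k)) => //; rewrite /F pickleK; case: pselect => // -[].
  split; last by apply: subset_trans qV _ => ? [].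
  by apply: hV; apply: subset_trans qV _ => ? [].
apply: Pcup => k; rewrite /F; case: unpickle => // i.
by case: pselect => // -[].
Qed.

Lemma measurable_open U : open U -> measurable U.
Proof.
move=> oU; apply: open_measurable_ind => //.
  by move=> F mF; exact: bigcup_measurable.
by move=> x Ux; exists U => //; split => // y s _ _; exact: measurable_eball.
Qed.

Lemma lebesgueRn_cube x r : 0 <= r -> mu (box ((x : 'rV[R]_n) - const_mx r)
  ((x : 'rV[R]_n) + const_mx r) : set (Rn R n)) = ((2 * r) ^+ n)%:E.
Proof.
move=> r0; rewrite lebesgueRn_box; last first.
  by move=> i; rewrite !mxE; lra.
congr EFin; rewrite -[n in RHS]card_ord -prodr_const.
by apply: eq_bigr => i _; rewrite !mxE; lra.
Qed.

Lemma eball_sub_cube x r : eball x r `<=` box ((x : 'rV[R]_n) - const_mx r)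
  ((x : 'rV[R]_n) + const_mx r).
Proof.
move=> y /eballE xy i; rewrite !mxE.
have := le_lt_trans (enorm_coord ((y : 'rV[R]_n) - x) i) xy.
by rewrite !mxE ltr_norml => /andP[? ?]; apply/andP; split; lra.
Qed.

(** Volumes of balls are only compared with those of a circumscribed and an inscribed cube:
    two-sided bounds by multiples of r^n are all that the proof uses. *)
Lemma lebesgueRn_eball_le x r : 0 < r -> (mu (eball x r) <= ((2 * r) ^+ n)%:E)%E.
Proof.
move=> r0; rewrite -(lebesgueRn_cube x (ltW r0)); apply: le_measure.
- by rewrite inE; exact: measurable_eball.
- by rewrite inE; exact: measurable_boxRn.
- exact: eball_sub_cube.
Qed.

Lemma lebesgueRn_eball_ge x r : (0 < n)%N -> 0 < r ->
  (((r / n%:R) ^+ n)%:E <= mu (eball x r))%E.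
Proof.
move=> n0 r0; have n0' : 0 < n%:R :> R by rewrite ltr0n.
have -> : r / n%:R = 2 * (r / (2 * n%:R)) by field; rewrite gt_eqF.
have s0 : 0 < r / (2 * n%:R) by rewrite divr_gt0// mulr_gt0.
rewrite -(lebesgueRn_cube x (ltW s0)); apply: le_measure.
- by rewrite inE; exact: measurable_boxRn.
- by rewrite inE; exact: measurable_eball.
move=> y h; apply/eballE.
apply: (@le_lt_trans _ _ (n%:R * (r / (2 * n%:R)))).
  apply: enorm_le => i; have := h i; rewrite !mxE ler_norml.
  by move=> /andP[? ?]; apply/andP; split; lra.
have -> : n%:R * (r / (2 * n%:R)) = r / 2 by field; rewrite gt_eqF.
lra.
Qed.

Lemma lebesgueRn_eball_fin x r : mu (eball x r) \is a fin_num.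
Proof.
rewrite ge0_fin_numE//.
have r0 : 0 < `|r| + 1 by rewrite ltr_pwDr.
apply: le_lt_trans (_ : (_ <= mu (eball x (`|r| + 1)))%E) _; last first.
  by apply: le_lt_trans (lebesgueRn_eball_le x r0) _; rewrite ltry.
apply: le_measure; rewrite ?inE; [exact: measurable_eball..|].
by apply: eball_le; rewrite ler_wpDr// ler_norm.
Qed.

End topology_measure.

(** * Weighted measures and small sets *)

Section finite_content.
Context d {T : measurableType d} {R : realType}.
Implicit Types (f : set T -> R) (A B : set T).

(** Measures of [A] intersected with a fixed set of finite mass, read as real numbers, have this
    form. Additivity suffices for most of the argument; where continuity along increasing sequences
    is used it is a separate hypothesis. *)
Definition content_like f := (forall A, measurable A -> 0 <= f A) /\
  forall A B, measurable A -> measurable B -> A `&` B = set0 ->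
    f (A `|` B) = f A + f B.

Section theory.
Variable f : set T -> R.
Hypothesis hf : content_like f.

Lemma content_like_ge0 A : measurable A -> 0 <= f A. Proof. exact: hf.1. Qed.

Lemma content_likeD A B : measurable A -> measurable B -> A `<=` B ->
  f (B `\` A) = f B - f A.
Proof.
move=> mA mB AB; have := hf.2 A (B `\` A) mA (measurableD mB mA) (setDIK _ _).
by rewrite setDUK// => ->; rewrite addrAC subrr add0r.
Qed.

Lemma content_like_le A B : measurable A -> measurable B -> A `<=` B -> f A <= f B.
Proof.
move=> mA mB AB; have := content_like_ge0 (measurableD mB mA).
by rewrite content_likeD// subr_ge0.
Qed.

Lemma content_likeU_le A B : measurable A -> measurable B ->
  f (A `|` B) <= f A + f B.
Proof.
move=> mA mB; have -> : A `|` B = A `|` (B `\` A).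
  apply/seteqP; split => x; last by case=> [|[]]; [left|right].
  by case: (pselect (A x)) => ? [?|?]; [left|left|left|right].
rewrite hf.2//; [|exact: measurableD|exact: setDIK].
by rewrite lerD2l content_like_le//; exact: measurableD.
Qed.

Lemma content_like_cover (L : nat) (F : 'I_L -> set T) A : measurable A ->
  (forall i, measurable (F i)) -> A `<=` \bigcup_i F i ->
  f A <= \sum_(i < L) f (F i).
Proof.
elim: L F A => [|L IH] F A mA mF AF.
  rewrite big_ord0 (_ : A = set0); last first.
    by rewrite -subset0 => x /AF[[]].
  have := hf.2 set0 set0 measurable0 measurable0 (setI0 _).
  by rewrite setU0 => /eqP; rewrite -subr_eq0 opprD addrA subrr add0r oppr_eq0 => /eqP->.
rewrite big_ord_recr /= -(setUIDK A (F ord_max)).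
have m1 : measurable (A `&` F ord_max) by exact: measurableI.
have m2 : measurable (A `\` F ord_max) by exact: measurableD.
rewrite (le_trans (content_likeU_le m1 m2))// addrC; apply: lerD.
  by apply: content_like_le => // x [].
apply: (IH (fun i => F (widen_ord (leqnSn L) i))) => //.
  move=> x [/AF[i _ Fix] nF]; have := ltn_ord i; rewrite leq_eqVlt => /predU1P[iL|iL].
    by exfalso; apply: nF; rewrite (_ : ord_max = i)//; apply: val_inj => /=; case: iL.
  rewrite ltnS in iL; exists (Ordinal iL) => //.
  by rewrite (_ : widen_ord _ _ = i)//; exact: val_inj.
Qed.

End theory.

Lemma content_like_restrict (mu : measure T R) (V : set T) : measurable V ->
  (mu V < +oo)%E -> content_like (fun A => fine (mu (A `&` V))).
Proof.
move=> mV Voo.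
have fin A : measurable A -> mu (A `&` V) \is a fin_num.
  move=> mA; rewrite ge0_fin_numE// (le_lt_trans _ Voo)// le_measure// inE//.
  exact: measurableI.
split=> [A mA|A B mA mB AB0]; first exact/fine_ge0/measure_ge0.
rewrite setIUl measureU//; [|exact: measurableI..|]; first by rewrite fineD// fin.
by rewrite setIACA AB0 set0I.
Qed.

End finite_content.

Section weighted_measure.
Local Open Scope ereal_scope.
Context d (T : measurableType d) (R : realType).
Variables (mu : {measure set T -> \bar R}) (w : T -> R).
Hypotheses (mw : measurable_fun setT w) (w0 : forall x, (0 <= w x)%R).

(** The two proofs are arguments so that the instance below can make [weighted mw w0] a measure. *)
Definition weighted (_ : measurable_fun setT w) (_ : forall x, (0 <= w x)%R)
  (A : set T) := \int[mu]_(x in A) (w x)%:E.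

Let nu := weighted mw w0.

Let mEw A : measurable_fun A (fun x => (w x)%:E).
Proof. by apply/measurable_EFinP; exact: measurable_funTS. Qed.

Let Ew0 x : 0 <= (w x)%:E. Proof. by rewrite lee_fin. Qed.

Let weighted0 : nu set0 = 0. Proof. exact: integral_set0. Qed.

Let weighted_ge0 A : 0 <= nu A. Proof. exact: integral_ge0. Qed.

Let weighted_sigma_additive : semi_sigma_additive nu.
Proof.
move=> F mF tF mUF; rewrite /nu /weighted ge0_integral_bigcup//.
by apply: is_cvg_nneseries => n _ _; exact: integral_ge0.
Qed.

HB.instance Definition _ := isMeasure.Build _ _ _ (weighted mw w0)
  weighted0 weighted_ge0 weighted_sigma_additive.

Lemma weighted_le (t : R) A : measurable A -> (forall x, A x -> w x <= t)%R ->
  (0 <= t)%R -> nu A <= t%:E * mu A.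
Proof.
move=> mA h t0; by rewrite -integral_cst//; exact: ge0_le_integral.
Qed.

Lemma weighted_ge (t : R) A : measurable A -> (forall x, A x -> t <= w x)%R ->
  (0 <= t)%R -> t%:E * mu A <= nu A.
Proof.
move=> mA h t0; by rewrite -integral_cst//; exact: ge0_le_integral.
Qed.

End weighted_measure.

Section reverse_Holder.
Context {R : realType}.

(** Above [K], write v = v^(1-q) v^q; since 1 - q < 0, the first factor is at most K^(1-q). *)
Lemma le_powR_truncation (K q v : R) : 0 < K -> 1 < q -> 0 <= v ->
  v <= K + K `^ (1 - q) * v `^ q.
Proof.
move=> K0 q1 v0; have [vK|Kv] := leP v K.
  by rewrite ler_wpDr// mulr_ge0// powR_ge0.
apply: ler_wpDl; first exact: ltW.
have q0 : 0 < q by apply: lt_trans q1.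
rewrite -(mulr_powRB1 v0 q0).
rewrite mulrCA ler_peMr// -opprB powRN mulrC ler_pdivlMr ?mul1r ?powR_gt0//.
by apply: ge0_ler_powR; rewrite ?nnegrE ?subr_ge0 ?ltW// (lt_trans K0).
Qed.

(* Splitting [w <= K + K^(1-q) w^q] with a suitable multiple [K] of the       *)
(* average over [A2] replaces Holder's inequality.                            *)
Lemma reverse_Holder_small_sets (q B e : R) : 1 < q -> 0 < B -> 0 < e ->
  exists2 dl : R, 0 < dl &
  forall d (T : measurableType d) (mu : {measure set T -> \bar R}) (w : T -> R)
    (A A2 E : set T), measurable_fun setT w -> (forall x, 0 <= w x) ->
    measurable A -> measurable A2 -> measurable E -> A `<=` A2 -> E `<=` A ->
    (0 < mu A)%E -> (mu A2 < +oo)%E ->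
    (\int[mu]_(x in A2) (w x)%:E < +oo)%E ->
    (((mu A)^-1 * \int[mu]_(x in A) (w x `^ q)%:E) `^ q^-1 <=
      B%:E * ((mu A2)^-1 * \int[mu]_(x in A2) (w x)%:E))%E ->
    (mu E <= dl%:E * mu A)%E ->
    (\int[mu]_(x in E) (w x)%:E <= e%:E * \int[mu]_(x in A2) (w x)%:E)%E.
Proof.
(* With K equal to [Lam * B] times the average over [A2], this value makes the integral of K^(1-q)
   w^q at most e/2 times the mass of [A2]. The delta chosen below makes K mu(E) at most the other
   half. Both depend on q, B and e only. *)
move=> q1 B0 e0; pose Lam := (e / (2 * B)) `^ (1 - q)^-1.
have q0 : 0 < q by apply: lt_trans q1.
have q1n : 1 - q != 0 by rewrite subr_eq0 lt_eqF.
have eB0 : 0 < e / (2 * B) by rewrite divr_gt0// mulr_gt0.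
have Lam0 : 0 < Lam by rewrite powR_gt0.
have LamE : Lam `^ (1 - q) = e / (2 * B).
  by rewrite /Lam -powRrM mulVf// powRr1// ltW.
exists (e / (2 * B * Lam)); first by rewrite divr_gt0// !mulr_gt0.
move=> d T mu w A A2 E mw w0 mA mA2 mE AA2 EA muA0 muA2 WA2 rH Edl.
have EA2 := subset_trans EA AA2.
have mEw C : measurable_fun C (fun x => (w x)%:E).
  by apply/measurable_EFinP; exact: measurable_funTS.
have mEwq C : measurable_fun C (fun x => (w x `^ q)%:E).
  apply/measurable_EFinP; apply: measurable_funTS.
  exact: (measurableT_comp (measurable_powR q) mw).
have muAA2 : (mu A <= mu A2)%E by rewrite le_measure// inE.
have muAfin : mu A \is a fin_num by rewrite ge0_fin_numE// (le_lt_trans muAA2).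
have muA2fin : mu A2 \is a fin_num by rewrite ge0_fin_numE.
set W2 := (\int[mu]_(x in A2) (w x)%:E)%E in WA2 rH *.
have W20 : (0 <= W2)%E by apply: integral_ge0 => x _; rewrite lee_fin.
have W2fin : W2 \is a fin_num by rewrite ge0_fin_numE.
have EW2 : (\int[mu]_(x in E) (w x)%:E <= W2)%E.
  by apply: ge0_subset_integral => // x _; rewrite lee_fin.
(* If [A2] carries no mass, the truncation level K would be 0. *)
have [W2z|W2z] := eqVneq W2 0%E; first by rewrite W2z mule0 -W2z.
have W2p : (0 < W2)%E by rewrite lt_def W2z.
pose a := fine (mu A); pose a2 := fine (mu A2); pose s := fine W2.
have a0 : 0 < a by rewrite fine_gt0// muA0 -ge0_fin_numE.
have aa2 : a <= a2 by rewrite fine_le.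
have a20 : 0 < a2 by exact: lt_le_trans aa2.
have s0 : 0 < s by rewrite fine_gt0// W2p -ge0_fin_numE.
have muAE : mu A = a%:E by rewrite fineK.
have muA2E : mu A2 = a2%:E by rewrite fineK.
have W2E : W2 = s%:E by rewrite fineK.
pose b := B * (s / a2); have b0 : 0 < b by rewrite mulr_gt0// divr_gt0.
have Iq0 : (0 <= \int[mu]_(x in A) (w x `^ q)%:E)%E.
  by apply: integral_ge0 => x _; rewrite lee_fin powR_ge0.
have Iq : (\int[mu]_(x in A) (w x `^ q)%:E <= (a * b `^ q)%:E)%E.
  move: rH; rewrite muAE muA2E W2E !inver !gt_eqF// -!EFinM.
  rewrite [a2^-1 * s]mulrC -/b => rH.
  have c0 : (0 <= (a^-1)%:E * \int[mu]_(x in A) (w x `^ q)%:E)%E.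
    by rewrite mule_ge0// lee_fin invr_ge0 ltW.
  have := @gt0_ler_poweR _ q (ltW q0) _ _ _ _ rH.
  rewrite -poweRrM mulVf ?gt_eqF// poweRe1// poweR_EFin lee_pdivrMl//.
  rewrite -EFinM; apply; rewrite in_itv/= ?leey ?andbT//.
    by rewrite poweR_ge0.
  by rewrite lee_fin ltW.
pose K := Lam * b; have K0 : 0 < K by rewrite mulr_gt0.
have KE : K `^ (1 - q) * b `^ q = e / (2 * B) * b.
  rewrite powRM ?ltW// LamE -mulrA; congr (_ * _).
  rewrite -powRD; last by rewrite (gt_eqF b0) implybT.
  by rewrite subrK powRr1// ltW.
have -> : (e%:E * W2 = (K * (e / (2 * B * Lam) * a2) + e / (2 * B) * b * a2)%:E)%E.
  rewrite W2E -EFinM; congr EFin; rewrite /K /b; field.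
  by rewrite !gt_eqF.
apply: (@le_trans _ _ (\int[mu]_(x in E)
    (K%:E + (K `^ (1 - q))%:E * (w x `^ q)%:E))%E).
  apply: ge0_le_integral => //.
  - by move=> x _; rewrite lee_fin.
  - by apply: emeasurable_funD => //; exact: measurable_funeM.
  - by move=> x _; rewrite -EFinM -EFinD lee_fin le_powR_truncation.
have Kq0 : 0 <= K `^ (1 - q) by rewrite powR_ge0.
rewrite ge0_integralD//; last 3 first.
- by move=> x _; rewrite lee_fin ltW.
- by move=> x _; rewrite mule_ge0// lee_fin ?powR_ge0.
- exact: measurable_funeM.
rewrite EFinD leeD//.
  rewrite integral_cst// [leRHS]EFinM.
  apply: (@lee_wpmul2l _ K%:E); first by rewrite lee_fin ltW.
  rewrite (le_trans Edl)// muAE -EFinM lee_fin ler_wpM2l//.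
  by rewrite divr_ge0 ?ltW// !mulr_gt0.
rewrite ge0_integralZl//; last by move=> x _; rewrite lee_fin powR_ge0.
apply: (@le_trans _ _ ((K `^ (1 - q))%:E * (a * b `^ q)%:E)%E).
  apply: lee_wpmul2l; first by rewrite lee_fin.
  apply: le_trans Iq; apply: ge0_subset_integral => //.
  by move=> x _; rewrite lee_fin powR_ge0.
rewrite -EFinM mulrCA KE lee_fin mulrC ler_wpM2l//.
by rewrite mulr_ge0 ?ltW.
Qed.

End reverse_Holder.

(** * BMO implies doubling *)

Section log_oscillation.
Context d {T : measurableType d} {R : realType}.
Variables (m W : set T -> R) (w : T -> R).
Hypotheses (hm : content_like m) (hW : content_like W).
Hypothesis mw : measurable_fun setT w.
Hypothesis W_le : forall t A, measurable A -> 0 <= t ->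
  (forall x, A x -> w x <= t) -> W A <= t * m A.
Hypothesis W_ge : forall t A, measurable A -> 0 <= t ->
  (forall x, A x -> t <= w x) -> t * m A <= W A.

(** Written with exponentials so that a zero of [w] counts as a point where log w is far below [c];
    the convention ln 0 = 0 would misplace it. *)
Definition log_outside (c t : R) : set T :=
  [set y | w y < expR (c - t) \/ expR (c + t) < w y].

(* The weak-type consequence of a BMO bound on [log w]. *)
Definition log_osc (A : set T) (c D : R) : Prop := forall t, 0 < t ->
  m (A `&` log_outside c t) <= D / t ^+ 2 * m A.

Lemma measurable_log_outside c t : measurable (log_outside c t).
Proof.
rewrite (_ : log_outside c t = (setT `&` w @^-1` `]-oo, expR (c - t)[%classic) `|`
  (setT `&` w @^-1` `]expR (c + t), +oo[%classic)).
  by apply: measurableU; apply: mw => //; exact: measurable_itv.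
apply/seteqP; split => [y [h|h]|y [[_]|[_]]]; rewrite /= in_itv/= ?andbT => *.
- by left; split => //=; rewrite in_itv.
- by right; split => //=; rewrite in_itv/= andbT.
- by left.
- by right.
Qed.

(** The two exceptional sets together have measure less than that of [A], because D (1 + K) < t^2.
    So [A] has a point outside both, where log w is within [t] of [c] and of [c']. *)
Lemma log_osc_compare (A A' : set T) (c c' D K t : R) :
  measurable A -> measurable A' -> A `<=` A' -> 0 < m A -> m A' <= K * m A ->
  0 <= D -> 0 < t -> D * (1 + K) < t ^+ 2 ->
  log_osc A c D -> log_osc A' c' D -> `|c - c'| <= 2 * t.
Proof.
move=> mA mA' AA' mA0 mK D0 t0 Dt oA oA'.
have mb := measurable_log_outside.
have [y [Ay [ny ny']]] : exists y, A y /\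
    ~ log_outside c t y /\ ~ log_outside c' t y.
  apply: contrapT => nex.
  have : m A <= m ((A `&` log_outside c t) `|` (A' `&` log_outside c' t)).
    apply: content_like_le => //; first by apply: measurableU; exact: measurableI.
    move=> y Ay; apply: contrapT => /not_orP[h1 h2]; apply: nex; exists y.
    by split => //; split => h; [apply: h1|apply: h2; split => //; exact: AA'].
  have := @content_likeU_le _ _ _ _ hm (A `&` log_outside c t)
    (A' `&` log_outside c' t) (measurableI _ _ mA (mb _ _)) (measurableI _ _ mA' (mb _ _)).
  have h1 := oA _ t0; have h2 := oA' _ t0 => h3 h4.
  have t20 : 0 < t ^+ 2 by rewrite exprn_gt0.
  have : D / t ^+ 2 * m A' <= D / t ^+ 2 * (K * m A).
    by apply: ler_wpM2l => //; rewrite divr_ge0// ltW.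
  have : D * (1 + K) / t ^+ 2 * m A < 1 * m A.
    by rewrite ltr_pM2r// ltr_pdivrMr// mul1r.
  have -> : D * (1 + K) / t ^+ 2 * m A =
    D / t ^+ 2 * m A + D / t ^+ 2 * (K * m A) by ring.
  lra.
move: ny ny' => /not_orP[/negP + /negP +] /not_orP[/negP + /negP +].
rewrite -!leNgt => h1 h2 h3 h4.
have := le_trans h1 h4; have := le_trans h3 h2; rewrite !ler_expR.
by move=> ? ?; rewrite ler_norml; apply/andP; split; lra.
Qed.

(** * Abstract balls: comparing centres and absorbing the exceptional set *)

Variables (ball : T -> R -> set T) (V : set T) (n : nat) (c0 C0 : R).
Variables (c : T -> R -> R) (D : R).
Hypotheses (mball : forall x r, measurable (ball x r)) (mV : measurable V).
Hypotheses (c0_gt0 : 0 < c0) (C0_gt0 : 0 < C0) (D_ge0 : 0 <= D).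
Hypothesis vol : forall x r, 0 < r -> ball x r `<=` V ->
  c0 * r ^+ n <= m (ball x r) <= C0 * r ^+ n.

Let vol_gt0 x r : 0 < r -> ball x r `<=` V -> 0 < m (ball x r).
Proof.
move=> r0 xV; case/andP: (vol r0 xV) => + _; apply: lt_le_trans.
by rewrite mulr_gt0// exprn_gt0.
Qed.

Let ball_compare x r y s K t : 0 < r -> 0 < s -> ball x r `<=` ball y s ->
  ball y s `<=` V -> s <= K * r -> 0 < K -> 0 < t ->
  D * (1 + C0 * K ^+ n / c0) < t ^+ 2 ->
  log_osc (ball x r) (c x r) D -> log_osc (ball y s) (c y s) D ->
  `|c x r - c y s| <= 2 * t.
Proof.
move=> r0 s0 xy yV sK K0 t0 Dt; apply: log_osc_compare Dt => //.
  by apply: vol_gt0 => //; exact: subset_trans yV.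
case/andP: (vol s0 yV) => _ /le_trans; apply.
case/andP: (vol r0 (subset_trans xy yV)) => h _.
have -> : C0 * K ^+ n / c0 * m (ball x r) = C0 * (K ^+ n * (m (ball x r) / c0)).
  by ring.
rewrite ler_pM2l//; apply: le_trans (_ : K ^+ n * r ^+ n <= _).
  by rewrite -exprMn; apply: lerXn2r => //; rewrite nnegrE ltW// mulr_gt0.
by rewrite ler_wpM2l ?exprn_ge0 ?(ltW K0)// ler_pdivlMr// mulrC.
Qed.

Section absorption.
Variables (L : nat) (e dl t t' M : R).
Hypothesis cover : forall y r, 0 < r -> exists z : 'I_L -> T,
  (forall i, ball (z i) (2 * r) `<=` ball y (4 * r) /\
             ball (z i) (4 * r) `<=` ball y (8 * r)) /\
  ball y (2 * r) `<=` \bigcup_i ball (z i) (r / 2).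
Hypothesis ball_mono : forall y r s, r <= s -> ball y r `<=` ball y s.
Hypothesis osc : forall y r, 0 < r -> ball y (2 * r) `<=` V ->
  log_osc (ball y r) (c y r) D.
Hypothesis small : forall y r E, 0 < r -> ball y (2 * r) `<=` V ->
  measurable E -> E `<=` ball y r -> m E <= dl * r ^+ n ->
  W E <= e * W (ball y (2 * r)).
Hypotheses (e0 : 0 <= e) (t0 : 0 < t) (t'0 : 0 < t').
Hypothesis t_large : D * C0 * 4 ^+ n <= dl * t ^+ 2.
Hypothesis t'_large : D * (1 + C0 * 2 ^+ n / c0) < t' ^+ 2.
Hypothesis e_small : e * L%:R * expR (2 * t') <= 2^-1.

(** Outside the exceptional set w <= exp (c + t); the exceptional set has measure at most
    [dl * r ^+ n] by [t_large], so [small] applies to it. The centre is taken at radius 4r because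
    the next step uses balls with [ball (z i) (2 * r)] inside [ball y (4 * r)], whose centres
    compare directly. *)
Let step y r : 0 < r -> ball y (8 * r) `<=` V ->
  W (ball y r) <= expR (c y (4 * r) + t) * (C0 * r ^+ n) + e * W (ball y (2 * r)).
Proof.
move=> r0 yV; set ct := expR _.
have yV4 : ball y (4 * r) `<=` V by apply: subset_trans yV; apply: ball_mono; lra.
have yV2 : ball y (2 * r) `<=` V by apply: subset_trans yV; apply: ball_mono; lra.
have yV1 : ball y r `<=` V by apply: subset_trans yV; apply: ball_mono; lra.
pose E := ball y r `&` log_outside (c y (4 * r)) t.
have mE : measurable E by apply: measurableI => //; exact: measurable_log_outside.
have Er : E `<=` ball y r by move=> ? [].
have -> : ball y r = E `|` (ball y r `\` E) by rewrite setDUK.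
rewrite hW.2//; [|exact: measurableD|exact: setDIK].
rewrite addrC lerD//.
  apply: le_trans (_ : ct * m (ball y r `\` E) <= _).
    apply: W_le; [exact: measurableD|exact: expR_ge0|].
    move=> x [xr /not_andP[//|/not_orP[_ /negP]]]; by rewrite -leNgt.
  rewrite ler_wpM2l ?expR_ge0//.
  case/andP: (vol r0 yV1) => _; apply: le_trans.
  by apply: content_like_le; [|exact: measurableD| |exact: subDsetl].
apply: small => //.
have r40 : 0 < 4 * r by rewrite mulr_gt0.
apply: le_trans (_ : D / t ^+ 2 * m (ball y (4 * r)) <= _).
  apply: le_trans (osc r40 _ t0); last by rewrite mulrA (_ : 2 * 4 = 8)//; ring.
  apply: content_like_le => //.
    by apply: measurableI => //; exact: measurable_log_outside.
  by apply: setSI; apply: ball_mono; lra.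
case/andP: (vol r40 yV4) => _ h.
apply: le_trans (_ : D / t ^+ 2 * (C0 * (4 * r) ^+ n) <= _).
  by rewrite ler_wpM2l// divr_ge0// exprn_ge0// ltW.
have -> : D / t ^+ 2 * (C0 * (4 * r) ^+ n) = D * C0 * 4 ^+ n / t ^+ 2 * r ^+ n.
  by rewrite exprMn; ring.
by rewrite ler_wpM2r ?exprn_ge0 ?(ltW r0)// ler_pdivrMr ?exprn_gt0.
Qed.

(** Let X be the main term. One step gives X / 2 plus [e] times the mass of the double ball, which
    is covered by L balls of half the radius. Their centres exceed that of [ball y (4 * r)] by at
    most 2t', so by [e_small] they contribute at most X / 2 and half of the previous error. The
    factor 2 in X makes it a fixed point of this recursion. *)
Lemma absorption_iter j y r : 0 < r -> ball y (8 * r) `<=` V ->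
  W (ball y r) <= 2 * C0 * expR t * expR (c y (4 * r)) * r ^+ n + 2^-1 ^+ j * W V.
Proof.
elim: j y r => [|j IH] y r r0 yV.
  rewrite expr0 mul1r; apply: ler_wpDl.
    by rewrite !mulr_ge0 ?expR_ge0 ?exprn_ge0// ltW.
  apply: content_like_le => //; apply: subset_trans yV; apply: ball_mono; lra.
have yV4 : ball y (4 * r) `<=` V by apply: subset_trans yV; apply: ball_mono; lra.
have [z [hz cov]] := cover y r0.
have r20 : 0 < r / 2 by rewrite divr_gt0.
have hi i : W (ball (z i) (r / 2)) <= expR (2 * t') *
    (2 * C0 * expR t * expR (c y (4 * r)) * r ^+ n) + 2^-1 ^+ j * W V.
  have [h2 h4] := hz i.
  have E4 : 4 * (r / 2) = 2 * r by field.
  have E8 : 8 * (r / 2) = 4 * r by field.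
  have zV : ball (z i) (4 * r) `<=` V by exact: subset_trans yV.
  have := IH (z i) _ r20; rewrite E8 E4 => /(_ zV); move/le_trans; apply.
  rewrite lerD2r.
  have cz : c (z i) (2 * r) <= c y (4 * r) + 2 * t'.
    have r2 : 0 < 2 * r by rewrite mulr_gt0.
    have r4 : 0 < 4 * r by rewrite mulr_gt0.
    have : `|c (z i) (2 * r) - c y (4 * r)| <= 2 * t'.
      apply: (@ball_compare _ _ _ _ 2) => //; first by lra.
        by apply: osc => //; rewrite (_ : 2 * (2 * r) = 4 * r)//; ring.
      by apply: osc => //; rewrite (_ : 2 * (4 * r) = 8 * r)//; ring.
    by rewrite ler_norml => /andP[? ?]; lra.
  have -> : expR (2 * t') * (2 * C0 * expR t * expR (c y (4 * r)) * r ^+ n) =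
    (2 * C0 * expR t) * (expR (c y (4 * r) + 2 * t') * r ^+ n).
    by rewrite expRD; ring.
  rewrite -[leLHS]mulrA ler_wpM2l ?mulr_ge0 ?expR_ge0 ?(ltW C0_gt0)//.
  apply: ler_pM; rewrite ?expR_ge0 ?exprn_ge0 ?ler_expR ?(ltW r20)//.
  by apply: lerXn2r; rewrite ?nnegrE ?ltW//; lra.
have sumW : W (ball y (2 * r)) <= L%:R * (expR (2 * t') *
    (2 * C0 * expR t * expR (c y (4 * r)) * r ^+ n) + 2^-1 ^+ j * W V).
  apply: le_trans (content_like_cover hW _ _ cov) _ => //.
  rewrite mulr_natl -[L in X in _ <= X]card_ord -sumr_const.
  by apply: ler_sum => i _.
apply: le_trans (step r0 yV) _.
have WV0 : 0 <= 2^-1 ^+ j * W V.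
  by rewrite mulr_ge0 ?exprn_ge0//; exact: content_like_ge0.
have eL : e * L%:R <= 2^-1.
  apply: le_trans e_small; rewrite ler_peMr ?mulr_ge0// -expR0 ler_expR.
  by rewrite mulr_ge0// ltW.
set X := 2 * C0 * expR t * expR (c y (4 * r)) * r ^+ n in sumW *.
have X0 : 0 <= X by rewrite /X !mulr_ge0 ?expR_ge0 ?exprn_ge0// ltW.
have -> : expR (c y (4 * r) + t) * (C0 * r ^+ n) = X / 2.
  by rewrite expRD /X; field.
have h1 := ler_wpM2l e0 sumW.
have h2 := ler_wpM2r X0 e_small.
have h3 := ler_wpM2r WV0 eL.
rewrite exprS; move: h1 h2 h3 WV0; set Y := 2^-1 ^+ j * W V.
rewrite -[2^-1 * 2^-1 ^+ j * W V]mulrA -/Y.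
have -> : e * (L%:R * (expR (2 * t') * X + Y)) =
  e * L%:R * expR (2 * t') * X + e * L%:R * Y by ring.
lra.
Qed.

Lemma absorption y r : 0 < r -> ball y (8 * r) `<=` V ->
  W (ball y r) <= 2 * C0 * expR t * expR (c y (4 * r)) * r ^+ n.
Proof.
move=> r0 yV; rewrite leNgt; apply/negP; rewrite -subr_gt0.
have h j := absorption_iter j r0 yV; move: h; set X := _ * r ^+ n => h.
set g := _ - X => g0.
have WV0 : 0 <= W V by exact: content_like_ge0.
have [j hj] : exists j : nat, W V / g < j%:R.
  by exists (Num.truncn (W V / g)).+1; apply: truncnS_gt; rewrite divr_ge0// ltW.
have : 2^-1 ^+ j * W V < g.
  rewrite exprVn mulrC ltr_pdivrMr ?exprn_gt0// mulrC -ltr_pdivrMr//.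
  by rewrite (lt_trans hj)// -natrX ltr_nat ltn_expl.
by have := h j; rewrite /g; lra.
Qed.

(** From below, half of [ball x r] has w >= exp (c - u). From above, absorption bounds each ball of
    a cover of [ball x (2 * r)]. The centres are linked by three comparisons, each costing 2s:
    [ball (z i) (r / 2)] may stick out of [ball x (2 * r)], so the chain passes through the smaller
    [ball (z' i) (r / 4)] contained in both, then from [ball x (2 * r)] to [ball x r]. The largest
    ratio of radii is 8. The oscillation bound on [ball x (2 * r)] is a separate hypothesis, since
    the double of that ball may leave V. *)
Lemma doubling_of_log_osc (N : nat) (z z' : 'I_N -> T) (s u : R) x r : 0 < r ->
  ball x (2 * r) `<=` V -> log_osc (ball x (2 * r)) (c x (2 * r)) D ->
  ball x (2 * r) `<=` \bigcup_i ball (z i) (r / 8) ->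
  (forall i, [/\ ball (z i) r `<=` V, ball (z' i) (r / 2) `<=` V,
    ball (z' i) (r / 4) `<=` ball (z i) (r / 2) &
    ball (z' i) (r / 4) `<=` ball x (2 * r)]) ->
  0 < s -> D * (1 + C0 * 8 ^+ n / c0) < s ^+ 2 ->
  0 < u -> D / u ^+ 2 <= 2^-1 ->
  W (ball x (2 * r)) <=
    (N%:R * 4 * C0 * expR (t + 6 * s + u) / c0) * W (ball x r).
Proof.
move=> r0 xV osc2 cov hz s0 Ds u0 Du.
have r20 : 0 < r / 2 by rewrite divr_gt0.
have r40 : 0 < r / 4 by rewrite divr_gt0.
have r80 : 0 < r / 8 by rewrite divr_gt0.
have rr0 : 0 < 2 * r by rewrite mulr_gt0.
have xV1 : ball x r `<=` V by apply: subset_trans xV; apply: ball_mono; lra.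
have osc1 : log_osc (ball x r) (c x r) D by exact: osc.
have lower : expR (c x r - u) * (2^-1 * (c0 * r ^+ n)) <= W (ball x r).
  pose G := ball x r `\` log_outside (c x r) u.
  have mG : measurable G by apply: measurableD => //; exact: measurable_log_outside.
  apply: le_trans (_ : W G <= _); last first.
    by apply: content_like_le => //; exact: subDsetl.
  apply: le_trans (W_ge mG (expR_ge0 (c x r - u)) _); last first.
    by move=> y [_ /not_orP[/negP + _]]; rewrite -leNgt.
  rewrite ler_wpM2l ?expR_ge0//.
  have -> : G = ball x r `\` (ball x r `&` log_outside (c x r) u) by rewrite setDIr setDv set0U.
  have mo := measurable_log_outside (c x r) u.
  rewrite content_likeD//; last exact: measurableI.
  have h1 := osc1 _ u0; case/andP: (vol r0 xV1) => h2 _.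
  have mx0 : 0 <= m (ball x r) by exact: content_like_ge0.
  have h3 := ler_wpM2r mx0 Du.
  lra.
have upper i : W (ball (z i) (r / 8)) <=
    2 * C0 * expR t * expR (c x r + 6 * s) * r ^+ n.
  have [zV z'V z'z z'x] := hz i.
  have E8 : 8 * (r / 8) = r by field.
  have E4 : 4 * (r / 8) = r / 2 by field.
  have E2 : 2 * (r / 2) = r by field.
  have E24 : 2 * (r / 4) = r / 2 by field.
  have := @absorption (z i) _ r80; rewrite E8 E4 => /(_ zV) /le_trans; apply.
  have o1 : log_osc (ball (z i) (r / 2)) (c (z i) (r / 2)) D.
    by apply: osc => //; rewrite E2.
  have o2 : log_osc (ball (z' i) (r / 4)) (c (z' i) (r / 4)) D.
    by apply: osc => //; rewrite E24.
  have zV2 : ball (z i) (r / 2) `<=` V.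
    by apply: subset_trans zV; apply: ball_mono; lra.
  have k1 : `|c (z' i) (r / 4) - c (z i) (r / 2)| <= 2 * s.
    by apply: (@ball_compare _ _ _ _ 8) => //; lra.
  have k2 : `|c (z' i) (r / 4) - c x (2 * r)| <= 2 * s.
    by apply: (@ball_compare _ _ _ _ 8) => //; lra.
  have k3 : `|c x r - c x (2 * r)| <= 2 * s.
    by apply: (@ball_compare _ _ _ _ 8) => //; [apply: ball_mono; lra|lra].
  move: k1 k2 k3; rewrite !ler_norml => /andP[? ?] /andP[? ?] /andP[? ?].
  rewrite -!mulrA !ler_wpM2l ?expR_ge0 ?(ltW C0_gt0)//.
  apply: ler_pM; rewrite ?expR_ge0 ?exprn_ge0 ?ler_expR ?(ltW r80)//; first by lra.
  by apply: lerXn2r; rewrite ?nnegrE ?ltW//; lra.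
apply: le_trans (content_like_cover hW _ _ cov) _ => //.
apply: le_trans (_ : N%:R * (2 * C0 * expR t * expR (c x r + 6 * s) * r ^+ n) <= _).
  rewrite mulr_natl -[N in X in _ <= X]card_ord -sumr_const.
  by apply: ler_sum => i _.
have -> : N%:R * (2 * C0 * expR t * expR (c x r + 6 * s) * r ^+ n) =
  N%:R * 4 * C0 * expR (t + 6 * s + u) / c0 *
  (expR (c x r - u) * (2^-1 * (c0 * r ^+ n))).
  rewrite !expRD expRN; field; rewrite !gt_eqF ?expR_gt0//.
rewrite ler_wpM2l// divr_ge0 ?(ltW c0_gt0)// !mulr_ge0 ?expR_ge0//.
exact: ltW.
Qed.

End absorption.
End log_oscillation.

(** * Chebyshev's inequality for the extended-real logarithm *)

Section chebyshev.
Local Open Scope ereal_scope.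
Context d (T : measurableType d) (R : realType).
Variables (mu : {measure set T -> \bar R}) (w : T -> R).
Hypotheses (mw : measurable_fun setT w) (w0 : forall x, (0 <= w x)%R).

Lemma measurable_lne_comp : measurable_fun setT (fun y => lne (w y)%:E).
Proof.
rewrite (_ : (fun y => _) = fun y => if (w y <= 0)%R then -oo else (ln (w y))%:E) //.
apply: measurable_fun_ifT => //.
- by apply: measurable_fun_ler.
- apply/measurable_EFinP.
  exact: (measurableT_comp (@measurable_ln R) mw).
Qed.

Let sqdist (av : \bar R) y : \bar R := `|lne (w y)%:E - av| ^+ 2.

Lemma measurable_sqdist_lne av : measurable_fun setT (sqdist av).
Proof.
have mf : measurable_fun setT (fun y => `|lne (w y)%:E - av|).
  apply: measurableT_comp => //; apply: emeasurable_funB => //.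
  exact: measurable_lne_comp.
rewrite /sqdist; under eq_fun do rewrite expe2.
exact: emeasurable_funM.
Qed.

Lemma measurable_lne_far av (t : R) :
  measurable [set y | t%:E <= `|lne (w y)%:E - av|].
Proof.
have mf : measurable_fun setT (fun y => `|lne (w y)%:E - av|).
  apply: measurableT_comp => //; apply: emeasurable_funB => //.
  exact: measurable_lne_comp.
rewrite (_ : [set y | _] = setT `&` (fun y => `|lne (w y)%:E - av|) @^-1`
    `[t%:E, +oo[%classic).
  exact: mf measurableT _ (emeasurable_itv _).
by apply/seteqP; split => y /=; rewrite in_itv/= andbT; [|case].
Qed.

Lemma chebyshev_lne (A : set T) (av : \bar R) (D t : R) : measurable A ->
  0 < mu A -> mu A < +oo -> (0 < t)%R ->
  (mu A)^-1 * \int[mu]_(y in A) sqdist av y <= D%:E ->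
  mu (A `&` [set y | t%:E <= `|lne (w y)%:E - av|]) <= (D / t ^+ 2)%:E * mu A.
Proof.
move=> mA muA0 muAoo t0 h.
have fA : mu A \is a fin_num by rewrite ge0_fin_numE// ltW.
have a0 : (0 < fine (mu A))%R by rewrite fine_gt0// muA0.
have t20 : (0 < t ^+ 2)%R by rewrite exprn_gt0.
have ms : measurable_fun A (sqdist av).
  by apply: measurable_funTS; exact: measurable_sqdist_lne.
have mE : measurable (A `&` [set y | t%:E <= `|lne (w y)%:E - av|]).
  by apply: measurableI => //; exact: measurable_lne_far.
rewrite -(fineK fA) inver gt_eqF// lee_pdivrMl// in h.
set E := A `&` _ in mE *.
have s0 y : 0 <= sqdist av y by rewrite /sqdist expe_ge0.
have : (t ^+ 2)%:E * mu E <= \int[mu]_(y in A) sqdist av y.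
  apply: (@le_trans _ _ (\int[mu]_(y in E) sqdist av y)); last first.
    by apply: ge0_subset_integral => //; exact: subIsetl.
  rewrite -integral_cst//; apply: ge0_le_integral => //.
  - by move=> x _; rewrite lee_fin ltW.
  - exact: measurable_funS mA (@subIsetl _ _ _) ms.
  - move=> x [_ /= tx]; rewrite /sqdist expe2 EFin_expe expe2.
    by apply: lee_pmul => //; rewrite lee_fin ltW.
move=> /le_trans /(_ h); rewrite (fineK fA) => k.
rewrite mulrC EFinM -muleA -(@lee_pdivrMl _ (t ^+ 2)^-1) ?invr_gt0// invrK.
by rewrite (le_trans k)// muleC.
Qed.

(** A non-finite average would put every point of [A] at infinite distance from it, and Chebyshev at
    the threshold 2D + 1 would bound mu(A) by D / (2D + 1)^2 < 1 times itself. So [fine av] is the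
    genuine average. Zeros of [w] lie at infinite distance from it, hence in the Chebyshev set. *)
Lemma chebyshev_log_osc (A : set T) (D t : R) : measurable A ->
  0 < mu A -> mu A < +oo -> (0 < t)%R -> (0 <= D)%R ->
  let av := (mu A)^-1 * \int[mu]_(y in A) lne (w y)%:E in
  (mu A)^-1 * \int[mu]_(y in A) sqdist av y <= D%:E ->
  mu (A `&` log_outside w (fine av) t) <= (D / t ^+ 2)%:E * mu A.
Proof.
move=> mA muA0 muAoo t0 D0 av h.
have fA : mu A \is a fin_num by rewrite ge0_fin_numE// ltW.
have a0 : (0 < fine (mu A))%R by rewrite fine_gt0// muA0.
have fav : av \is a fin_num.
  apply/negPn/negP => nfav.
  have s0 : (0 < 2 * D + 1)%R by rewrite ltr_wpDl// mulr_ge0.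
  have := chebyshev_lne mA muA0 muAoo s0 h.
  rewrite (_ : A `&` _ = A); last first.
    apply/setIidPl => y _.
    change ((2 * D + 1)%:E <= `|lne (w y)%:E - av|); move: nfav.
    move: (lne (w y)%:E) => v.
    by case: av {h} => [//||] _; case: v => [?||] /=; rewrite ?leey.
  rewrite -(fineK fA) -EFinM lee_fin -{1}[fine (mu A)]mul1r ler_pM2r//.
  rewrite ler_pdivlMr ?exprn_gt0// mul1r => k.
  have D2 := sqr_ge0 D.
  have E : ((2 * D + 1) ^+ 2 = 4 * D ^+ 2 + 4 * D + 1)%R by ring.
  by move: k; rewrite E; lra.
apply: le_trans (chebyshev_lne mA muA0 muAoo t0 h).
apply: le_measure; rewrite ?inE.
- by apply: measurableI => //; exact: measurable_log_outside.
- by apply: measurableI => //; exact: measurable_lne_far.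
move=> y [Ay Oy]; split => //.
change (t%:E <= `|lne (w y)%:E - av|).
have := w0 y; rewrite le_eqVlt => /predU1P[wy|wy].
  by rewrite -wy le0_lneNy// -(fineK fav) /= leey.
rewrite lne_EFin// -(fineK fav) -EFinB /= lee_fin.
case: Oy => Oy.
  have : (ln (w y) < fine av - t)%R by rewrite -(expRK (fine av - t)%R) ltr_ln ?posrE ?expR_gt0.
  by move=> k; rewrite ler0_norm; lra.
have : (fine av + t < ln (w y))%R by rewrite -(expRK (fine av + t)%R) ltr_ln ?posrE ?expR_gt0.
by move=> k; rewrite ger0_norm; lra.
Qed.

End chebyshev.

(** * Changing the weight off U *)

Section restriction.
Context {R : realType} {n : nat}.
Implicit Types (U : set (Rn R n)) (f g : Rn R n -> \bar R) (w v : Rn R n -> R).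
Local Open Scope ereal_scope.
Local Notation mu := (@lebesgueRn R n).

Lemma eq_avg A f g : (forall y, A y -> f y = g y) -> avg A f = avg A g.
Proof.
by move=> fg; rewrite /avg; congr (_ * _); apply: eq_integral => y /set_mem /fg.
Qed.

Variables (U : set (Rn R n)) (v w : Rn R n -> R).
Hypothesis vw : forall y, U y -> v y = w y.

Let avg_vw A : A `<=` U -> avg A (EFin \o v) = avg A (EFin \o w).
Proof. by move=> AU; apply: eq_avg => y /AU /vw /= ->. Qed.

Let eball_half (x : Rn R n) (r : R) : (0 < r)%R -> eball x (2 * r) `<=` U -> eball x r `<=` U.
Proof. by move=> r0; apply: subset_trans; apply: eball_le; lra. Qed.

Lemma eq_doubling_with A : doubling_with U v A -> doubling_with U w A.
Proof.
move=> h x r r0 xU; have := h x r r0 xU.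
have xU2 : eball x (2 * r) `<=` U by apply: subset_trans xU; apply: eball_le; lra.
by rewrite !avg_vw//; exact: eball_half.
Qed.

Lemma eq_weak_reverse_Holder q B :
  weak_reverse_Holder U v q B -> weak_reverse_Holder U w q B.
Proof.
move=> h x r r0 xU; move: (h x r r0 xU).
have E1 : avg (eball x r) (fun y => (v y `^ q)%:E) =
  avg (eball x r) (fun y => (w y `^ q)%:E).
  by apply: eq_avg => y /(eball_half r0 xU) /vw ->.
by case: _ / E1; case: _ / (avg_vw xU).
Qed.

Lemma eq_BMO_with D : BMO_with U (log v) D -> BMO_with U (log w) D.
Proof.
move=> h x r r0 xU; move: (h x r r0 xU).
have lvw y : eball x r y -> log v y = log w y.
  by move=> /(eball_half r0 xU) /vw; rewrite /log => ->.
have E a : avg (eball x r) (fun y => `|log v y - a| ^+ 2) =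
           avg (eball x r) (fun y => `|log w y - a| ^+ 2).
  by apply: eq_avg => y xy; rewrite lvw.
by case: _ / (eq_avg lvw); case: _ / (E (avg (eball x r) (log v))).
Qed.

Lemma eq_loc_integrable : loc_integrable U v -> loc_integrable U w.
Proof.
move=> h K KU cK; have := h K KU cK; congr (_ < _).
by apply: eq_integral => y /set_mem /KU /vw ->.
Qed.

Lemma eq_nonvanishing : nonvanishing U v -> nonvanishing U w.
Proof.
move=> h x Ux; have := h x Ux; congr (_ < _).
by apply: eq_integral => y /set_mem /connected_component_sub /vw ->.
Qed.

End restriction.

Section ball_hypotheses.
Context {R : realType} {n : nat}.
Hypothesis n0 : (0 < n)%N.
Local Notation mu := (@lebesgueRn R n).
Implicit Types (x y z : Rn R n) (r s : R) (U V : set (Rn R n)).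

Lemma lebesgueRn_eball_gt0 x r : 0 < r -> (0 < mu (eball x r))%E.
Proof.
move=> r0; apply: lt_le_trans (lebesgueRn_eball_ge x n0 r0).
by rewrite lte_fin exprn_gt0// divr_gt0// ltr0n.
Qed.

Let closed_eball_closed x r : closed ([set y | eudist x y <= r] : set (Rn R n)).
Proof.
rewrite -openC; apply: eball_subset_openP => y /= /negP; rewrite -ltNge => ry.
exists (eudist x y - r); first by rewrite subr_gt0.
move=> z /eballE yz /= xz.
have := eudist_triangle x z y; rewrite (eudistC z) leNgt => /negP; apply.
lra.
Qed.

Lemma closed_eball_compact x r : compact [set y | eudist x y <= r].
Proof.
suff : compact ([set y | eudist x y <= r] : set 'rV[R]_n) by [].
apply: bounded_closed_compact (@closed_eball_closed x r).
exists (`|x : 'rV[R]_n| + `|r|); split; first exact: num_real.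
move=> b hb y /= xy; apply: le_trans (ltW hb).
have -> : (y : 'rV[R]_n) = x + (y - x :> 'rV[R]_n) by rewrite addrC subrK.
apply: le_trans (ler_normD _ _) _; rewrite lerD2l.
apply: le_trans (ler_norm r); apply: le_trans xy.
set z := y - x; have [z0|z0] := eqVneq (mx_norm z) 0.
  by rewrite (_ : `|z| = mx_norm z)// z0 eudist_ge0.
have [i zi] := mx_norm_neq0 z0.
by rewrite (_ : `|z| = mx_norm z)// zi (ord1 i.1) enorm_coord.
Qed.

(** Local integrability speaks of compact sets; r < s leaves room for the closed ball of radius [r]
    inside U. This is why the ball V used later is slightly smaller than the one assumed to lie in
    U. *)
Lemma loc_integrable_eball U (w : Rn R n -> R) x r s : loc_integrable U w ->
  (forall y, 0 <= w y) -> measurable_fun setT w -> r < s -> eball x s `<=` U ->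
  (\int[mu]_(y in eball x r) (w y)%:E < +oo)%E.
Proof.
move=> li w0 mw rs xU.
apply: le_lt_trans (li [set y | eudist x y <= r] _ (@closed_eball_compact x r)).
  have -> : (fun y => `|w y|%:E) = (fun y => (w y)%:E).
    by apply/funext => y; rewrite ger0_norm.
  apply: ge0_subset_integral.
  - exact: measurable_eball.
  - have := @closed_eball_closed x r.
    rewrite -openC => /measurable_open /measurableC; rewrite setCK; exact.
  - by apply/measurable_EFinP; exact: measurable_funTS.
  - by move=> y _; rewrite lee_fin.
  - by move=> y /eballE /ltW.
by move=> y /= yr; apply: xU; apply/eballE; exact: le_lt_trans rs.
Qed.

(** Extension by zero gives a weight that is measurable and nonnegative everywhere; the [eq_] lemmas
    carry hypotheses and conclusion across, since all the notions see only values in U. *)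
Lemma restrict_nonneg U (w : Rn R n -> R) : measurable U -> measurable_fun U w ->
  (forall x, U x -> 0 <= w x) ->
  measurable_fun setT (w \_ U) /\ (forall y, 0 <= (w \_ U) y) /\
  (forall y, U y -> (w \_ U) y = w y).
Proof.
move=> mU mw w0; split; first by apply/(measurable_restrictT w mU).
split=> y; rewrite patchE; last by move=> Uy; rewrite mem_set.
by case: ifPn => // /set_mem /w0.
Qed.

Lemma fine_mu_restrict (nu : {measure set (Rn R n) -> \bar R}) V A :
  A `<=` V -> fine (nu (A `&` V)) = fine (nu A).
Proof. by move=> /setIidPl ->. Qed.

End ball_hypotheses.

(** * The abstract argument applied to Euclidean balls *)

Section bmo_implies_doubling.
Context {R : realType} {n : nat}.
Hypothesis n0 : (0 < n)%N.
Local Notation mu := (@lebesgueRn R n).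

Lemma lt_sqr_exists (x : R) : 0 <= x -> exists2 t, 0 < t & x < t ^+ 2.
Proof.
move=> x0; exists (x + 1); first by rewrite ltr_wpDl.
by have := sqr_ge0 x; rewrite sqrrD1 mulr2n; lra.
Qed.

Lemma weighted_facts (w : Rn R n -> R) (V : set (Rn R n))
    (mw : measurable_fun setT w) (w0 : forall y, 0 <= w y) :
  measurable V -> (mu V < +oo)%E -> (weighted mu mw w0 V < +oo)%E ->
  let m A := fine (mu (A `&` V)) in
  let W A := fine (weighted mu mw w0 (A `&` V)) in
  [/\ content_like m, content_like W,
   (forall t A, measurable A -> 0 <= t -> (forall x, A x -> w x <= t) ->
      W A <= t * m A) &
   (forall t A, measurable A -> 0 <= t -> (forall x, A x -> t <= w x) ->
      t * m A <= W A)].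
Proof.
move=> mV muV WV m W.
have fm A : measurable A -> mu (A `&` V) \is a fin_num.
  move=> mA; rewrite ge0_fin_numE// (le_lt_trans _ muV)// le_measure ?inE//.
  exact: measurableI.
have fW A : measurable A -> weighted mu mw w0 (A `&` V) \is a fin_num.
  move=> mA; rewrite ge0_fin_numE// (le_lt_trans _ WV)// le_measure ?inE//.
  exact: measurableI.
split; [exact: content_like_restrict|exact: content_like_restrict| |].
- move=> t A mA t0 h; rewrite -lee_fin EFinM !fineK ?fm ?fW//.
  by apply: weighted_le; [exact: measurableI|move=> x [/h]|].
- move=> t A mA t0 h; rewrite -lee_fin EFinM !fineK ?fm ?fW//.
  by apply: weighted_ge; [exact: measurableI|move=> x [/h]|].
Qed.

(** Moving [z] towards [x] by one eighth of the distance costs less than r/4, so the ball of radius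
    r/4 stays in [eball z (r / 2)]; it also brings the centre within 7r/4 of [x], so the same ball
    lies in [eball x (2 * r)]. *)
Lemma shifted_ball_subset (x z : Rn R n) (r : R) : 0 < r -> eudist x z < 2 * r ->
  let z' : Rn R n := (z : 'rV[R]_n) + 8^-1 *: ((x : 'rV[R]_n) - z) in
  [/\ eball z r `<=` eball x (3 * r), eball z' (r / 2) `<=` eball x (3 * r),
    eball z' (r / 4) `<=` eball z (r / 2) & eball z' (r / 4) `<=` eball x (2 * r)].
Proof.
move=> r0 xz z'.
have zz' : eudist z z' = 8^-1 * eudist x z.
  by rewrite /eudist /z' addrC addKr enormZ ger0_norm ?invr_ge0// enormB.
have xz' : eudist x z' = 7 / 8 * eudist x z.
  rewrite /eudist /z'.
  have -> : (z : 'rV[R]_n) + 8^-1 *: ((x : 'rV[R]_n) - z) - x =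
    (7 / 8) *: ((z : 'rV[R]_n) - x) :> 'rV[R]_n.
    by apply/rowP => j; rewrite !mxE; field.
  by rewrite enormZ ger0_norm.
by split; apply: eball_subset; lra.
Qed.

Lemma BMO_doubling (q B D : R) : 1 < q -> 0 < B -> 0 < D ->
  exists2 C : R, 0 < C &
    forall (U : set (Rn R n)) (w : Rn R n -> R),
      measurable_fun setT w -> (forall x, 0 <= w x) ->
      loc_integrable U w -> weak_reverse_Holder U w q B ->
      BMO_with U (log w) D -> doubling_with U w C.
Proof.
move=> q1 B0 D0.
have nR0 : 0 < n%:R :> R by rewrite ltr0n.
(* The volume constants given by the inscribed and circumscribed cubes. *)
pose c0 : R := n%:R^-1 ^+ n; pose C0 : R := 2 ^+ n.
have c00 : 0 < c0 by rewrite exprn_gt0// invr_gt0.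
have C00 : 0 < C0 by rewrite exprn_gt0.
have i4 : 0 < 4^-1 :> R by rewrite invr_gt0.
have i16 : 0 < 16^-1 :> R by rewrite invr_gt0.
(* Scale 1/4 covers radius 2p by radius p/2 for the absorption; scale 1/16 covers radius 2r by
   radius r/8 for the final chain. *)
have [L hL] := @eball_cover R n 4^-1 i4.
have [N hN] := @eball_cover R n 16^-1 i16.
have K0 (k : R) : 0 <= k -> 0 <= D * (1 + C0 * k ^+ n / c0).
  move=> k0; rewrite mulr_ge0 ?(ltW D0)// addr_ge0// divr_ge0 ?(ltW c00)//.
  by rewrite mulr_ge0 ?(ltW C00)// exprn_ge0.
(* [t'] and [s] are thresholds for comparing balls with radii in ratio at most 2 and 8; [u] makes
   the exceptional part at most half of a ball. They are fixed before [e], and [t] after the delta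
   that [e] determines. *)
have [t' t'0 Dt'] := lt_sqr_exists (K0 2 (ler0n _ _)).
have [s s0 Ds] := lt_sqr_exists (K0 8 (ler0n _ _)).
have [u u0 Du] := lt_sqr_exists (mulr_ge0 (ler0n R 2) (ltW D0)).
pose e := (2 * L.+1%:R * expR (2 * t'))^-1.
have e0 : 0 < e by rewrite invr_gt0 !mulr_gt0// expR_gt0.
have eL : e * L%:R * expR (2 * t') <= 2^-1.
  have -> : e * L%:R * expR (2 * t') = L%:R / L.+1%:R / 2.
    by rewrite /e; field; rewrite nat1r !gt_eqF ?expR_gt0.
  by rewrite ler_piMl ?invr_ge0// ler_pdivrMr// mul1r ler_nat.
have [dl' dl'0 small] := reverse_Holder_small_sets q1 B0 e0.
pose dl := dl' * c0; have dl0 : 0 < dl by rewrite mulr_gt0.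
have [t t0 Dt] : exists2 t, 0 < t & D * C0 * 4 ^+ n / dl < t ^+ 2.
  apply: lt_sqr_exists; rewrite divr_ge0 ?(ltW dl0)// mulr_ge0//.
  by rewrite mulr_ge0 ?ltW.
pose C := N%:R * 4 * C0 * expR (t + 6 * s + u) / c0.
have C_ge0 : 0 <= C by rewrite /C divr_ge0 ?(ltW c00)// !mulr_ge0 ?expR_ge0// ltW.
exists (C + 1); first by rewrite ltr_wpDl.
move=> U w mw w0 li rH bmo x r r0 xU.
(* The closed ball of radius 3r is compact inside B(x, 4r), hence in U, and V contains every ball of
   radius r centred in B(x, 2r). *)
pose V : set (Rn R n) := eball x (3 * r).
have VU : V `<=` U by apply: subset_trans xU; apply: eball_le; lra.
have mV : measurable V by exact: measurable_eball.
have muV : (mu V < +oo)%E by rewrite ltey_eq lebesgueRn_eball_fin.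
have WV : (weighted mu mw w0 V < +oo)%E.
  by apply: (loc_integrable_eball li w0 mw _ xU); lra.
have [hm hW W_le W_ge] := weighted_facts mV muV WV.
set m := fun A => fine (mu (A `&` V)) in hm W_le W_ge.
set W := fun A => fine (weighted mu mw w0 (A `&` V)) in hW W_le W_ge.
have finB y p : mu (eball y p) \is a fin_num by exact: lebesgueRn_eball_fin.
have mE y p : eball y p `<=` V -> m (eball y p) = fine (mu (eball y p)).
  by move=> yV; rewrite /m fine_mu_restrict.
have vol y p : 0 < p -> eball y p `<=` V ->
    c0 * p ^+ n <= m (eball y p) <= C0 * p ^+ n.
  move=> p0 yV; rewrite mE// -2!lee_fin fineK// -!exprMn [n%:R^-1 * p]mulrC.
  by rewrite lebesgueRn_eball_ge// lebesgueRn_eball_le.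
pose c y p := fine (avg (eball y p) (log w)).
have oscU y p : 0 < p -> eball y (2 * p) `<=` U -> eball y p `<=` V ->
    log_osc m w (eball y p) (c y p) D.
  move=> p0 yU yV tt tt0.
  have := chebyshev_log_osc mw w0 (@measurable_eball _ _ y p)
    (lebesgueRn_eball_gt0 n0 y p0) _ tt0 (ltW D0) (bmo y p p0 yU).
  rewrite ltey_eq finB => /(_ isT) h.
  pose O := log_outside w (c y p) tt.
  have mO : measurable (eball y p `&` O).
    by apply: measurableI; [exact: measurable_eball|exact: measurable_log_outside].
  have fO : mu (eball y p `&` O) \is a fin_num.
    rewrite ge0_fin_numE//; apply: le_lt_trans muV.
    by apply: le_measure; rewrite ?inE// => ? [/yV].
  have mOE : m (eball y p `&` O) = fine (mu (eball y p `&` O)).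
    by rewrite /m fine_mu_restrict// => ? [/yV].
  rewrite mE// mOE -lee_fin EFinM (fineK fO) (fineK (finB y p)).
  exact: h.
have xV2 : eball x (2 * r) `<=` V by apply: eball_le; lra.
have cover y p : 0 < p -> exists z : 'I_L -> Rn R n,
  (forall i, eball (z i) (2 * p) `<=` eball y (4 * p) /\
             eball (z i) (4 * p) `<=` eball y (8 * p)) /\
  eball y (2 * p) `<=` \bigcup_i eball (z i) (p / 2).
  move=> p0; have [z [z1 z2]] := hL y (2 * p) (mulr_gt0 (ltr0n R 2) p0).
  exists z; split; last by have -> : p / 2 = 4^-1 * (2 * p) by field.
  move=> i; have /eballE yz := z1 i.
  by split; apply: eball_subset; lra.
have smallV y p E : 0 < p -> eball y (2 * p) `<=` V -> measurable E ->
    E `<=` eball y p -> m E <= dl * p ^+ n -> W E <= e * W (eball y (2 * p)).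
  move=> p0 yV mEE Ey mEp.
  have yp : eball y p `<=` eball y (2 * p) by apply: eball_le; lra.
  have yV1 := subset_trans yp yV; have EV := subset_trans Ey yV1.
  have fE : mu E \is a fin_num.
    rewrite ge0_fin_numE//; by apply: le_lt_trans muV; apply: le_measure; rewrite ?inE.
  have W2 : (weighted mu mw w0 (eball y (2 * p)) < +oo)%E.
    apply: le_lt_trans WV; apply: le_measure; rewrite ?inE//; exact: measurable_eball.
  have WE : (weighted mu mw w0 E < +oo)%E.
    by apply: le_lt_trans WV; apply: le_measure; rewrite ?inE.
  have hE : (mu E <= dl'%:E * mu (eball y p))%E.
    rewrite -(fineK fE) -(fineK (finB y p)) -EFinM lee_fin.
    move: mEp; rewrite /m fine_mu_restrict// => /le_trans; apply.
    rewrite /dl -mulrA ler_wpM2l ?(ltW dl'0)//.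
    by have := vol y p p0 yV1; rewrite mE// => /andP[].
  have := small _ _ mu w (eball y p) (eball y (2 * p)) E mw w0
    (@measurable_eball _ _ _ _) (@measurable_eball _ _ _ _) mEE yp Ey
    (lebesgueRn_eball_gt0 n0 y p0) _ W2 (rH y p p0 (subset_trans yV VU)).
  rewrite ltey_eq finB => /(_ isT).
  rewrite /W !fine_mu_restrict// => h; rewrite -lee_fin EFinM !fineK ?ge0_fin_numE//.
  exact: h hE.
have [z [z1 z2]] := hN x (2 * r) (mulr_gt0 (ltr0n R 2) r0).
pose z' i : Rn R n := (z i : 'rV[R]_n) + 8^-1 *: ((x : 'rV[R]_n) - z i).
have r20 : 0 < 2 * r by rewrite mulr_gt0.
have dbl : W (eball x (2 * r)) <= C * W (eball x r).
  apply: (@doubling_of_log_osc _ _ _ m W w hm hW mw W_le W_ge (@eball R n) V n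
    c0 C0 c D (@measurable_eball R n) mV c00 C00 (ltW D0) vol L e dl t t'
    cover (@eball_le R n) _ smallV (ltW e0) t0 t'0 _ Dt' eL N z z' s u x r r0
    xV2 _ _ _ s0 Ds u0).
  - move=> y p p0 yV; apply: oscU => //; first exact: subset_trans VU.
    by apply: subset_trans yV; apply: eball_le; lra.
  - by rewrite [leRHS]mulrC -ler_pdivrMr// ltW.
  - by apply: oscU => //; apply: subset_trans xU; apply: eball_le; lra.
  - by have -> : r / 8 = 16^-1 * (2 * r) by field.
  - by move=> i; have /eballE xz := z1 i; exact: shifted_ball_subset.
  - by rewrite ler_pdivrMr ?exprn_gt0//; lra.
have xV1 : eball x r `<=` V by apply: eball_le; lra.
have fW p : p <= 2 * r -> weighted mu mw w0 (eball x p) \is a fin_num.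
  move=> pr; rewrite ge0_fin_numE//; apply: le_lt_trans WV.
  by apply: le_measure; rewrite ?inE//; [exact: measurable_eball|apply: eball_le; lra].
move: dbl; rewrite /W !fine_mu_restrict// => dbl.
rewrite /avg.
change (((mu (eball x (2 * r)))^-1 * weighted mu mw w0 (eball x (2 * r)) <=
  (C + 1)%:E * ((mu (eball x r))^-1 * weighted mu mw w0 (eball x r)))%E).
have rr : r <= 2 * r by lra.
have a1 : 0 < fine (mu (eball x r)) by rewrite -mE//; case/andP: (vol x r r0 xV1) => + _; apply: lt_le_trans; rewrite mulr_gt0// exprn_gt0.
have a12 : fine (mu (eball x r)) <= fine (mu (eball x (2 * r))).
  by rewrite -!mE//; apply: content_like_le => //; [exact: measurable_eball|exact: measurable_eball|exact: eball_le].
have a2 := lt_le_trans a1 a12.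
rewrite -(fineK (fW _ rr)) -(fineK (fW _ (lexx _))) -(fineK (finB x r)) -(fineK (finB x (2 * r))).
rewrite !inver !gt_eqF// -!EFinM lee_fin.
have W10 : 0 <= fine (weighted mu mw w0 (eball x r)) by exact/fine_ge0/measure_ge0.
(* The larger ball has the larger volume, so passing from masses to averages only helps. *)
apply: (@le_trans _ _ ((fine (mu (eball x r)))^-1 * (C * fine (weighted mu mw w0 (eball x r))))).
  apply: ler_pM => //; first by rewrite invr_ge0 ltW.
    exact/fine_ge0/measure_ge0.
  by rewrite lef_pV2.
rewrite mulrCA; apply: ler_wpM2r; last by rewrite lerDl.
by rewrite mulr_ge0// invr_ge0 ltW.
Qed.

End bmo_implies_doubling.

(** * Bisection trees *)

Section binary_tree.
Context d {T : measurableType d} {R : realType}.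
Variables (box_t : Type) (S : box_t -> set T) (lft rgt : box_t -> box_t).
Variable good : box_t -> Prop.
Variables (m W : set T -> R).
Hypotheses (hm : content_like m) (hW : content_like W).
Hypothesis good_lft : forall Q, good Q -> good (lft Q).
Hypothesis good_rgt : forall Q, good Q -> good (rgt Q).
Hypothesis mS : forall Q, good Q -> measurable (S Q).
Hypothesis S_split : forall Q, good Q -> S Q = S (lft Q) `|` S (rgt Q).
Hypothesis S_disj : forall Q, good Q -> S (lft Q) `&` S (rgt Q) = set0.

(** Finite unions of generation-[k] boxes. Keeping the generation in the index lets them be summed
    along the same recursion as [low_mass]. *)
Fixpoint simple_set (k : nat) (Q : box_t) (F : set T) : Prop :=
  if k is k'.+1 then exists F1 F2,
    [/\ simple_set k' (lft Q) F1, simple_set k' (rgt Q) F2 & F = F1 `|` F2]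
  else F = set0 \/ F = S Q.

Lemma simple_set_measurable k Q F : good Q -> simple_set k Q F -> measurable F.
Proof.
elim: k Q F => [|k IH] Q F gQ /=; first by case=> ->; [exact: measurable0|exact: mS].
move=> [F1 [F2 [h1 h2 ->]]]; apply: measurableU.
  by apply: IH h1; exact: good_lft.
by apply: IH h2; exact: good_rgt.
Qed.

Lemma simple_set_sub k Q F : good Q -> simple_set k Q F -> F `<=` S Q.
Proof.
elim: k Q F => [|k IH] Q F gQ /=; first by case=> ->.
move=> [F1 [F2 [h1 h2 ->]]]; rewrite S_split//; apply: setUSS.
  by apply: IH h1; exact: good_lft.
by apply: IH h2; exact: good_rgt.
Qed.

Lemma simple_set0 k Q : simple_set k Q set0.
Proof.
by elim: k Q => [|k IH] Q /=; [left|exists set0, set0; rewrite setU0; split].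
Qed.

Lemma simple_setS k Q F : good Q -> simple_set k Q F -> simple_set k.+1 Q F.
Proof.
elim: k Q F => [|k IH] Q F gQ.
  case=> ->; first exact: (simple_set0 1).
  exists (S (lft Q)), (S (rgt Q)); split; [by right|by right|exact: S_split].
move=> [F1 [F2 [h1 h2 ->]]]; exists F1, F2; split => //.
  by apply: IH => //; exact: good_lft.
by apply: IH => //; exact: good_rgt.
Qed.

Lemma simple_set_le k k' Q F : good Q -> (k <= k')%N -> simple_set k Q F ->
  simple_set k' Q F.
Proof.
move=> gQ; elim: k' => [|k' IH]; first by rewrite leqn0 => /eqP ->.
rewrite leq_eqVlt => /predU1P[->//|]; rewrite ltnS => /IH h /h.
exact: simple_setS.
Qed.

Lemma simple_setU k Q F G : good Q -> simple_set k Q F -> simple_set k Q G ->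
  simple_set k Q (F `|` G).
Proof.
elim: k Q F G => [|k IH] Q F G gQ /=.
  case=> ->; first by rewrite set0U.
  by case=> ->; right; rewrite ?setU0 ?setUid.
move=> [F1 [F2 [h1 h2 ->]]] [G1 [G2 [k1 k2 ->]]].
exists (F1 `|` G1), (F2 `|` G2); split; last by rewrite setUACA.
  by apply: IH => //; exact: good_lft.
by apply: IH => //; exact: good_rgt.
Qed.

Lemma simple_setC k Q F : good Q -> simple_set k Q F -> simple_set k Q (S Q `\` F).
Proof.
elim: k Q F => [|k IH] Q F gQ /=.
  by case=> ->; [right; rewrite setD0|left; rewrite setDv].
move=> [F1 [F2 [h1 h2 ->]]].
have gl := good_lft gQ; have gr := good_rgt gQ.
exists (S (lft Q) `\` F1), (S (rgt Q) `\` F2); split; [exact: IH|exact: IH|].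
have s1 := simple_set_sub gl h1; have s2 := simple_set_sub gr h2.
have dj x : S (lft Q) x -> S (rgt Q) x -> False.
  by move=> xl xr; have : (S (lft Q) `&` S (rgt Q)) x by []; rewrite S_disj.
rewrite S_split//; apply/seteqP; split => x.
  by move=> [[xl|xr] /not_orP[n1 n2]]; [left|right].
case=> -[xS nx]; split; [by left| |by right|]; case=> // h.
- by apply: (dj x) => //; exact: s2.
- by apply: (dj x) => //; exact: s1.
Qed.

Section approximation.
Variable Q0 : box_t.
Hypothesis gQ0 : good Q0.
Hypothesis m_continuous : forall (A : nat -> set T), (forall k, measurable (A k)) ->
  (forall k, A k `<=` A k.+1) -> forall e, 0 < e ->
  exists k, m (\bigcup_i A i `\` A k) <= e.

(** With [m] continuous along increasing sequences, these sets form a sigma-algebra; so for Borel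
    sets only half-spaces have to be approximated by hand. *)
Definition approximable (A : set T) := measurable A /\ forall e, 0 < e ->
  exists k F, [/\ simple_set k Q0 F, m ((A `&` S Q0) `\` F) <= e & m (F `\` A) <= e].

Let m0 : m set0 = 0.
Proof. by have := content_likeD hm measurable0 measurable0 (@subset_refl _ _); rewrite setD0 subrr. Qed.

Lemma approximable0 : approximable set0.
Proof.
split=> // e e0; exists 0%N, set0; split; first exact: simple_set0.
  by rewrite set0I set0D m0 ltW.
by rewrite set0D m0 ltW.
Qed.

Lemma approximableC A : approximable A -> approximable (~` A).
Proof.
move=> [mA h]; split; first exact: measurableC.
move=> e e0; have [k [F [sF h1 h2]]] := h e e0.
exists k, (S Q0 `\` F); split; first exact: simple_setC.
  rewrite (_ : _ `\` _ = F `\` A)//; apply/seteqP; split => x.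
    by move=> [[nA xS] /not_andP[//|/contrapT]].
  by move=> [Fx nA]; split; [split => //; exact: (simple_set_sub gQ0 sF)|case].
rewrite (_ : _ `\` _ = (A `&` S Q0) `\` F)//; apply/seteqP; split => x.
  by move=> [[xS nF] /contrapT].
by move=> [[Ax xS] nF]; split => //; exact.
Qed.

Lemma approximableU A B : approximable A -> approximable B -> approximable (A `|` B).
Proof.
move=> [mA hA] [mB hB]; split; first exact: measurableU.
move=> e e0; have e20 : 0 < e / 2 by rewrite divr_gt0.
have [k [F [sF h1 h2]]] := hA _ e20; have [l [G [sG k1 k2]]] := hB _ e20.
have mF := simple_set_measurable gQ0 sF; have mG := simple_set_measurable gQ0 sG.
have mQ := mS gQ0.
exists (maxn k l), (F `|` G); split.
- apply: simple_setU => //.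
    by apply: simple_set_le sF => //; exact: leq_maxl.
  by apply: simple_set_le sG => //; exact: leq_maxr.
- have u1 : measurable ((A `&` S Q0) `\` F) by apply: measurableD => //; exact: measurableI.
  have u2 : measurable ((B `&` S Q0) `\` G) by apply: measurableD => //; exact: measurableI.
  apply: (@le_trans _ _ (m (((A `&` S Q0) `\` F) `|` ((B `&` S Q0) `\` G)))).
    apply: content_like_le => //.
    + apply: measurableD; last exact: measurableU.
      by apply: measurableI => //; exact: measurableU.
    + exact: measurableU.
    + by move=> x [[[Ax|Bx] xS] /not_orP[? ?]]; [left|right].
  by have := content_likeU_le hm u1 u2; lra.
- have u1 : measurable (F `\` A) by exact: measurableD.
  have u2 : measurable (G `\` B) by exact: measurableD.
  apply: (@le_trans _ _ (m ((F `\` A) `|` (G `\` B)))).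
    apply: content_like_le => //.
    + by apply: measurableD; exact: measurableU.
    + exact: measurableU.
    + by move=> x [[Ax|Bx] /not_orP[? ?]]; [left|right].
  by have := content_likeU_le hm u1 u2; lra.
Qed.

Lemma approximable_bigcup (A : nat -> set T) : (forall k, approximable (A k)) ->
  approximable (\bigcup_k A k).
Proof.
move=> hA; pose B k := \big[setU/set0]_(i < k) A i.
have hB k : approximable (B k).
  elim: k => [|k IH]; first by rewrite /B big_ord0; exact: approximable0.
  by rewrite /B big_ord_recr /=; exact: approximableU.
have BA : \bigcup_k B k = \bigcup_k A k.
  apply/seteqP; split => x [k _].
    by rewrite /B -bigcup_mkord => -[i /= ik Ai]; exists i.
  by move=> Ak; exists k.+1 => //; rewrite /B -bigcup_mkord; exists k => /=.
have mU : measurable (\bigcup_k A k).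
  by apply: bigcup_measurable => k _; exact: (hA k).1.
split => // e e0; have e20 : 0 < e / 2 by rewrite divr_gt0.
have [k hk] := m_continuous (fun k => (hB k).1)
  (fun k => ltac:(by rewrite /B big_ord_recr; exact: subsetUl)) e20.
rewrite BA in hk.
have BkA : B k `<=` \bigcup_k A k by rewrite -BA => x Bx; exists k.
have [l [F [sF h1 h2]]] := (hB k).2 _ e20.
have mF := simple_set_measurable gQ0 sF; have mQ := mS gQ0; have mB := (hB k).1.
exists l, F; split => //.
- have u1 : measurable (\bigcup_k A k `\` B k) by exact: measurableD.
  have u2 : measurable ((B k `&` S Q0) `\` F) by apply: measurableD => //; exact: measurableI.
  apply: (@le_trans _ _ (m ((\bigcup_k A k `\` B k) `|` ((B k `&` S Q0) `\` F)))).
    apply: content_like_le => //.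
    + by apply: measurableD => //; exact: measurableI.
    + exact: measurableU.
    + move=> x [[Ax xS] nF]; case: (pselect (B k x)) => Bx; [by right|by left].
  by have := content_likeU_le hm u1 u2; lra.
- apply: le_trans (_ : _ <= e / 2) _; last by lra.
  apply: le_trans h2; apply: content_like_le => //; [exact: measurableD..|].
  by apply: setDS.
Qed.

End approximation.

(** * The stopping time and the decay of low averages *)

Variables (dl u : R).
Hypotheses (dl0 : 0 < dl) (dl1 : dl < 1) (u0 : 0 < u) (u12 : u <= 2^-1).
Hypothesis S_half : forall Q, good Q ->
  m (S (lft Q)) = m (S Q) / 2 /\ m (S (rgt Q)) = m (S Q) / 2.
Hypothesis m_gt0 : forall Q, good Q -> 0 < m (S Q).
Hypothesis W_gt0 : forall Q, good Q -> 0 < W (S Q).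
Hypothesis W_small : forall Q E, good Q -> measurable E -> E `<=` S Q ->
  m E <= dl * m (S Q) -> W E <= W (S Q) / 4.
Hypothesis W_child : forall Q, good Q ->
  u * W (S Q) <= W (S (lft Q)) /\ u * W (S Q) <= W (S (rgt Q)).

(** Total measure of the generation-[k] boxes whose W-average is below [t]: the finite-depth
    substitute for the measure of { w < t }. *)
Fixpoint low_mass (k : nat) (Q : box_t) (t : R) : R :=
  if k is k'.+1 then low_mass k' (lft Q) t + low_mass k' (rgt Q) t
  else if W (S Q) < t * m (S Q) then m (S Q) else 0.

Lemma low_mass_le k Q t : good Q -> low_mass k Q t <= m (S Q).
Proof.
elim: k Q => [|k IH] Q gQ /=; first by case: ifP => // _; rewrite ltW// m_gt0.
have [h1 h2] := S_half gQ.
have := IH _ (good_lft gQ); have := IH _ (good_rgt gQ); rewrite h1 h2; lra.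
Qed.

Lemma low_mass_mono k Q t t' : good Q -> t <= t' -> low_mass k Q t <= low_mass k Q t'.
Proof.
move=> + tt'; elim: k Q => [|k IH] Q gQ /=.
  have mQ := m_gt0 gQ.
  case: ifP => h; last by case: ifP => // _; exact: ltW.
  by rewrite (lt_le_trans h)// ler_pM2r.
by apply: lerD; apply: IH; [exact: good_lft|exact: good_rgt].
Qed.

(* The maximal descendants of depth at most [k] with [W]-average below [s].   *)
Fixpoint stopping (k : nat) (Q : box_t) (s : R) : set T :=
  if W (S Q) < s * m (S Q) then S Q else
  if k is k'.+1 then stopping k' (lft Q) s `|` stopping k' (rgt Q) s else set0.

Lemma stopping_sub k Q s : good Q -> stopping k Q s `<=` S Q.
Proof.
elim: k Q => [|k IH] Q gQ /=.
  by case: ifP => _; [exact: subset_refl|exact: sub0set].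
case: ifP => _; first exact: subset_refl.
rewrite (S_split gQ); apply: setUSS; apply: IH; [exact: good_lft|exact: good_rgt].
Qed.

Lemma stopping_measurable k Q s : good Q -> measurable (stopping k Q s).
Proof.
elim: k Q => [|k IH] Q gQ /=; case: ifP => // _; try exact: mS.
by apply: measurableU; apply: IH; [exact: good_lft|exact: good_rgt].
Qed.

Let stopping_disj k Q s : good Q ->
  stopping k (lft Q) s `&` stopping k (rgt Q) s = set0.
Proof.
move=> gQ; rewrite -subset0 -(S_disj gQ).
by apply: setISS; apply: stopping_sub; [exact: good_lft|exact: good_rgt].
Qed.

Let f0 (f : set T -> R) : content_like f -> f set0 = 0.
Proof.
move=> hf; have := content_likeD hf measurable0 measurable0 (@subset_refl _ _).
by rewrite setD0 subrr.
Qed.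

Lemma stopping_W k Q s : good Q -> W (stopping k Q s) <= s * m (stopping k Q s).
Proof.
elim: k Q => [|k IH] Q gQ /=; case: ifP => [/ltW//|_].
  by rewrite !f0// mulr0.
have gl := good_lft gQ; have gr := good_rgt gQ.
have ml := stopping_measurable k s gl; have mr := stopping_measurable k s gr.
rewrite hW.2//; last exact: stopping_disj.
rewrite hm.2//; last exact: stopping_disj.
by rewrite mulrDr lerD// IH.
Qed.

(** The stopped set carries at most half of the W-mass, since averages on it are below half of that
    of [Q]. If the rest had measure at most [dl * m (S Q)], it would carry at most a quarter, and
    the two could not add up to W(Q). *)
Lemma stopping_m k Q : good Q ->
  m (stopping k Q (W (S Q) / m (S Q) / 2)) <= (1 - dl) * m (S Q).
Proof.
move=> gQ; set s := _ / 2; set St := stopping k Q s.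
have mSt : measurable St by exact: stopping_measurable.
have SQ : St `<=` S Q by exact: stopping_sub.
have mQ := m_gt0 gQ; have WQ := W_gt0 gQ; have mQm := mS gQ.
rewrite leNgt; apply/negP => h.
have := W_small gQ (measurableD mQm mSt) (@subDsetl _ _ _).
rewrite !content_likeD// => /(_ _) hh.
have : m (S Q) - m St <= dl * m (S Q) by lra.
move=> /hh; have := stopping_W k s gQ; rewrite -/St => h1 h2.
have sE : s * m (S Q) = W (S Q) / 2 by rewrite /s; field; rewrite gt_eqF.
have : s * m St <= s * m (S Q).
  apply: ler_wpM2l; last exact: content_like_le.
  by rewrite /s !divr_ge0// ltW.
lra.
Qed.

(** Stop at half the average a of [Q]. A stopped box other than [Q] has an unstopped parent, of
    average at least a/2; it holds a proportion [u] of the parent's mass on half of its volume, so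
    its own average is at least u a. The level u^(j+1) a is thus at most u^j times that average, and
    induction applies inside each stopped box; the stopped boxes together have lost a factor 1 - dl
    by [stopping_m]. *)
Lemma low_mass_decay j k Q : good Q ->
  low_mass k Q (u ^+ j * (W (S Q) / m (S Q))) <= (1 - dl) ^+ j * m (S Q).
Proof.
elim: j k Q => [|j IH] k Q gQ; first by rewrite !expr0 !mul1r low_mass_le.
have g0 : 0 <= (1 - dl) ^+ j by rewrite exprn_ge0// subr_ge0 ltW.
have ule1 : u <= 1 by apply: le_trans u12 _; rewrite invf_le1// ler1n.
have u1 : u ^+ j <= 1 by apply: exprn_ile1 => //; rewrite ?ltW.
have uj0 : 0 <= u ^+ j by rewrite exprn_ge0// ltW.
have inner s t k' Q' : good Q' -> 0 <= s -> t <= u ^+ j * (u * (2 * s)) ->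
    u * (2 * s) <= W (S Q') / m (S Q') ->
    low_mass k' Q' t <= (1 - dl) ^+ j * m (stopping k' Q' s).
  move=> + s0 ts; elim: k' Q' => [|k' IHk] Q' gQ' hav.
    have mQ' := m_gt0 gQ'; rewrite /=; case: ifP => [h1|/negbT h1]; case: ifP => h2.
    - have tl : t <= u ^+ j * (W (S Q') / m (S Q')).
        by apply: (le_trans ts); rewrite ler_wpM2l.
      have := low_mass_mono 0 gQ' tl; rewrite /= h1 => /le_trans; apply.
      exact: (IH 0%N).
    (* Here u <= 1/2 gives t <= s, so a final box with average below [t] would itself have been
       stopped. *)
    - exfalso; move/negbT: h2; rewrite -leNgt => h2.
      have : s * m (S Q') < t * m (S Q') by exact: le_lt_trans h1.
      rewrite ltr_pM2r//; apply/negP; rewrite -leNgt (le_trans ts)//.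
      apply: (@le_trans _ _ (1 * (u * (2 * s)))).
        by rewrite ler_wpM2r// !mulr_ge0// ltW.
      by rewrite mul1r; have := ler_wpM2r s0 u12; lra.
    - by rewrite mulr_ge0// ltW.
    - by rewrite f0// mulr0.
  have mQ' := m_gt0 gQ'; rewrite [stopping _ _ _]/=; case: ifP => [h1|/negbT h1].
    have tl : t <= u ^+ j * (W (S Q') / m (S Q')).
      by apply: (le_trans ts); rewrite ler_wpM2l.
    exact: le_trans (low_mass_mono _ gQ' tl) (IH _ _ gQ').
  have gl := good_lft gQ'; have gr := good_rgt gQ'.
  rewrite hm.2 ?mulrDr /=; last 3 first.
  - exact: stopping_measurable.
  - exact: stopping_measurable.
  - exact: stopping_disj.
  rewrite -leNgt in h1.
  have [c1 c2] := W_child gQ'; have [e1 e2] := S_half gQ'.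
  have us : u * (s * m (S Q')) <= u * W (S Q') by rewrite ler_wpM2l// ltW.
  have m2 : 0 < m (S Q') / 2 by rewrite divr_gt0.
  apply: lerD; apply: IHk => //; rewrite ?e1 ?e2 ler_pdivlMr//.
    apply: le_trans c1; apply: le_trans us; rewrite le_eqVlt; apply/orP; left.
    by apply/eqP; field.
  apply: le_trans c2; apply: le_trans us; rewrite le_eqVlt; apply/orP; left.
  by apply/eqP; field.
have mQ := m_gt0 gQ; have WQ := W_gt0 gQ.
apply: le_trans (inner (W (S Q) / m (S Q) / 2) _ k Q gQ _ _ _) _.
- by rewrite !divr_ge0// ltW.
- rewrite le_eqVlt; apply/orP; left; apply/eqP; rewrite exprSr; field.
  by rewrite gt_eqF.
- rewrite [2 * _]mulrC divfK// ler_piMl//.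
  by rewrite divr_ge0// ltW.
by rewrite exprSr -[leRHS]mulrA ler_wpM2l// stopping_m.
Qed.

(** Each box of [F] is of one of two kinds. Either more than a proportion [dl] of it lies outside
    [E], which the first term pays for, or the part outside [E] carries at most a quarter of its
    W-mass, so that its average is at most 4/3 eta. Positivity of W makes this strictly less than 2
    eta, and the box is counted in [low_mass]. *)
Lemma simple_set_low_mass k Q F E eta : good Q -> simple_set k Q F ->
  measurable E -> 0 <= eta ->
  (forall A, measurable A -> A `<=` E -> W A <= eta * m A) ->
  m F <= m (F `\` E) / dl + low_mass k Q (2 * eta).
Proof.
move=> + + mE eta0 hE; elim: k Q F => [|k IH] Q F gQ /=.
  have mQ := m_gt0 gQ; have WQ := W_gt0 gQ; have mSQ := mS gQ.
  case=> ->; first by rewrite set0D f0// mul0r add0r; case: ifP => // _; exact: ltW.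
  have mD : measurable (S Q `\` E) by exact: measurableD.
  have [h|h] := leP (m (S Q `\` E)) (dl * m (S Q)); last first.
    apply: ler_wpDr; first by case: ifP => // _; exact: ltW.
    by rewrite ler_pdivlMr// mulrC ltW.
  have h1 := W_small gQ mD (@subDsetl _ _ _) h.
  have mI : measurable (S Q `&` E) by exact: measurableI.
  have h2 := hE _ mI (@subIsetr _ _ _).
  have h3 : m (S Q `&` E) <= m (S Q) by apply: content_like_le => //; exact: subIsetl.
  have h4 := ler_wpM2l eta0 h3.
  have : W (S Q) <= W (S Q `&` E) + W (S Q `\` E).
    by rewrite -{1}(setUIDK (S Q) E); exact: content_likeU_le.
  move=> h5; rewrite ifT; last by lra.
  by rewrite lerDr divr_ge0 ?(ltW dl0)//; exact: content_like_ge0.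
move=> [F1 [F2 [s1 s2 ->]]].
have gl := good_lft gQ; have gr := good_rgt gQ.
have m1 := simple_set_measurable gl s1; have m2 := simple_set_measurable gr s2.
have dj : F1 `&` F2 = set0.
  rewrite -subset0 -(S_disj gQ).
  by apply: setISS; [exact: simple_set_sub s1|exact: simple_set_sub s2].
rewrite hm.2// setDUl hm.2; last 3 first.
- exact: measurableD.
- exact: measurableD.
- by rewrite -subset0 -dj; apply: setISS; exact: subDsetl.
have := IH _ _ gl s1; have := IH _ _ gr s2; rewrite mulrDl; lra.
Qed.

(** Combines the two previous bounds on a union of boxes close to [E]. The threshold carries a
    factor 1/2 because [simple_set_low_mass] doubles it before [low_mass_decay] applies. *)
Lemma sublevel_decay j Q E : good Q -> measurable E -> E `<=` S Q ->
  (forall e, 0 < e -> exists k F,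
    [/\ simple_set k Q F, m (E `\` F) <= e & m (F `\` E) <= e]) ->
  (forall A, measurable A -> A `<=` E ->
     W A <= u ^+ j * (W (S Q) / m (S Q)) / 2 * m A) ->
  m E <= (1 - dl) ^+ j * m (S Q).
Proof.
move=> gQ mE ES happ hE; have mQ := m_gt0 gQ; have WQ := W_gt0 gQ.
apply/ler_addgt0Pr => e e0.
(* [E] minus [F] enters with coefficient 1 and [F] minus [E] with coefficient 1/dl, so the two
   errors add up to [e]. *)
have [k [F [sF h1 h2]]] := happ (e / (1 + dl^-1)) ltac:(by rewrite divr_gt0// addr_gt0// invr_gt0).
have mF := simple_set_measurable gQ sF.
have eta0 : 0 <= u ^+ j * (W (S Q) / m (S Q)) / 2.
  by rewrite divr_ge0// mulr_ge0// ?exprn_ge0 ?divr_ge0// ltW.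
have := simple_set_low_mass gQ sF mE eta0 hE; rewrite [2 * _]mulrC divfK//.
have := low_mass_decay j k gQ => h3 h4.
have h5 : m E <= m (E `\` F) + m F.
  apply: le_trans (content_likeU_le hm (measurableD mE mF) mF).
  apply: content_like_le => //; first by apply: measurableU => //; exact: measurableD.
  by move=> x Ex; case: (pselect (F x)) => ?; [right|left].
have h6 : m (F `\` E) / dl <= e / (1 + dl^-1) / dl by rewrite ler_pM2r ?invr_gt0.
have h7 : e / (1 + dl^-1) + e / (1 + dl^-1) / dl = e.
  have c0 : 1 + dl^-1 != 0 by rewrite gt_eqF// addr_gt0// invr_gt0.
  by rewrite -[X in X + _]mulr1 -mulrDr divfK.
lra.
Qed.

(** Inner approximation by the generation-[k] boxes contained in [A]: missed points lie in boxes
    straddling its boundary, which are thin when [k] is large. *)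
Lemma simple_set_inner k Q A : good Q -> exists F, [/\ simple_set k Q F, F `<=` A &
  forall x, A x -> S Q x -> ~ F x -> exists Q',
    [/\ good Q', S Q' x, ~ (S Q' `<=` A) & m (S Q') = m (S Q) / 2 ^+ k]].
Proof.
elim: k Q => [|k IH] Q gQ.
  case: (pselect (S Q `<=` A)) => h.
    by exists (S Q); split; [right|exact: h|move=> x _ ? []].
  exists set0; split; [by left|exact: sub0set|].
  by move=> x _ Sx _; exists Q; split => //; rewrite expr0 divr1.
have [F1 [s1 A1 h1]] := IH _ (good_lft gQ).
have [F2 [s2 A2 h2]] := IH _ (good_rgt gQ).
have [e1 e2] := S_half gQ.
exists (F1 `|` F2); split; first by exists F1, F2.
  by rewrite subUset; split.
move=> x Ax SQx /not_orP[n1 n2].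
have [Sx|Sx] : (S (lft Q) `|` S (rgt Q)) x by rewrite -S_split.
  have [Q' [g' S' n' v']] := h1 x Ax Sx n1; exists Q'; split => //.
  by rewrite v' e1 exprS invfM mulrA.
have [Q' [g' S' n' v']] := h2 x Ax Sx n2; exists Q'; split => //.
by rewrite v' e2 exprS invfM mulrA.
Qed.

End binary_tree.

Section restricted_measure.
Context d {T : measurableType d} {R : realType}.

Lemma restrict_continuous (mu : {measure set T -> \bar R}) (V : set T)
    (A : nat -> set T) (e : R) : measurable V -> (mu V < +oo)%E ->
  (forall k, measurable (A k)) -> (forall k, A k `<=` A k.+1) -> 0 < e ->
  exists k, fine (mu ((\bigcup_i A i `\` A k) `&` V)) <= e.
Proof.
move=> mV Voo mA ndA e0.
have hm := content_like_restrict mV Voo.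
have mU : measurable (\bigcup_i A i) by apply: bigcup_measurable.
have nd : {homo (fun k => A k `&` V) : n m / (n <= m)%N >-> (n <= m)%O}.
  apply: homo_leq => [X|Y X Z|k]; [exact: lexx|exact: le_trans|].
  by apply/subsetPset; exact: setSI.
have := @nondecreasing_cvg_mu _ _ _ mu (fun k => A k `&` V)
  (fun k => measurableI _ _ (mA k) mV).
rewrite -setI_bigcupl => /(_ (measurableI _ _ mU mV) nd) cv.
have fU : mu (\bigcup_i A i `&` V) \is a fin_num.
  rewrite ge0_fin_numE//; apply: le_lt_trans Voo.
  by apply: le_measure; rewrite ?inE//; exact: measurableI.
rewrite -(fineK fU) in cv.
move/fine_cvg: cv => /cvgrPdist_le /(_ _ e0) [N _ hN].
exists N; have := hN N (leqnn N).
have AU : A N `<=` \bigcup_i A i by move=> x Ax; exists N.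
rewrite (content_likeD hm (mA N) mU AU) => h.
by apply: le_trans h; exact: ler_norm.
Qed.

End restricted_measure.

(** * Bisection of boxes in R^n *)

Section boxes.
Context {R : realType} {n : nat}.
Hypothesis n0 : (0 < n)%N.
Local Notation mu := (@lebesgueRn R n).
Local Notation box_t := ('rV[R]_n * 'rV[R]_n)%type.
Implicit Types (Q : box_t).

Definition bset Q : set (Rn R n) := box Q.1 Q.2.
Definition side Q (i : 'I_n) : R := Q.2 ord0 i - Q.1 ord0 i.
Definition longest Q : 'I_n := [arg max_(i > Ordinal n0) side Q i]%O.
Definition midpt Q (i : 'I_n) : R := (Q.1 ord0 i + Q.2 ord0 i) / 2.
Definition blft Q : box_t :=
  (Q.1, \row_i if i == longest Q then midpt Q i else Q.2 ord0 i).
Definition brgt Q : box_t :=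
  (\row_i if i == longest Q then midpt Q i else Q.1 ord0 i, Q.2).

(* Halving the longest side keeps all ratios of sides at most 2.              *)
Definition quasicube Q : Prop :=
  (forall i, 0 < side Q i) /\ forall i j, side Q i <= 2 * side Q j.

Lemma le_longest Q i : side Q i <= side Q (longest Q).
Proof. by rewrite /longest; case: arg_maxP => // j _ /(_ i isT). Qed.

Lemma side_lft Q i :
  side (blft Q) i = if i == longest Q then side Q i / 2 else side Q i.
Proof. by rewrite /side /= mxE; case: ifP => // _; rewrite /midpt; lra. Qed.

Lemma side_rgt Q i :
  side (brgt Q) i = if i == longest Q then side Q i / 2 else side Q i.
Proof. by rewrite /side /= mxE; case: ifP => // _; rewrite /midpt; lra. Qed.

Let quasicube_half Q Q' : quasicube Q ->
  (forall i, side Q' i = if i == longest Q then side Q i / 2 else side Q i) ->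
  quasicube Q'.
Proof.
move=> [h1 h2] h; split=> [i|i j]; rewrite !h.
  by have := h1 i; case: ifP => _ //; lra.
have i0 := h1 i; have j0 := h1 j; have ij := h2 i j; have il := le_longest Q i.
by case: ifP => [_|_]; case: ifP => [/eqP jl|_] //; rewrite ?jl; lra.
Qed.

Lemma quasicube_lft Q : quasicube Q -> quasicube (blft Q).
Proof. by move=> qQ; apply: quasicube_half qQ _ => i; exact: side_lft. Qed.

Lemma quasicube_rgt Q : quasicube Q -> quasicube (brgt Q).
Proof. by move=> qQ; apply: quasicube_half qQ _ => i; exact: side_rgt. Qed.

Lemma measurable_bset Q : measurable (bset Q).
Proof. exact: measurable_boxRn. Qed.

Lemma bset_split Q : quasicube Q -> bset Q = bset (blft Q) `|` bset (brgt Q).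
Proof.
move=> [h1 _].
have lm i : Q.1 ord0 i < midpt Q i < Q.2 ord0 i.
  by have := h1 i; rewrite /side /midpt => ?; apply/andP; split; lra.
apply/seteqP; split => [x h|x [h|h] i].
- have [xm|mx] := leP ((x : 'rV[R]_n) ord0 (longest Q)) (midpt Q (longest Q)).
    left=> i; have := h i; rewrite !mxE; case: eqP => [->|//].
    by move=> /andP[-> _].
  right=> i; have := h i; rewrite !mxE; case: eqP => [->|//].
  by move=> /andP[_ ->]; rewrite andbT.
- have := h i; rewrite !mxE; case: eqP => // _ /andP[-> /=].
  by move=> /le_trans; apply; case/andP: (lm i) => _ /ltW.
- have := h i; rewrite !mxE; case: eqP => // _ /andP[+ ->].
  by case/andP: (lm i) => + _ => /lt_trans h' /h' ->.
Qed.

Lemma bset_disj Q : bset (blft Q) `&` bset (brgt Q) = set0.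
Proof.
rewrite -subset0 => x [/(_ (longest Q)) + /(_ (longest Q))].
by rewrite !mxE eqxx => /andP[_ h1] /andP[/lt_le_trans /(_ h1)]; rewrite ltxx.
Qed.

Lemma mu_bset Q : quasicube Q -> mu (bset Q) = (\prod_(i < n) side Q i)%:E.
Proof.
by move=> [h _]; rewrite lebesgueRn_box// => i; rewrite -subr_ge0 ltW//; exact: h.
Qed.

Let prod_half Q Q' :
  (forall i, side Q' i = if i == longest Q then side Q i / 2 else side Q i) ->
  \prod_(i < n) side Q' i = (\prod_(i < n) side Q i) / 2.
Proof.
move=> h; rewrite (bigD1 (longest Q))//= [in RHS](bigD1 (longest Q))//=.
rewrite h eqxx mulrAC; congr (_ * _ / _).
by apply: eq_bigr => i /negbTE il; rewrite h il.
Qed.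

Lemma mu_blft Q : quasicube Q ->
  fine (mu (bset (blft Q))) = fine (mu (bset Q)) / 2.
Proof.
move=> qQ; rewrite !mu_bset//; last exact: quasicube_lft.
by rewrite /= (@prod_half Q)// => i; exact: side_lft.
Qed.

Lemma mu_brgt Q : quasicube Q ->
  fine (mu (bset (brgt Q))) = fine (mu (bset Q)) / 2.
Proof.
move=> qQ; rewrite !mu_bset//; last exact: quasicube_rgt.
by rewrite /= (@prod_half Q)// => i; exact: side_rgt.
Qed.

Lemma mu_bset_gt0 Q : quasicube Q -> 0 < fine (mu (bset Q)).
Proof. by move=> qQ; rewrite mu_bset//= prodr_gt0// => i _; case: qQ => + _; apply. Qed.

(** Turns small volume into short sides, which is what bisection delivers only for boxes with
    comparable sides. *)
Lemma side_exp_le Q i : quasicube Q -> side Q i ^+ n <= 2 ^+ n * fine (mu (bset Q)).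
Proof.
move=> qQ; rewrite mu_bset//= -[in side Q i ^+ n](card_ord n) -[in 2 ^+ n](card_ord n).
rewrite -!prodr_const -big_split /=; apply: ler_prod => j _.
by case: qQ => h1 h2; rewrite (ltW (h1 i)) h2.
Qed.

Variable Q0 : box_t.
Hypothesis qQ0 : quasicube Q0.
Let V := bset Q0.
Let m A := fine (mu (A `&` V)).

Definition sub_quasicube Q := quasicube Q /\ bset Q `<=` bset Q0.

Lemma sub_quasicube_lft Q : sub_quasicube Q -> sub_quasicube (blft Q).
Proof.
move=> [qQ QV]; split; first exact: quasicube_lft.
by apply: subset_trans QV; rewrite (bset_split qQ); exact: subsetUl.
Qed.

Lemma sub_quasicube_rgt Q : sub_quasicube Q -> sub_quasicube (brgt Q).
Proof.
move=> [qQ QV]; split; first exact: quasicube_rgt.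
by apply: subset_trans QV; rewrite (bset_split qQ); exact: subsetUr.
Qed.

Let Voo : (mu V < +oo)%E.
Proof. by rewrite mu_bset// ltry. Qed.

Let hm : content_like m.
Proof. by apply: content_like_restrict Voo; exact: measurable_bset. Qed.

Let mE Q : sub_quasicube Q -> m (bset Q) = fine (mu (bset Q)).
Proof. by move=> [_ QV]; rewrite /m fine_mu_restrict. Qed.

Let m_half Q : sub_quasicube Q ->
  m (bset (blft Q)) = m (bset Q) / 2 /\ m (bset (brgt Q)) = m (bset Q) / 2.
Proof.
move=> gQ; have [qQ _] := gQ.
rewrite !mE//; [|exact: sub_quasicube_rgt|exact: sub_quasicube_lft].
by split; [exact: mu_blft|exact: mu_brgt].
Qed.

Local Notation approx := (approximable bset blft brgt m Q0).

Let gQ0 : sub_quasicube Q0. Proof. by split. Qed.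

(** After enough bisections all sides are at most eta, so the points missed by the inner
    approximation lie in the slab t - eta < x_i <= t of [Q0]. Its measure is eta times the product
    [c] of the other sides, which is [e]. *)
Let approximable_halfspace i (t : R) :
  approx [set x : Rn R n | (x : 'rV[R]_n) ord0 i <= t].
Proof.
set A := [set x | _].
have mA : measurable A.
  have mc := @measurable_coordRn R n i.
  by have := mc measurableT _ (measurable_itv `]-oo, t]); rewrite setTI.
split=> // e e0.
pose c := \prod_(j < n | j != i) side Q0 j.
have c0 : 0 < c by apply: prodr_gt0 => j _; case: qQ0 => + _; apply.
pose eta := e / c; have eta0 : 0 < eta by rewrite divr_gt0.
pose v := m (bset Q0); have v0 : 0 < v by rewrite /v mE//; exact: mu_bset_gt0.
have [k hk] : exists k : nat, 2 ^+ n * (v / 2 ^+ k) <= eta ^+ n.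
  have en0 : 0 < eta ^+ n by rewrite exprn_gt0.
  exists (Num.truncn (2 ^+ n * v / eta ^+ n)).+1.
  set K := (Num.truncn _).+1.
  have : 2 ^+ n * v / eta ^+ n < K%:R.
    by apply: truncnS_gt; rewrite divr_ge0 ?(ltW en0)// mulr_ge0 ?(ltW v0)// exprn_ge0.
  have K2 : K%:R < 2 ^+ K :> R by rewrite -natrX ltr_nat ltn_expl.
  move=> /lt_trans /(_ K2) /ltW h.
  by rewrite mulrA ler_pdivrMr ?exprn_gt0// [leRHS]mulrC -ler_pdivrMr.
have [F [sF FA hF]] := @simple_set_inner _ _ _ _ bset blft brgt sub_quasicube m
  sub_quasicube_lft sub_quasicube_rgt (fun Q gQ => bset_split gQ.1) m_half k Q0 A gQ0.
have mF : measurable F.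
  exact: (simple_set_measurable sub_quasicube_lft sub_quasicube_rgt
    (fun Q _ => measurable_bset Q) gQ0 sF).
exists k, F; split => //; last first.
  have -> : F `\` A = set0 by apply/seteqP; split => // x [/FA].
  by rewrite /m set0I measure0 ltW.
pose b1 : 'rV[R]_n := \row_j if j == i then t - eta else Q0.1 ord0 j.
pose b2 : 'rV[R]_n := \row_j if j == i then t else Q0.2 ord0 j.
have b12 j : b1 ord0 j <= b2 ord0 j.
  rewrite !mxE; case: eqP => _; first by lra.
  by rewrite -subr_ge0 ltW//; case: qQ0 => + _; apply.
have sub : ((A `&` bset Q0) `\` F) `&` V `<=` (box b1 b2 : set (Rn R n)).
  move=> x [[[Ax Qx] nF] _] j; rewrite !mxE.
  have [Q' [gQ' xQ' nA v']] := hF x Ax Qx nF; have q' := gQ'.1.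
  case: eqP => [->|_]; last exact: Qx.
  rewrite Ax andbT.
  have [y [yQ' yA]] : exists y, bset Q' y /\ ~ A y.
    apply: contrapT => h; apply: nA => y yQ'; apply: contrapT => yA.
    by apply: h; exists y.
  have sQ' : side Q' i <= eta.
    rewrite -(@ler_pXn2r _ n)// ?nnegrE ?(ltW eta0)//; last first.
      by rewrite ltW//; case: q' => + _; apply.
    apply: le_trans (side_exp_le i q') _; apply: le_trans hk.
    by rewrite -mE// v'.
  have /andP[x1 x2] := xQ' i; have /andP[y1 y2] := yQ' i.
  move/negP: yA; rewrite -ltNge => yt; move: sQ'; rewrite /side; lra.
have -> : e = fine (mu (box b1 b2 : set (Rn R n))).
  rewrite lebesgueRn_box//= (bigD1 i)//= !mxE eqxx.
  rewrite (eq_bigr (fun j => side Q0 j)); last first.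
    by move=> j /negbTE ji; rewrite !mxE ji.
  rewrite -/c (_ : t - (t - eta) = eta); last by lra.
  by rewrite /eta divfK// gt_eqF.
apply: fine_le.
- rewrite ge0_fin_numE//; apply: le_lt_trans Voo; apply: le_measure; rewrite ?inE.
  + apply: measurableI; last exact: measurable_bset.
    by apply: measurableD => //; apply: measurableI => //; exact: measurable_bset.
  + exact: measurable_bset.
  + exact: subIsetr.
- by rewrite lebesgueRn_box.
- apply: le_measure; rewrite ?inE//; last exact: measurable_boxRn.
  apply: measurableI; last exact: measurable_bset.
  by apply: measurableD => //; apply: measurableI => //; exact: measurable_bset.
Qed.

Let m_cont (A : nat -> set (Rn R n)) : (forall k, measurable (A k)) ->
  (forall k, A k `<=` A k.+1) -> forall e, 0 < e ->
  exists k, m (\bigcup_i A i `\` A k) <= e.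
Proof.
by move=> mA ndA e e0; exact: restrict_continuous (measurable_bset Q0) Voo mA ndA e0.
Qed.

Let approx0 : approx set0.
Proof. exact: approximable0. Qed.

Let approxC A : approx A -> approx (~` A).
Proof.
apply: (approximableC sub_quasicube_lft sub_quasicube_rgt
  (fun Q gQ => bset_split gQ.1) (fun Q _ => bset_disj Q) gQ0).
Qed.

Let approx_bigcup (A : nat -> set (Rn R n)) :
  (forall k, approx (A k)) -> approx (\bigcup_k A k).
Proof.
apply: (approximable_bigcup hm sub_quasicube_lft sub_quasicube_rgt
  (fun Q _ => measurable_bset Q) (fun Q gQ => bset_split gQ.1) gQ0 m_cont).
Qed.

Let approximable_coord i (B : set (measurableTypeR R)) : measurable B ->
  approx [set x : Rn R n | B ((x : 'rV[R]_n) ord0 i)].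
Proof.
move=> mB; suff : (@RGenOInfty.G R).-sigma.-measurable `<=`
    [set B | approx [set x : Rn R n | B ((x : 'rV[R]_n) ord0 i)]].
  by move/(_ B); apply; rewrite -RGenOInfty.measurableE.
apply: smallest_sub.
  split.
  - exact: approx0.
  - by move=> C hC; rewrite setTD; exact: approxC.
  - by move=> F hF; exact: (approx_bigcup hF).
move=> _ [t ->] /=.
have -> : [set x : Rn R n | `]t, +oo[%classic ((x : 'rV[R]_n) ord0 i)] =
    ~` [set x : Rn R n | (x : 'rV[R]_n) ord0 i <= t].
  by apply/seteqP; split => x /=; rewrite in_itv/= andbT ltNge => /negP.
exact/approxC/approximable_halfspace.
Qed.

Let approximable_borel (A : set (borelRn R n)) : measurable A ->
  approx (A : set (Rn R n)).
Proof.
move: A; apply: smallest_sub.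
  split.
  - exact: approx0.
  - by move=> C hC; rewrite setTD; exact: approxC.
  - by move=> F hF; exact: (approx_bigcup hF).
move=> A; rewrite -bigcup_seq => -[i _ [B mB <-]].
by rewrite setTI; exact: approximable_coord.
Qed.

(** By definition of the outer measure, a Lebesgue measurable set inside V is enclosed in a Borel
    set [H] with excess at most e/3. A union of boxes approximating [H] within e/3 then serves for
    [A]. *)
Lemma approximable_quasicube (A : set (Rn R n)) : measurable A -> approx A.
Proof.
move=> mA; split => // e e0; have e30 : 0 < e / 3 by rewrite divr_gt0.
have mAV : measurable (A `&` V) by apply: measurableI => //; exact: measurable_bset.
have fAV : mu (A `&` V) \is a fin_num.
  rewrite ge0_fin_numE//; apply: le_lt_trans Voo.
  by apply: le_measure; rewrite ?inE//; exact: measurable_bset.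
have [_ [F [mF AF] <-] hF] := lb_ereal_inf_adherent e30 fAV.
pose H : set (borelRn R n) := \bigcup_k F k.
have mH : measurable H by exact: bigcup_measurable.
have mH' : measurable (H : set (Rn R n)).
  by apply: sub_caratheodory; apply: sub_sigma_algebra.
have muH : (mu (H : set (Rn R n)) <= mu (A `&` V) + (e / 3)%:E)%E.
  apply: le_trans (ltW hF).
  rewrite /lebesgueRn /completed_measure_extension measurable_mu_extE//.
  exact: (@measure_sigma_subadditive _ _ _ (borel_lebesgue R n)).
have [k [G [sG h1 h2]]] := (approximable_borel mH).2 _ e30.
have mG : measurable G.
  exact: (simple_set_measurable sub_quasicube_lft sub_quasicube_rgt
    (fun Q _ => measurable_bset Q) gQ0 sG).
have GV : G `<=` V.
  exact: (simple_set_sub sub_quasicube_lft sub_quasicube_rgt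
    (fun Q gQ => bset_split gQ.1) gQ0 sG).
have mV := measurable_bset Q0.
have mHA : m (H `\` (A `&` V)) <= e / 3.
  rewrite (content_likeD hm mAV mH' AF) lerBlDr -lee_fin EFinD.
  rewrite {2}/m -setIA setIid (fineK fAV) addeC; apply: le_trans muH.
  rewrite /m fineK.
    by apply: le_measure; rewrite ?inE//; exact: measurableI.
  rewrite ge0_fin_numE//; apply: le_lt_trans Voo.
  by apply: le_measure; rewrite ?inE//; exact: measurableI.
exists k, G; split => //.
- apply: le_trans (_ : e / 3 <= e); last by lra.
  apply: le_trans h1; apply: (content_like_le hm).
  + by apply: measurableD.
  + by apply: measurableD => //; exact: measurableI.
  + by move=> x [[Ax Vx] nG]; split => //; split => //; exact: AF.
- have u1 : measurable (G `\` (H : set (Rn R n))) by exact: measurableD.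
  have u2 : measurable ((H : set (Rn R n)) `\` (A `&` V)) by exact: measurableD.
  apply: (@le_trans _ _ (m ((G `\` (H : set (Rn R n))) `|` (H `\` (A `&` V))))).
    apply: (content_like_le hm); [exact: measurableD|exact: measurableU|].
    move=> x [Gx nA]; case: (pselect (H x)) => Hx; [right|by left].
    by split => // -[].
  by have := content_likeU_le hm u1 u2; lra.
Qed.

End boxes.

(** * From tails to mean oscillation *)

Section second_moment.
Context {R : realType}.

(** Square 1 + x <= exp x at x = (ln y) / 2. *)
Lemma sqr_ln_le (y : R) : 1 <= y -> ln y ^+ 2 <= 4 * y.
Proof.
move=> y1; have y0 : 0 < y by apply: lt_le_trans y1.
have l0 : 0 <= ln y by exact: ln_ge0.
have h : 1 + ln y / 2 <= expR (ln y / 2) by exact: expR_ge1Dx.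
have : (1 + ln y / 2) ^+ 2 <= expR (ln y / 2) ^+ 2.
  by rewrite ler_sqr ?nnegrE ?expR_ge0// addr_ge0// divr_ge0.
rewrite -expRM_natl (_ : 2%:R * (ln y / 2) = ln y); last by field.
rewrite lnK ?posrE// => k.
have : ln y ^+ 2 / 4 <= (1 + ln y / 2) ^+ 2.
  have -> : (1 + ln y / 2) ^+ 2 = 1 + ln y + ln y ^+ 2 / 4 by field.
  by rewrite lerDr addr_ge0.
lra.
Qed.

Lemma bernoulli_exp (x : R) (j : nat) : 0 <= x <= 1 -> x * j.+1%:R <= (1 + x) ^+ j.
Proof.
move=> /andP[x0 x1]; suff h : 1 + x * j%:R <= (1 + x) ^+ j.
  by apply: le_trans h; rewrite -natr1 mulrDr mulr1 addrC lerD2r.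
elim: j => [|j IH]; first by rewrite mulr0 addr0 expr0.
rewrite exprS -natr1; apply: (@le_trans _ _ ((1 + x) * (1 + x * j%:R))); last first.
  by rewrite ler_wpM2l// addr_ge0.
have : 0 <= x * x * j%:R by rewrite !mulr_ge0.
lra.
Qed.

Lemma geometric_partial_sum (g : R) (N : nat) : 0 <= g < 1 ->
  \sum_(0 <= j < N) g ^+ j <= (1 - g)^-1.
Proof.
move=> /andP[g0 g1].
have E : (1 - g) * \sum_(0 <= j < N) g ^+ j = 1 - g ^+ N.
  elim: N => [|N IH]; first by rewrite big_geq// mulr0 expr0 subrr.
  by rewrite big_nat_recr//= mulrDr IH exprS; ring.
rewrite -[leRHS]mul1r ler_pdivlMr ?subr_gt0// mulrC E.
by rewrite lerBlDr lerDl exprn_ge0.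
Qed.

(* [tail_coef u dl j] dominates [(ln y)^2] for [u^(j+1)/2 <= y < u^j/2], yet  *)
(* is summable against [(1 - dl)^j].                                          *)
Definition tail_coef (u dl : R) (j : nat) : R :=
  ((1 - ln u) / (dl / 4)) ^+ 2 * ((1 + dl / 4) ^+ 2) ^+ j.

Lemma tail_coef_ge (u dl : R) (j : nat) : 0 < u < 1 -> 0 < dl < 1 ->
  (1 - ln u * j.+1%:R) ^+ 2 <= tail_coef u dl j.
Proof.
move=> /andP[u0 u1] /andP[d0 d1].
have l0 : ln u < 0 by rewrite ln_lt0// u0.
have x01 : 0 <= dl / 4 <= 1 by apply/andP; split; lra.
have x0 : 0 < dl / 4 by rewrite divr_gt0.
have h := bernoulli_exp j x01.
rewrite /tail_coef -exprM mulnC exprM -exprMn ler_sqr ?nnegrE; last 2 first.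
- by rewrite subr_ge0; apply: (@le_trans _ _ 0) => //; rewrite mulr_le0_ge0// ltW.
- rewrite mulr_ge0 ?exprn_ge0 ?addr_ge0 ?(ltW x0)// divr_ge0 ?(ltW x0)//.
  by rewrite subr_ge0; lra.
apply: (@le_trans _ _ ((1 - ln u) * j.+1%:R)).
  have j1 : 1 <= j.+1%:R :> R by rewrite ler1n.
  by rewrite mulrBl mul1r lerD2r.
rewrite -mulrA ler_wpM2l//; first by rewrite subr_ge0; lra.
by rewrite ler_pdivlMl.
Qed.

(** The quarter in [dl / 4] is chosen so that (1 + dl/4)^2 <= 1 + dl, and (1 + dl)(1 - dl) < 1. *)
Lemma tail_rate (dl : R) : 0 < dl < 1 ->
  0 <= (1 + dl / 4) ^+ 2 * (1 - dl) < 1.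
Proof.
move=> /andP[d0 d1]; apply/andP; split.
  by rewrite mulr_ge0 ?sqr_ge0// subr_ge0 ltW.
apply: (@le_lt_trans _ _ ((1 + dl) * (1 - dl))).
  rewrite ler_wpM2r ?subr_ge0 ?(ltW d1)//.
  have -> : (1 + dl / 4) ^+ 2 = 1 + dl / 2 + dl * dl / 16 by field.
  have : dl * dl <= dl * 1 by rewrite ler_wpM2l// ltW.
  lra.
have : 0 < dl * dl by rewrite mulr_gt0.
have -> : (1 + dl) * (1 - dl) = 1 - dl * dl by ring.
lra.
Qed.

(** Take the least [j] with u^j / 2 <= y. It is positive because y < 1/2, and its predecessor is the
    index wanted: |ln y| <= ln 2 - j ln u <= 1 - j ln u. *)
Lemma sqr_ln_tail (u dl y : R) : 0 < u <= 2^-1 -> 0 < dl < 1 -> 0 < y ->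
  y < 2^-1 -> exists2 j, y < u ^+ j / 2 & ln y ^+ 2 <= tail_coef u dl j.
Proof.
move=> /andP[u0 u12] d01 y0 y12.
have u1 : u < 1 by apply: le_lt_trans u12 _; rewrite invf_lt1// ltr1n.
have ex : exists j, u ^+ j / 2 <= y.
  exists (Num.truncn y^-1).+1; set k := _.+1.
  have yk : y^-1 < k%:R by apply: truncnS_gt; rewrite invr_ge0 ltW.
  have k2 : k%:R < 2 ^+ k :> R by rewrite -natrX ltr_nat ltn_expl.
  apply: (@le_trans _ _ (2^-1 ^+ k)).
    apply: (@le_trans _ _ (u ^+ k)); last first.
      by apply: lerXn2r => //; rewrite nnegrE; [exact: ltW|rewrite invr_ge0].
    by rewrite ler_pdivrMr// ler_peMr ?ler1n// exprn_ge0// ltW.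
  rewrite exprVn -[leRHS]invrK lef_pV2 ?posrE ?exprn_gt0 ?invr_gt0//.
  by rewrite ltW// (lt_trans yk).
case: (ex_minnP ex) => j hj jmin.
have j0 : (0 < j)%N.
  by case: j hj {jmin} => //; rewrite expr0 div1r leNgt y12.
exists j.-1.
  by rewrite ltNge; apply/negP => /jmin; rewrite leqNgt prednK// leqnn.
apply: le_trans (tail_coef_ge j.-1 _ d01); last by rewrite u0.
rewrite prednK//.
have ly : ln y < 0 by rewrite ln_lt0// y0/= (lt_trans y12)// invf_lt1// ltr1n.
rewrite -sqrrN ler_sqr ?nnegrE; last 2 first.
- by rewrite oppr_ge0 ltW.
- rewrite subr_ge0; apply: (@le_trans _ _ 0) => //; rewrite mulr_le0_ge0//.
  by rewrite ltW// ln_lt0// u0.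
have uj0 : 0 < u ^+ j / 2 by rewrite divr_gt0// exprn_gt0.
have : ln (u ^+ j / 2) <= ln y by rewrite ler_ln ?posrE.
rewrite ln_div ?posrE ?exprn_gt0// lnXn// -[ln u *+ j]mulr_natr.
have : ln 2 <= 1 :> R.
  by rewrite -[leRHS]expRK ler_ln ?posrE ?expR_gt0//; have := expR_ge1Dx (1 : R); lra.
lra.
Qed.

Local Open Scope ereal_scope.
Context d (T : measurableType d).
Variables (mu : {measure set T -> \bar R}) (w : T -> R).
Hypotheses (mw : measurable_fun setT w) (w0 : forall x, (0 <= w x)%R).

(** Pointwise, the square of log (w/a) is at most 1 + 4w/a + G, where G sums [tail_coef] over the
    sublevel sets containing the point: the term 4w/a serves for w >= a, the 1 for a/2 <= w < a
    since ln 2 <= 1, and a single term of G for 0 < w < a/2. Integrating G gives a geometric series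
    of the ratio in [tail_rate]. *)
Lemma second_moment_of_tails (u dl a : R) (Q : set T) :
  (0 < u <= 2^-1)%R -> (0 < dl < 1)%R -> (0 < a)%R -> measurable Q ->
  mu Q < +oo -> \int[mu]_(y in Q) (w y)%:E <= a%:E * mu Q ->
  (forall j, mu (Q `&` [set y | (w y < u ^+ j * a / 2)%R]) <=
     ((1 - dl) ^+ j)%:E * mu Q) ->
  \int[mu]_(y in Q) (`|lne (w y)%:E - (ln a)%:E| ^+ 2) <=
    (1 + 4 + ((1 - ln u) / (dl / 4)) ^+ 2 /
      (1 - (1 + dl / 4) ^+ 2 * (1 - dl)))%:E * mu Q.
Proof.
move=> u01 d01 a0 mQ Qoo Wa tails.
have [u0 u12] := andP u01; have [d0 d1] := andP d01.
pose E j := Q `&` [set y | (w y < u ^+ j * a / 2)%R].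
have mE j : measurable (E j).
  apply: measurableI => //; have := mw measurableT (measurable_itv `]-oo, (u ^+ j * a / 2)%R[).
  by rewrite setTI; congr measurable; apply/seteqP; split => y /=; rewrite in_itv.
pose c j := tail_coef u dl j.
have l0 : (0 < (1 - ln u) / (dl / 4))%R.
  rewrite divr_gt0 ?divr_gt0// subr_gt0 (lt_trans _ ltr01)// ln_lt0// u0/=.
  by apply: le_lt_trans u12 _; rewrite invf_lt1// ltr1n.
have c_ge j : (((1 - ln u) / (dl / 4)) ^+ 2 <= c j)%R.
  rewrite /c /tail_coef ler_peMr ?sqr_ge0// exprn_ege1// -[leLHS](expr1n _ 2).
  by apply: lerXn2r; rewrite ?nnegrE ?addr_ge0 ?lerDl// ?divr_ge0// ltW.
have c0 j : (0 < c j)%R by apply: lt_le_trans (c_ge j); rewrite exprn_gt0.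
pose G y := \sum_(0 <= j <oo) ((c j)%:E * (\1_(E j) y)%:E).
have G0 y : 0 <= G y.
  by apply: nneseries_ge0 => j _ _; rewrite mule_ge0// lee_fin// ltW.
have mG : measurable_fun Q G.
  apply: ge0_emeasurable_sum => [j y _ _|j _].
    by rewrite mule_ge0// lee_fin// ltW.
  apply: measurable_funeM; apply/measurable_EFinP.
  exact: measurable_funTS (measurable_indic _).
have pointwise y : Q y -> `|lne (w y)%:E - (ln a)%:E| ^+ 2 <=
    1%:E + ((4 / a)%:E * (w y)%:E + G y).
  move=> Qy; have G_term j : (c j)%:E * (\1_(E j) y)%:E <= G y.
    apply: (@le_trans _ _ (\sum_(0 <= i < j.+1) ((c i)%:E * (\1_(E i) y)%:E))).
      rewrite big_nat_recr//= leeDr// sume_ge0// => i _.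
      by rewrite mule_ge0// lee_fin// ltW.
    by apply: nneseries_lim_ge => i _; rewrite mule_ge0// lee_fin// ltW.
  have w4 : 0 <= (4 / a)%:E * (w y)%:E by rewrite mule_ge0// lee_fin// divr_ge0// ltW.
  have := w0 y; rewrite le_eqVlt => /predU1P[wy|wy].
    (* A zero of [w] lies in every sublevel set and the coefficients stay above a positive constant,
       so G is infinite there, like the left-hand side. *)
    have GR : G y <= 1 + ((4 / a)%:E * (w y)%:E + G y).
      by rewrite addeA leeDr// adde_ge0// lee_fin.
    apply: le_trans GR; suff -> : G y = +oo by exact: leey.
    apply: eq_infty => r; pose L := ((1 - ln u) / (dl / 4))%R.
    have L2 : (0 < L ^+ 2)%R by rewrite exprn_gt0.
    pose N := (Num.truncn (r / L ^+ 2)).+1.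
    apply: (@le_trans _ _ (\sum_(0 <= i < N) ((c i)%:E * (\1_(E i) y)%:E))); last first.
      by apply: nneseries_lim_ge => i _; rewrite mule_ge0// lee_fin// ltW.
    apply: (@le_trans _ _ (\sum_(0 <= i < N) (L ^+ 2)%:E)); last first.
      apply: lee_sum => i _; rewrite indicE mem_set ?mule1 ?lee_fin ?c_ge//.
      by split=> //=; rewrite -wy divr_gt0// mulr_gt0// exprn_gt0.
    rewrite sumEFin lee_fin sumr_const_nat subn0 -mulr_natl -ler_pdivrMr//.
    have [r0|r0] := leP 0%R r; last by rewrite (@le_trans _ _ 0%R)// pmulr_lle0 ?invr_gt0// ltW.
    by rewrite ltW// truncnS_gt// divr_ge0// ltW.
  rewrite lne_EFin// -EFinB abse_EFin -EFin_expe real_normK ?num_real//.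
  rewrite -ln_div ?posrE//.
  have ya0 : (0 < w y / a)%R by rewrite divr_gt0.
  have [y1|y1] := leP 1%R (w y / a)%R.
    apply: (@le_trans _ _ ((4 / a)%:E * (w y)%:E)).
      by rewrite -EFinM lee_fin (le_trans (sqr_ln_le y1))// mulrA mulrAC.
    by rewrite addeCA leeDl// adde_ge0// lee_fin.
  have [y2|y2] := leP (2^-1)%R (w y / a)%R.
    apply: (@le_trans _ _ 1%:E); last by rewrite leeDl// adde_ge0.
    rewrite lee_fin -[leRHS](expr1n _ 2) -sqrrN ler_sqr ?nnegrE//; last first.
      by rewrite oppr_ge0 ltW// ln_lt0// ya0.
    rewrite lerNl; apply: (@le_trans _ _ (ln (2^-1)%R)); last by rewrite ler_ln ?posrE.
    rewrite lnV ?posrE// lerN2 -[leRHS]expRK ler_ln ?posrE ?expR_gt0//.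
    by have := expR_ge1Dx (1 : R); lra.
  have [j yj hj] := sqr_ln_tail u01 d01 ya0 y2.
  apply: (@le_trans _ _ (G y)); last first.
    by rewrite addeA leeDr// adde_ge0// lee_fin.
  apply: le_trans (G_term j); rewrite indicE mem_set ?mule1 ?lee_fin//.
  by split=> //=; move: yj; rewrite ltr_pdivrMr// mulrAC.
apply: (@le_trans _ _ (\int[mu]_(y in Q) (1%:E + ((4 / a)%:E * (w y)%:E + G y)))).
  apply: ge0_le_integral => //.
  - by move=> y _; exact: expe_ge0.
  - exact: measurable_funTS (measurable_sqdist_lne mw _).
  - apply: emeasurable_funD => //; apply: emeasurable_funD => //.
    by apply: measurable_funeM; apply/measurable_EFinP; exact: measurable_funTS.
have mw' : measurable_fun Q (fun y => (w y)%:E).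
  by apply/measurable_EFinP; exact: measurable_funTS.
have w4 y : 0 <= (4 / a)%:E * (w y)%:E by rewrite mule_ge0// lee_fin// divr_ge0// ltW.
rewrite ge0_integralD//; last 2 first.
- by move=> y _; rewrite adde_ge0.
- by apply: emeasurable_funD => //; exact: measurable_funeM.
rewrite ge0_integralD//; last exact: measurable_funeM.
rewrite integral_cst// ge0_integralZl//; last 2 first.
- by move=> y _; rewrite lee_fin.
- by rewrite lee_fin divr_ge0// ltW.
rewrite integral_nneseries//; last 2 first.
- move=> j; apply: measurable_funeM; apply/measurable_EFinP.
  exact: measurable_funTS (measurable_indic _).
- by move=> j y _; rewrite mule_ge0// lee_fin// ltW.
have fQ : mu Q \is a fin_num by rewrite ge0_fin_numE.
pose v := fine (mu Q); have v0 : (0 <= v)%R by exact/fine_ge0/measure_ge0.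
have vE : mu Q = v%:E by rewrite fineK.
pose g := ((1 + dl / 4) ^+ 2 * (1 - dl))%R.
have g01 : (0 <= g < 1)%R by exact: tail_rate.
pose L := (((1 - ln u) / (dl / 4)) ^+ 2)%R.
have L0 : (0 <= L)%R by exact: sqr_ge0.
rewrite -/L -/g vE.
have -> : (1 + 4 + L / (1 - g))%:E * v%:E =
    1%:E * v%:E + ((4 * v)%:E + (L * v / (1 - g))%:E).
  by rewrite -!EFinM -!EFinD; congr EFin; move: (1 - g)%R^-1%R => h; ring.
apply: leeD => //; apply: leeD.
  have a40 : (0 < 4 / a)%R by rewrite divr_gt0.
  apply: (@le_trans _ _ ((4 / a)%:E * (a%:E * v%:E))).
    by apply: lee_wpmul2l; [rewrite lee_fin ltW|rewrite -vE].
  by rewrite -!EFinM lee_fin mulrA divfK// gt_eqF.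
apply: lime_le.
  by apply: is_cvg_nneseries => j _ _; apply: integral_ge0 => y _; rewrite mule_ge0// lee_fin// ltW.
apply: nearW => N.
apply: (@le_trans _ _ (\sum_(0 <= j < N) (L * v * g ^+ j)%:E)).
  apply: lee_sum => j _; rewrite ge0_integralZl//; last 2 first.
  - by apply/measurable_EFinP; exact: measurable_funTS (measurable_indic _).
  - by rewrite lee_fin ltW.
  rewrite integral_indic// (_ : E j `&` Q = E j); last first.
    by apply/setIidPl => y [].
  apply: (@le_trans _ _ ((c j)%:E * (((1 - dl) ^+ j)%:E * mu Q))).
    by apply: lee_wpmul2l; [rewrite lee_fin ltW|exact: tails].
  rewrite vE -!EFinM lee_fin /c /tail_coef -/L /g.
  move: ((1 + dl / 4) ^+ 2)%R => X; rewrite exprMn.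
  by rewrite le_eqVlt; apply/orP; left; apply/eqP; ring.
rewrite sumEFin lee_fin -mulr_sumr.
apply: ler_wpM2l; first exact: mulr_ge0 L0 v0.
exact: geometric_partial_sum.
Qed.

End second_moment.

Section mean_oscillation.
Local Open Scope ereal_scope.
Context {R : realType} d (T : measurableType d).
Variables (mu : {measure set T -> \bar R}) (w : T -> R).
Hypotheses (mw : measurable_fun setT w).
Local Notation f y := (lne (w y)%:E).

Lemma ge0_integral_cover (g : T -> \bar R) (N : nat) (Q : 'I_N -> set T) (A : set T) :
  measurable_fun setT g -> (forall y, 0 <= g y) -> measurable A ->
  (forall i, measurable (Q i)) -> A `<=` \bigcup_i Q i ->
  \int[mu]_(y in A) g y <= \sum_(i < N) \int[mu]_(y in Q i) g y.
Proof.
move=> mg g0; have mgD D : measurable_fun D g by exact: measurable_funTS.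
elim: N Q A => [|N IH] Q A mA mQ AQ.
  by rewrite big_ord0 (_ : A = set0) ?integral_set0// -subset0 => x /AQ[[]].
rewrite big_ord_recr /= -(setUIDK A (Q ord_max)).
have m1 : measurable (A `&` Q ord_max) by exact: measurableI.
have m2 : measurable (A `\` Q ord_max) by exact: measurableD.
rewrite ge0_integral_setU//; last first.
  by apply/disj_setPS => x [[_ ?] [_]].
rewrite addeC; apply: leeD; last first.
  by apply: ge0_subset_integral => // x [].
apply: (IH (fun i => Q (widen_ord (leqnSn N) i))) => //.
move=> x [/AQ[i _ Qix] nQ]; have := ltn_ord i; rewrite leq_eqVlt => /predU1P[iN|iN].
  by exfalso; apply: nQ; rewrite (_ : ord_max = i)//; apply: val_inj => /=; case: iN.
rewrite ltnS in iN; exists (Ordinal iN) => //.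
by rewrite (_ : widen_ord _ _ = i)//; exact: val_inj.
Qed.

Lemma sqr_dist_shift (v : \bar R) (a b k : R) : (`|a - b| <= k)%R ->
  `|v - b%:E| ^+ 2 <= 2%:E * `|v - a%:E| ^+ 2 + (2 * k ^+ 2)%:E.
Proof.
move=> abk; case: v => [v||]; last 2 first.
- have E c : `|+oo - c%:E| = +oo by [].
  by rewrite !E !expe2 mulyy gt0_muley ?lte_fin// leey.
- have E c : `|-oo - c%:E| = +oo by [].
  by rewrite !E !expe2 mulyy gt0_muley ?lte_fin// leey.
rewrite -!EFinB !abse_EFin -!EFin_expe -EFinM -EFinD lee_fin !real_normK ?num_real//.
have : ((a - b) ^+ 2 <= k ^+ 2)%R.
  rewrite -[leLHS]real_normK ?num_real// ler_sqr ?nnegrE//.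
  exact: le_trans abk.
have : (0 <= (v - a - (a - b)) ^+ 2)%R by exact: sqr_ge0.
have -> : ((v - b) ^+ 2 = 2 * (v - a) ^+ 2 + 2 * (a - b) ^+ 2 - (v - a - (a - b)) ^+ 2)%R by ring.
lra.
Qed.

Lemma integral_sqr_shift (A : set T) (a b k C : R) : measurable A ->
  (`|a - b| <= k)%R ->
  \int[mu]_(y in A) `|f y - a%:E| ^+ 2 <= C%:E * mu A -> mu A < +oo ->
  \int[mu]_(y in A) `|f y - b%:E| ^+ 2 <= (2 * C + 2 * k ^+ 2)%:E * mu A.
Proof.
move=> mA abk hC Aoo.
have fA : mu A \is a fin_num by rewrite ge0_fin_numE.
have ms c : measurable_fun A (fun y => `|f y - c| ^+ 2).
  exact: measurable_funTS (measurable_sqdist_lne mw _).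
have s0 c y : 0 <= `|f y - c| ^+ 2 by exact: expe_ge0.
apply: (@le_trans _ _ (\int[mu]_(y in A) (2%:E * `|f y - a%:E| ^+ 2 + (2 * k ^+ 2)%:E))).
  apply: ge0_le_integral => //.
    by apply: emeasurable_funD => //; exact: measurable_funeM.
  by move=> y _; exact: sqr_dist_shift.
have k0 : (0 <= 2 * k ^+ 2)%R by rewrite mulr_ge0// sqr_ge0.
rewrite ge0_integralD//; last 2 first.
- by move=> y _; rewrite mule_ge0.
- exact: measurable_funeM.
rewrite ge0_integralZl// integral_cst// -(fineK fA) in hC *.
have -> : (2 * C + 2 * k ^+ 2)%:E * (fine (mu A))%:E =
    2%:E * (C%:E * (fine (mu A))%:E) + (2 * k ^+ 2)%:E * (fine (mu A))%:E.
  by rewrite -!EFinM -EFinD; congr EFin; ring.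
by apply: leeD => //; apply: lee_wpmul2l.
Qed.

(** The inequality |x| <= x^2 + 1 makes log w integrable on [A] and puts its average within D + 1 of
    [c0]. The average is therefore a real number, and moving the centre to it by
    [integral_sqr_shift] gives the constant. *)
Lemma mean_oscillation_of_center (A : set T) (c0 D : R) : measurable A ->
  0 < mu A -> mu A < +oo -> (0 <= D)%R ->
  \int[mu]_(y in A) `|f y - c0%:E| ^+ 2 <= D%:E * mu A ->
  forall av, av = (mu A)^-1 * \int[mu]_(y in A) f y ->
  (mu A)^-1 * \int[mu]_(y in A) `|f y - av| ^+ 2 <= (2 * D + 2 * (D + 1) ^+ 2)%:E.
Proof.
move=> mA A0 Aoo D0 hD av avD.
have fA : mu A \is a fin_num by rewrite ge0_fin_numE.
pose v := fine (mu A); have v0 : (0 < v)%R by rewrite fine_gt0// A0.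
have vE : mu A = v%:E by rewrite fineK.
have mf : measurable_fun setT (fun y => f y) by exact: measurable_lne_comp.
have mfA : measurable_fun A (fun y => f y) by exact: measurable_funTS.
have ms : measurable_fun A (fun y => `|f y - c0%:E| ^+ 2).
  exact: measurable_funTS (measurable_sqdist_lne mw _).
have mfc : measurable_fun A (fun y => f y - c0%:E) by exact: emeasurable_funB.
have b1 y : `|f y - c0%:E| <= `|f y - c0%:E| ^+ 2 + 1.
  case: (f y) => [r||]; last 2 first.
  - by rewrite (_ : `|+oo - c0%:E| = +oo)// expe2 mulyy addye.
  - by rewrite (_ : `|-oo - c0%:E| = +oo)// expe2 mulyy addye.
  rewrite -EFin_expe -EFinD lee_fin; set x := `|_|%R.
  have := sqr_ge0 (x - 1)%R; have x0 : (0 <= x)%R by exact: normr_ge0.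
  have -> : ((x - 1) ^+ 2 = x ^+ 2 - 2 * x + 1)%R by ring.
  lra.
have I1 : \int[mu]_(y in A) `|f y - c0%:E| <= (D + 1)%:E * mu A.
  apply: (@le_trans _ _ (\int[mu]_(y in A) (`|f y - c0%:E| ^+ 2 + 1))).
    apply: ge0_le_integral => //.
    - exact: measurableT_comp.
    - exact: emeasurable_funD.
  rewrite ge0_integralD//; last by move=> y _; exact: expe_ge0.
  by rewrite integral_cst// EFinD vE muleDl// -vE leeD.
have ifc : mu.-integrable A (fun y => f y - c0%:E).
  apply/integrableP; split => //; apply: le_lt_trans I1 _.
  by rewrite vE -EFinM ltry.
have icc : mu.-integrable A (fun=> c0%:E).
  by apply/integrableP; split => //; rewrite abse_EFin integral_cst// vE -EFinM ltry.
have intf : mu.-integrable A (fun y => f y).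
  have -> : (fun y => f y) = (fun y => (f y - c0%:E) + c0%:E).
    by apply/funext => y; rewrite subeK.
  exact: integrableD.
have E1 : \int[mu]_(y in A) (f y - c0%:E) = \int[mu]_(y in A) f y - c0%:E * mu A.
  by rewrite integralB// integral_cst.
have fI : \int[mu]_(y in A) f y \is a fin_num by exact: integrable_fin_num.
pose F := fine (\int[mu]_(y in A) f y).
have FE : \int[mu]_(y in A) f y = F%:E by rewrite fineK.
have avE : av = (F / v)%:E.
  by rewrite avD vE FE inver gt_eqF// -EFinM mulrC.
have h : (`|c0 - F / v| <= D + 1)%R.
  have := le_abse_integral mu mA mfc.
  move=> /le_trans /(_ I1); rewrite E1 FE vE -!EFinM -EFinB abse_EFin lee_fin => h.
  have -> : (c0 - F / v = - ((F - c0 * v) / v))%R by field; rewrite gt_eqF.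
  by rewrite normrN normrM normfV (gtr0_norm v0) ler_pdivrMr.
rewrite avE; have := integral_sqr_shift mA h hD Aoo.
by rewrite vE inver gt_eqF// lee_pdivrMl// muleC.
Qed.

End mean_oscillation.

(** * Doubling implies BMO *)

Section positivity.
Context {R : realType} {n : nat}.
Hypothesis n0 : (0 < n)%N.
Local Notation mu := (@lebesgueRn R n).
Variables (U : set (Rn R n)) (w : Rn R n -> R) (A : R).
Hypotheses (mw : measurable_fun setT w) (w0 : forall y, 0 <= w y).
Local Notation nu := (weighted mu mw w0).

(** Stated for arbitrary sets, because it is applied to a connected component of U whose
    measurability has not been established. *)
Lemma ge0_integral_subset d (T : measurableType d) (mu' : {measure set T -> \bar R})
    (A1 A2 : set T) (f : T -> \bar R) : (forall x, 0 <= f x)%E -> A1 `<=` A2 ->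
  (\int[mu']_(x in A1) f x <= \int[mu']_(x in A2) f x)%E.
Proof.
move=> f0 A12; rewrite integral_mkcond [leRHS]integral_mkcond.
have g0 D x : (0 <= (f \_ D) x)%E by rewrite patchE; case: ifP.
rewrite !ge0_integralTE//; apply: ereal_sup_le => _ [h hf <-]; exists h => // x.
apply: le_trans (hf x) _; rewrite !patchE; case: ifPn => [/set_mem/A12 /mem_set ->//|_].
by case: ifP.
Qed.

Hypothesis dbl : doubling_with U w A.

Let null_double z s : 0 < s -> eball z (4 * s) `<=` U -> nu (eball z s) = 0%E ->
  nu (eball z (2 * s)) = 0%E.
Proof.
move=> s0 zU zs; have := dbl s0 zU.
change (((mu (eball z (2 * s)))^-1 * nu (eball z (2 * s)) <=
  A%:E * ((mu (eball z s))^-1 * nu (eball z s)))%E -> nu (eball z (2 * s)) = 0%E).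
rewrite zs !mule0 => h; apply/eqP; rewrite eq_le measure_ge0 andbT.
have s20 : 0 < 2 * s by rewrite mulr_gt0.
have fm : mu (eball z (2 * s)) \is a fin_num by exact: lebesgueRn_eball_fin.
have m0 : 0 < fine (mu (eball z (2 * s))).
  by rewrite fine_gt0// lebesgueRn_eball_gt0//= ltey_eq fm.
by move: h; rewrite -(fineK fm) inver gt_eqF// lee_pdivrMl// mule0.
Qed.

(** Shrink to radius r / 2^k <= s, where the mass vanishes, then double k + 1 times. *)
Let null_grow z s r : 0 < s -> 0 < r -> eball z (4 * r) `<=` U ->
  nu (eball z s) = 0%E -> nu (eball z (2 * r)) = 0%E.
Proof.
move=> s0 r0 zU zs.
have H k : nu (eball z (r / 2 ^+ k)) = 0%E -> nu (eball z (2 * r)) = 0%E.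
  elim: k => [|k IH]; first by rewrite expr0 divr1; exact: null_double.
  have rk0 : 0 < r / 2 ^+ k.+1 by rewrite divr_gt0// exprn_gt0.
  have rkr : r / 2 ^+ k.+1 <= r by rewrite ler_pdivrMr ?exprn_gt0// ler_peMr ?(ltW r0)// exprn_ege1// ler1n.
  move=> /(null_double rk0) h; apply: IH.
  have -> : r / 2 ^+ k = 2 * (r / 2 ^+ k.+1) by rewrite exprS invfM; field; rewrite expf_neq0.
  by apply: h; apply: subset_trans zU; apply: eball_le; rewrite ler_wpM2l.
pose k := (Num.truncn (r / s)).+1.
have hk : r / s < k%:R by apply: truncnS_gt; rewrite divr_ge0// ltW.
have k2 : k%:R < 2 ^+ k :> R by rewrite -natrX ltr_nat ltn_expl.
apply: (H k); apply/eqP; rewrite eq_le measure_ge0 andbT -zs.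
apply: le_measure; rewrite ?inE; [exact: measurable_eball|exact: measurable_eball|].
apply: eball_le; rewrite ler_pdivrMr ?exprn_gt0// mulrC -ler_pdivrMr//.
exact: ltW (lt_trans hk k2).
Qed.

(** The points having a null ball form an open set [Z]. It is also closed in U: a point of U near
    some v in [Z] is swallowed by the null ball around v, which [null_grow] enlarges to a radius
    independent of v. So [Z] contains a component of U, and by the Lindelof property it is null. *)
Lemma doubling_positive : open U -> nonvanishing U w ->
  forall y r, 0 < r -> eball y r `<=` U -> (0 < nu (eball y r))%E.
Proof.
move=> oU nv y r r0 yU; rewrite lt_def measure_ge0 andbT; apply/negP => /eqP yr.
pose Z : set (Rn R n) := [set z | U z /\ exists2 s, 0 < s & nu (eball z s) = 0%E].
have Uy : U y by apply: yU; exact: eball_center.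
have Zy : Z y by split => //; exists r.
have oZ : open Z.
  apply: eball_subset_openP => z [Uz [s s0 zs]].
  have [t t0 tU] := open_eball_subset oU Uz.
  exists (Num.min s t); first by rewrite lt_min s0.
  move=> v zv; have /eballE zv' := zv.
  have [dvs dvt] : eudist z v < s /\ eudist z v < t by move: zv'; rewrite lt_min => /andP.
  split; first by apply: tU; exact/eballE.
  exists (s - eudist z v); first by rewrite subr_gt0.
  apply/eqP; rewrite eq_le measure_ge0 andbT -zs.
  apply: le_measure; rewrite ?inE; [exact: measurable_eball|exact: measurable_eball|].
  by apply: eball_subset; rewrite addrC subrK.
pose C := connected_component U y.
have CU : C `<=` U by exact: connected_component_sub.
have CZ : C `<=` Z.
  have -> : C = C `&` Z; last exact: subIsetr.
  apply/esym; apply: (@component_connected _ U y).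
  - by exists y; split => //; exact: connected_component_refl.
  - by exists Z.
  - exists (closure Z); first exact: closed_closure.
    apply/seteqP; split => z [Cz Zz]; split => //; first exact: subset_closure.
    have Uz := CU _ Cz; have [t t0 tU] := open_eball_subset oU Uz.
    have t80 : 0 < t / 8 by rewrite divr_gt0.
    have [v [[Uv [s s0 vs]] /eballE zv]] : Z `&` eball z (t / 8) !=set0.
      apply: Zz; apply: open_nbhs_nbhs; split; first exact: open_eball.
      exact: eball_center.
    split => //; exists (t / 8) => //.
    have v4 : eball v (4 * (t / 8)) `<=` U.
      by apply: subset_trans tU; apply: eball_subset; lra.
    have v2 := null_grow s0 t80 v4 vs.
    apply/eqP; rewrite eq_le measure_ge0 andbT -v2.
    apply: le_measure; rewrite ?inE; [exact: measurable_eball|exact: measurable_eball|].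
    by apply: eball_subset; rewrite eudistC; lra.
have [mZ nuZ] : measurable Z /\ nu Z = 0%E.
  apply: (@open_measurable_ind _ _ Z (fun V => measurable V /\ nu V = 0%E)) => //.
  - move=> F hF; have mF : measurable (\bigcup_k F k).
      by apply: bigcup_measurable => k _; exact: (hF k).1.
    split => //; apply/(negligibleP _ mF); apply: negligible_bigcup => k.
    by apply/(negligibleP _ (hF k).1); exact: (hF k).2.
  - move=> z [Uz [s s0 zs]]; exists (eball z s); first exact: open_eball.
    split; first exact: eball_center.
    move=> v t vz _; split; first exact: measurable_eball.
    apply/eqP; rewrite eq_le measure_ge0 andbT -zs.
    by apply: le_measure; rewrite ?inE; [exact: measurable_eball|exact: measurable_eball|].
have := nv y Uy; rewrite ltNge => /negP; apply; rewrite -nuZ.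
by apply: ge0_integral_subset => // x; rewrite lee_fin.
Qed.

End positivity.

(** * Mass of boxes compared with mass of balls *)

Section boxes_and_balls.
Context {R : realType} {n : nat}.
Hypothesis n0 : (0 < n)%N.
Local Notation mu := (@lebesgueRn R n).
Local Notation box_t := ('rV[R]_n * 'rV[R]_n)%type.
Implicit Types (Q : box_t).
Local Notation len Q := (side Q (longest n0 Q)).

Definition box_center Q : Rn R n := \row_i midpt Q i.

Lemma bset_box_center Q : quasicube Q -> bset Q (box_center Q).
Proof.
by move=> [h _] i; have := h i; rewrite mxE /side /midpt => ?; apply/andP; split; lra.
Qed.

Lemma len_gt0 Q : quasicube Q -> 0 < len Q.
Proof. by case=> + _; apply. Qed.

Lemma eball_sub_bset Q : quasicube Q -> eball (box_center Q) (len Q / 4) `<=` bset Q.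
Proof.
move=> [h1 h2] y /eballE yc i; have := h1 i; have := h2 (longest n0 Q) i.
have := le_lt_trans (enorm_coord ((y : 'rV[R]_n) - box_center Q) i) yc.
rewrite !mxE ltr_norml /midpt => /andP[].
set l := side Q (longest n0 Q); rewrite /side.
by move=> ? ? ? ?; apply/andP; split; lra.
Qed.

Lemma bset_dist Q x y : bset Q x -> bset Q y -> eudist x y <= n%:R * len Q.
Proof.
move=> hx hy; apply: enorm_le => i; rewrite !mxE.
have /andP[? ?] := hx i; have /andP[? ?] := hy i.
apply: le_trans (le_longest n0 Q i); rewrite /side ler_norml; apply/andP; split; lra.
Qed.

Lemma bset_sub_eball Q x : quasicube Q -> bset Q x ->
  bset Q `<=` eball x (2 * n%:R * len Q).
Proof.
move=> qQ hx y hy; apply/eballE; apply: le_lt_trans (bset_dist hx hy) _.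
by rewrite -mulrA ltr_pMl ?ltr1n// mulr_gt0 ?len_gt0// ltr0n.
Qed.

Lemma len_child Q Q' : quasicube Q ->
  (forall i, side Q' i = if i == longest n0 Q then side Q i / 2 else side Q i) ->
  len Q / 2 <= len Q'.
Proof.
by move=> qQ h; apply: le_trans (le_longest n0 Q' (longest n0 Q)); rewrite h eqxx.
Qed.

(** The lower corner does not belong to a half-open box, so sides are measured from the centre to
    the upper corner; hence the factor 2. *)
Lemma len_sub Q Q' : quasicube Q' -> bset Q' `<=` bset Q -> len Q' <= 2 * len Q.
Proof.
move=> qQ' sub; set i := longest n0 Q'.
have /andP[h1 _] := sub _ (bset_box_center qQ') i.
have hb : bset Q' (Q'.2 : Rn R n).
  by move=> j; rewrite lexx andbT -subr_gt0; case: qQ' => + _; apply.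
have /andP[_ h2] := sub _ hb i.
apply: le_trans (_ : 2 * side Q i <= _); last by rewrite ler_wpM2l// le_longest.
by move: h1 h2; rewrite mxE /midpt /side; lra.
Qed.

Variables (V : set (Rn R n)) (w : Rn R n -> R) (A1 dl : R) (K : nat).
Hypotheses (mw : measurable_fun setT w) (w0 : forall y, 0 <= w y).
Local Notation nu := (weighted mu mw w0).
Local Notation W A := (fine (nu A)).
Local Notation m A := (fine (mu A)).
Hypotheses (mV : measurable V) (nuV : (nu V < +oo)%E) (muV : (mu V < +oo)%E).
Hypotheses (A1_ge2 : 2 <= A1) (dl01 : 0 < dl < 1) (K_large : 16 * n%:R <= 2 ^+ K :> R).
Hypothesis iter_dbl : forall y r, 0 < r -> eball y (2 ^+ K * (2 * r)) `<=` V ->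
  W (eball y (2 ^+ K * r)) <= A1 ^+ K * W (eball y r).
Hypothesis small : forall y r E, 0 < r -> eball y (2 * r) `<=` V ->
  measurable E -> E `<=` eball y r -> m E <= dl * m (eball y r) ->
  W E <= (4 * A1 ^+ K)^-1 * W (eball y (2 * r)).
Hypothesis pos : forall y r, 0 < r -> eball y r `<=` V -> 0 < W (eball y r).

Lemma fine_measure_le (nu' : {measure set (Rn R n) -> \bar R}) (A B : set (Rn R n)) :
  (nu' V < +oo)%E -> measurable A -> measurable B -> A `<=` B -> B `<=` V ->
  fine (nu' A) <= fine (nu' B).
Proof.
move=> Voo mA mB AB BV; have AV := subset_trans AB BV.
have fin C : measurable C -> C `<=` V -> nu' C \is a fin_num.
  move=> mC CV; rewrite ge0_fin_numE//; apply: le_lt_trans Voo.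
  by apply: le_measure; rewrite ?inE.
by apply: fine_le; rewrite ?fin//; apply: le_measure; rewrite ?inE.
Qed.

Variable Q0 : box_t.
Hypotheses (qQ0 : quasicube Q0).
Hypothesis Q0_inside : forall Q, sub_quasicube Q0 Q ->
  eball (box_center Q) (2 ^+ K * (2 * len Q)) `<=` V.

Let A1K_gt0 : 0 < A1 ^+ K. Proof. by apply: exprn_gt0; apply: lt_le_trans A1_ge2. Qed.

Let nK (l : R) : 0 < l -> 16 * n%:R * l <= 2 ^+ K * l.
Proof. by move=> l0; rewrite ler_wpM2r// ltW. Qed.

(** [K] doublings lead from the ball of radius len/4 inside the box beyond radius 4n len: this is
    the meaning of 16n <= 2^K. *)
Let big_ball Q : sub_quasicube Q0 Q ->
  W (eball (box_center Q) (4 * n%:R * len Q)) <= A1 ^+ K * W (bset Q).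
Proof.
move=> sQ; have [qQ _] := sQ; have l0 := len_gt0 qQ; have QV := Q0_inside sQ.
have l40 : 0 < len Q / 4 by rewrite divr_gt0.
have K0 : 0 <= 2 ^+ K :> R by rewrite exprn_ge0.
have Kl : 0 < 2 ^+ K * len Q by rewrite mulr_gt0// exprn_gt0.
apply: le_trans (_ : W (eball (box_center Q) (2 ^+ K * (len Q / 4))) <= _).
  apply: fine_measure_le => //; [exact: measurable_eball|exact: measurable_eball| |].
    by apply: eball_le; have := nK l0; lra.
  by apply: subset_trans QV; apply: eball_le; rewrite ler_wpM2l//; lra.
apply: le_trans (iter_dbl l40 _) _.
  by apply: subset_trans QV; apply: eball_le; rewrite ler_wpM2l//; lra.
rewrite ler_wpM2l ?(ltW A1K_gt0)//; apply: fine_measure_le => //.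
- exact: measurable_eball.
- exact: measurable_bset.
- exact: eball_sub_bset.
apply: subset_trans (bset_sub_eball qQ (bset_box_center qQ)) _.
by apply: subset_trans QV; apply: eball_le; have := nK l0; lra.
Qed.

(** The box lies in a ball of radius 2n len. The reverse Hoelder bound on it involves the double
    ball, whose mass is at most A1^K times that of the box; the constant 1 / (4 A1^K) in [small] is
    chosen to leave a quarter. *)
Let W_small Q E : sub_quasicube Q0 Q -> measurable E -> E `<=` bset Q ->
  m E <= dl * m (bset Q) -> W E <= W (bset Q) / 4.
Proof.
move=> sQ mE EQ mEQ; have [qQ _] := sQ; have l0 := len_gt0 qQ; have QV := Q0_inside sQ.
have nl0 : 0 < 2 * n%:R * len Q by rewrite !mulr_gt0// ltr0n.
have QB := bset_sub_eball qQ (bset_box_center qQ).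
have Kl : 0 < 2 ^+ K * len Q by rewrite mulr_gt0// exprn_gt0.
have BV : eball (box_center Q) (2 * (2 * n%:R * len Q)) `<=` V.
  by apply: subset_trans QV; apply: eball_le; have := nK l0; lra.
have BV1 : eball (box_center Q) (2 * n%:R * len Q) `<=` V.
  by apply: subset_trans BV; apply: eball_le; lra.
have h : m E <= dl * m (eball (box_center Q) (2 * n%:R * len Q)).
  apply: le_trans mEQ _; rewrite ler_wpM2l//; first by case/andP: dl01 => /ltW.
  by apply: fine_measure_le => //; [exact: measurable_bset|exact: measurable_eball].
apply: le_trans (small nl0 BV mE (subset_trans EQ QB) h) _.
rewrite (_ : 2 * (2 * n%:R * len Q) = 4 * n%:R * len Q); last by ring.
have := big_ball sQ => hb.
rewrite mulrC ler_pdivrMr; last exact: mulr_gt0.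
by rewrite mulrA divfK// [leRHS]mulrC.
Qed.

(** The parent lies in the ball of radius 2n len(Q) <= 4n len(Q') about the centre of the child.
    This is the origin of u = A1^-K. *)
Let W_child Q Q' : sub_quasicube Q0 Q -> sub_quasicube Q0 Q' -> bset Q' `<=` bset Q ->
  (forall i, side Q' i = if i == longest n0 Q then side Q i / 2 else side Q i) ->
  A1 ^- K * W (bset Q) <= W (bset Q').
Proof.
move=> sQ sQ' Q'Q h; have [qQ QQ0] := sQ; have [qQ' _] := sQ'.
have l0 := len_gt0 qQ; have l'0 := len_gt0 qQ'; have ll := len_child qQ h.
rewrite mulrC ler_pdivrMr// mulrC; apply: le_trans (big_ball sQ').
have QB := bset_sub_eball qQ (Q'Q _ (bset_box_center qQ')).
apply: fine_measure_le => //.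
- exact: measurable_bset.
- exact: measurable_eball.
- apply: subset_trans QB _; apply: eball_le.
  rewrite (_ : 2 * n%:R * len Q = 4 * n%:R * (len Q / 2)); last by field.
  by rewrite ler_wpM2l// mulr_ge0.
- apply: subset_trans (Q0_inside sQ'); apply: eball_le.
  have Kl : 0 < 2 ^+ K * len Q' by rewrite mulr_gt0// exprn_gt0.
  by have := nK l'0; lra.
Qed.

Lemma box_sublevel_decay j :
  m (bset Q0 `&` [set y | w y < A1 ^- K ^+ j * (W (bset Q0) / m (bset Q0)) / 2]) <=
    (1 - dl) ^+ j * m (bset Q0).
Proof.
have sQ0 : sub_quasicube Q0 Q0 by split.
have Q0V : bset Q0 `<=` V.
  apply: subset_trans (bset_sub_eball qQ0 (bset_box_center qQ0)) _.
  apply: subset_trans (Q0_inside sQ0); apply: eball_le.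
  have l0 := len_gt0 qQ0.
  have Kl : 0 < 2 ^+ K * len Q0 by rewrite mulr_gt0// exprn_gt0.
  by have := nK l0; lra.
have mQ0 := measurable_bset Q0.
have muQ0 : (mu (bset Q0) < +oo)%E by rewrite mu_bset// ltry.
have nuQ0 : (nu (bset Q0) < +oo)%E.
  by apply: le_lt_trans nuV; apply: le_measure; rewrite ?inE.
have [hm hW W_le _] := weighted_facts mQ0 muQ0 nuQ0.
set m' := fun A => fine (mu (A `&` bset Q0)) in hm W_le.
set W' := fun A => fine (nu (A `&` bset Q0)) in hW W_le.
have mE A : A `<=` bset Q0 -> m' A = m A by move=> AQ; rewrite /m' fine_mu_restrict.
have WE A : A `<=` bset Q0 -> W' A = W A by move=> AQ; rewrite /W' fine_mu_restrict.
pose u := A1 ^- K; have u0 : 0 < u by rewrite invr_gt0.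
pose E := bset Q0 `&` [set y | w y < u ^+ j * (W (bset Q0) / m (bset Q0)) / 2].
have mEE : measurable E.
  apply: measurableI => //.
  have := mw measurableT (measurable_itv `]-oo, (u ^+ j * (W (bset Q0) / m (bset Q0)) / 2)[).
  by rewrite setTI.
have EQ : E `<=` bset Q0 by exact: subIsetl.
rewrite -/u -/E -!mE//.
have K0 : (0 < K)%N.
  case: K K_large => //; rewrite expr0 => h.
  have : 1 <= n%:R :> R by rewrite ler1n.
  lra.
have u12 : u <= 2^-1.
  rewrite lef_pV2 ?posrE// -(prednK K0) exprS.
  apply: (@le_trans _ _ (A1 * 1)); first by rewrite mulr1.
  have A11 : 1 <= A1 by apply: le_trans A1_ge2; rewrite ler1n.
  by apply: ler_wpM2l; [exact: le_trans A11|exact: exprn_ege1].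
have [dl0 dl1] := andP dl01.
apply: (@sublevel_decay _ _ _ _ (@bset R n) (blft n0) (brgt n0) (sub_quasicube Q0)
  m' W' hm hW (@sub_quasicube_lft _ _ n0 Q0) (@sub_quasicube_rgt _ _ n0 Q0)
  (fun Q _ => measurable_bset Q) (fun Q gQ => bset_split n0 gQ.1)
  (fun Q _ => bset_disj n0 Q) dl u dl0 dl1 u0 u12 _ _ _ _ _ j Q0 E sQ0 mEE EQ) => //.
- move=> Q sQ; have sl := sub_quasicube_lft n0 sQ; have sr := sub_quasicube_rgt n0 sQ.
  rewrite (mE _ sQ.2) (mE _ sl.2) (mE _ sr.2).
  by split; [exact: mu_blft sQ.1|exact: mu_brgt sQ.1].
- by move=> Q sQ; rewrite (mE _ sQ.2); exact: mu_bset_gt0 sQ.1.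
- move=> Q sQ; rewrite (WE _ sQ.2).
  have qQ := sQ.1; have l0 := len_gt0 qQ.
  have l40 : 0 < len Q / 4 by rewrite divr_gt0.
  have QB := eball_sub_bset qQ; have QV := subset_trans sQ.2 Q0V.
  apply: lt_le_trans (pos l40 (subset_trans QB QV)) _.
  by apply: fine_measure_le => //; [exact: measurable_eball|exact: measurable_bset].
- move=> Q F sQ mF FQ; have FQ0 := subset_trans FQ sQ.2.
  by rewrite (mE _ FQ0) (mE _ sQ.2) (WE _ FQ0) (WE _ sQ.2); exact: W_small.
- move=> Q sQ; have sl := sub_quasicube_lft n0 sQ; have sr := sub_quasicube_rgt n0 sQ.
  rewrite (WE _ sQ.2) (WE _ sl.2) (WE _ sr.2).
  split; apply: W_child => //.
  + by rewrite (bset_split n0 sQ.1); exact: subsetUl.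
  + exact: side_lft.
  + by rewrite (bset_split n0 sQ.1); exact: subsetUr.
  + exact: side_rgt.
- move=> e e0; have [_ h] := approximable_quasicube n0 qQ0 mEE.
  have [k [F [sF h1 h2]]] := h e e0; exists k, F; split => //.
  by move: h1; rewrite (_ : E `&` bset Q0 = E)//; apply/setIidPl.
- move=> A mA AE; have Q00 : bset Q0 `<=` bset Q0 by [].
  rewrite (mE _ Q00) (WE _ Q00); apply: W_le => //.
    rewrite divr_ge0// mulr_ge0 ?exprn_ge0 ?(ltW u0)// divr_ge0//.
      exact/fine_ge0/measure_ge0.
    exact/fine_ge0/measure_ge0.
  by move=> y /AE [_ /= /ltW].
Qed.

End boxes_and_balls.

Lemma measurable_sublevel d (T : measurableType d) (R : realType) (w : T -> R)
  (t : R) : measurable_fun setT w -> measurable [set y | w y < t].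
Proof.
move=> mw; have := mw measurableT _ (measurable_itv `]-oo, t[).
by rewrite setTI; congr measurable; apply/seteqP; split => y /=; rewrite in_itv.
Qed.

Section doubling_implies_bmo.
Context {R : realType} {n : nat}.
Hypothesis n0 : (0 < n)%N.
Local Notation mu := (@lebesgueRn R n).

Section chains.
Variables (U : set (Rn R n)) (w : Rn R n -> R) (A1 : R) (x : Rn R n) (r : R).
Hypotheses (mw : measurable_fun setT w) (w0 : forall y, 0 <= w y).
Local Notation nu := (weighted mu mw w0).
Local Notation W A := (fine (nu A)).
Local Notation V := (eball x (3 / 2 * r)).
Hypotheses (r0 : 0 < r) (xU : eball x (2 * r) `<=` U) (nuV : (nu V < +oo)%E).
Hypothesis A1_ge1 : 1 <= A1.
Hypothesis dblW : forall y s, 0 < s -> eball y (4 * s) `<=` U ->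
  eball y (2 * s) `<=` V -> W (eball y (2 * s)) <= A1 * W (eball y s).

Let VU : V `<=` U.
Proof. by apply: subset_trans xU; apply: eball_le; move: r0; lra. Qed.

(** The last doubling needs four times its starting ball inside U, which is twice the final ball;
    hence the extra factor 2 in the inclusion. *)
Lemma iterated_doubling k y s : 0 < s -> eball y (2 ^+ k * (2 * s)) `<=` V ->
  W (eball y (2 ^+ k * s)) <= A1 ^+ k * W (eball y s).
Proof.
elim: k => [|k IH] s0 yV; first by rewrite !expr0 !mul1r.
have k0 : 0 < 2 ^+ k * s by rewrite mulr_gt0// exprn_gt0.
have E4 : 2 ^+ k.+1 * (2 * s) = 4 * (2 ^+ k * s) by rewrite exprS; ring.
have E2 : 2 ^+ k.+1 * s = 2 * (2 ^+ k * s) by rewrite exprS; ring.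
have E2' : 2 ^+ k * (2 * s) = 2 * (2 ^+ k * s) by ring.
rewrite E4 in yV.
have yV2 : eball y (2 * (2 ^+ k * s)) `<=` V.
  by apply: subset_trans yV; apply: eball_le; rewrite ler_wpM2r ?(ltW k0)// ler_nat.
rewrite E2 exprS -mulrA; apply: le_trans (dblW k0 (subset_trans yV VU) yV2) _.
by rewrite ler_wpM2l ?(le_trans ler01)// IH// E2'.
Qed.

Let hop u v : eudist x u < r -> eudist x v < r -> eudist u v <= r / 4 ->
  W (eball u (r / 4)) <= A1 * W (eball v (r / 4)).
Proof.
move=> xu xv uv; have r40 : 0 < r / 4 by rewrite divr_gt0.
have vU : eball v (4 * (r / 4)) `<=` U.
  by apply: subset_trans xU; apply: eball_subset; move: xv; lra.
have vV : eball v (2 * (r / 4)) `<=` V by apply: eball_subset; move: xv; lra.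
apply: le_trans (dblW r40 vU vV).
apply: (fine_measure_le (@measurable_eball _ _ x _) nuV) => //; [exact: measurable_eball|exact: measurable_eball|].
by apply: eball_subset; rewrite eudistC; move: uv; lra.
Qed.

(** Cuts the segment from [x] to [z] into four hops of length at most r/4. At radius r/4, four times
    a ball centred in B(x, r) still lies in B(x, 2r), so doubling is available at every hop. *)
Lemma four_hops z : eudist x z < r ->
  W (eball x (r / 4)) <= A1 ^+ 4 * W (eball z (r / 4)) /\
  W (eball z (r / 4)) <= A1 ^+ 4 * W (eball x (r / 4)).
Proof.
move=> xz; pose p (j : nat) : Rn R n :=
  (x : 'rV[R]_n) + (j%:R / 4) *: ((z : 'rV[R]_n) - x).
have p0 : p 0%N = x by rewrite /p mul0r scale0r addr0.
have p4 : p 4%N = z by rewrite /p divff// scale1r addrC subrK.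
have xp j : (j <= 4)%N -> eudist x (p j) < r.
  move=> j4; apply: le_lt_trans xz; rewrite /eudist /p addrC addKr enormZ.
  rewrite ler_piMl ?enorm_ge0// ger0_norm ?divr_ge0// ler_pdivrMr// mul1r.
  by rewrite (ler_nat R j 4).
have pp j : eudist (p j) (p j.+1) <= r / 4.
  rewrite /eudist /p.
  have -> : (x : 'rV[R]_n) + (j.+1%:R / 4) *: ((z : 'rV[R]_n) - x) -
      (x + (j%:R / 4) *: ((z : 'rV[R]_n) - x)) = 4^-1 *: ((z : 'rV[R]_n) - x) :> 'rV[R]_n.
    by apply/rowP => i; rewrite !mxE -natr1; field.
  rewrite enormZ ger0_norm ?invr_ge0// mulrC ler_wpM2r ?invr_ge0//; exact: ltW.
have A0 : 0 <= A1 by apply: le_trans A1_ge1.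
have up j : (j <= 4)%N -> W (eball x (r / 4)) <= A1 ^+ j * W (eball (p j) (r / 4)).
  elim: j => [|j IH] j4; first by rewrite expr0 mul1r p0.
  apply: le_trans (IH (ltnW j4)) _; rewrite exprSr -mulrA ler_wpM2l ?exprn_ge0//.
  by apply: hop; [exact/xp/ltnW|exact: xp|exact: pp].
have down j : (j <= 4)%N -> W (eball (p j) (r / 4)) <= A1 ^+ j * W (eball x (r / 4)).
  elim: j => [|j IH] j4; first by rewrite expr0 mul1r p0.
  apply: (@le_trans _ _ (A1 * W (eball (p j) (r / 4)))).
    by apply: hop; [exact: xp|exact/xp/ltnW|rewrite eudistC; exact: pp].
  by rewrite exprS -mulrA ler_wpM2l// IH// ltnW.
by have := up 4%N isT; have := down 4%N isT; rewrite p4.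
Qed.

End chains.

Lemma ln_ratio_le (a b c : R) (k : nat) : 0 < a -> 0 < b -> 0 < c ->
  c ^- k * b <= a -> a <= c ^+ k * b -> `|ln a - ln b| <= k%:R * ln c.
Proof.
move=> a0 b0 c0 h1 h2; have ck0 : 0 < c ^+ k by rewrite exprn_gt0.
have : ln (c ^- k * b) <= ln a by rewrite ler_ln ?posrE// mulr_gt0// invr_gt0.
have : ln a <= ln (c ^+ k * b) by rewrite ler_ln ?posrE// mulr_gt0.
rewrite !lnM ?posrE ?invr_gt0// lnV ?posrE// lnXn// -[ln c *+ _]mulr_natl.
by move=> ? ?; rewrite ler_norml; apply/andP; split; lra.
Qed.

Definition cube (z : Rn R n) (s : R) : 'rV[R]_n * 'rV[R]_n :=
  ((z : 'rV[R]_n) - const_mx s, (z : 'rV[R]_n) + const_mx s).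

Lemma side_cube z s i : side (cube z s) i = 2 * s.
Proof. by rewrite /side /= !mxE; ring. Qed.

Lemma quasicube_cube z s : 0 < s -> quasicube (cube z s).
Proof.
by move=> s0; split=> [i|i j]; rewrite !side_cube ?mulr_gt0// ler_peMl ?mulr_ge0 ?ltW// ltr1n.
Qed.

Lemma cube_center z s : 0 < s -> bset (cube z s) z.
Proof. by move=> s0 i; rewrite !mxE; apply/andP; split; lra. Qed.

(** The box has its centre within 2ns of [z] and longest side at most 4s, so the ball has radius at
    most 8 2^K s <= r/4. The bound r/32 leaves ample room within 3r/2. *)
Lemma cube_inside (x z : Rn R n) (r s : R) (K : nat) Q : 0 < s -> eudist x z < r ->
  16 * n%:R <= 2 ^+ K :> R -> 2 ^+ K * s <= r / 32 -> sub_quasicube (cube z s) Q ->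
  eball (box_center Q) (2 ^+ K * (2 * side Q (longest n0 Q))) `<=` eball x (3 / 2 * r).
Proof.
move=> s0 xz nK Ks [qQ QQ]; apply: eball_subset.
have zc : bset (cube z s) z.
  exact: cube_center.
have := bset_dist n0 zc (QQ _ (bset_box_center qQ)); rewrite side_cube => d1.
have := len_sub n0 qQ QQ; rewrite side_cube => d2.
have d3 := eudist_triangle x z (box_center Q); have d0 := eudist_ge0 x z.
have k0 : 0 <= 2 ^+ K :> R by rewrite exprn_ge0.
have d4 := ler_wpM2l k0 d2.
have d5 := ler_wpM2r (ltW s0) nK.
move: d0 d1 d3 d4 d5 xz Ks; move: (side Q _) => l.
have -> : 2 ^+ K * (2 * l) = 2 * (2 ^+ K * l) by ring.
have -> : 2 ^+ K * (2 * (2 * s)) = 4 * (2 ^+ K * s) by ring.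
have -> : n%:R * (2 * s) = 2 * (n%:R * s) by ring.
rewrite -[16 * n%:R * s]mulrA; move: (2 ^+ K * l) (2 ^+ K * s) (n%:R * s) => P P' P''.
move: (eudist x z) (eudist z _) (eudist x _) => e1 e2 e3.
by move=> *; lra.
Qed.

Lemma doubling_BMO (q B A : R) : 1 < q -> 0 < B -> 0 < A ->
  exists2 D : R, 0 < D &
    forall (U : set (Rn R n)) (w : Rn R n -> R),
      open U -> measurable_fun setT w -> (forall x, 0 <= w x) ->
      loc_integrable U w -> nonvanishing U w -> weak_reverse_Holder U w q B ->
      doubling_with U w A -> BMO_with U (log w) D.
Proof.
move=> q1 B0 A0.
have nR0 : 0 < n%:R :> R by rewrite ltr0n.
(* Doubling constant for masses instead of averages: the volume bounds give a ratio at most (4n)^n.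
   The summand 2 ensures A1 >= 2, hence u <= 1/2. *)
pose A1 := A * (4 * n%:R) ^+ n + 2.
have A1_ge2 : 2 <= A1 by rewrite lerDr mulr_ge0 ?(ltW A0)// exprn_ge0// mulr_ge0.
have A1_ge1 : 1 <= A1 by apply: le_trans A1_ge2; rewrite ler1n.
have A1_gt0 : 0 < A1 by apply: lt_le_trans A1_ge1.
pose K := (16 * n)%N.
have K_large : 16 * n%:R <= 2 ^+ K :> R.
  by rewrite -natrM -natrX ler_nat ltnW// ltn_expl.
have A1K0 : 0 < A1 ^+ K by rewrite exprn_gt0.
pose e := (4 * A1 ^+ K)^-1; have e0 : 0 < e by rewrite invr_gt0 mulr_gt0.
have [dl' dl'0 small] := reverse_Holder_small_sets q1 B0 e0.
pose dl := Num.min dl' 2^-1.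
have dl01 : 0 < dl < 1.
  by rewrite /dl lt_min dl'0 invr_gt0 ltr0n /= gt_min invf_lt1 ?ltr1n ?orbT.
have dldl' : dl <= dl' by rewrite /dl ge_min lexx.
(* With cubes of half-side [lam * r], one has 2^K lam r = r/32, as [cube_inside] requires. *)
pose lam : R := 2 ^- (K + 5); have lam0 : 0 < lam by rewrite invr_gt0 exprn_gt0.
have [N hN] := @eball_cover R n lam lam0.
pose u := A1 ^- K; have u0 : 0 < u by rewrite invr_gt0.
have K0 : (0 < K)%N by rewrite muln_gt0.
have u12 : u <= 2^-1.
  rewrite lef_pV2 ?posrE// -(prednK K0) exprS.
  apply: (@le_trans _ _ (A1 * 1)); first by rewrite mulr1.
  by apply: ler_wpM2l; [exact: ltW|exact: exprn_ege1].
have [dl0 dl1] := andP dl01.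
pose C1 := 1 + 4 + ((1 - ln u) / (dl / 4)) ^+ 2 / (1 - (1 + dl / 4) ^+ 2 * (1 - dl)).
have C10 : 0 <= C1.
  rewrite /C1 !addr_ge0// divr_ge0 ?sqr_ge0// subr_ge0.
  by have /andP[_ /ltW] := tail_rate dl01.
(* K + 3 doublings lead from radius [lam * r] to r/4, and four hops from there to [x]: this bounds
   the logarithm of the ratio between the mass of a small cube and that of [eball x (r / 4)]. *)
pose kap := (K + 7)%:R * ln A1.
pose D0 := N%:R * (2 * C1 + 2 * kap ^+ 2).
have D00 : 0 <= D0 by rewrite mulr_ge0// addr_ge0// mulr_ge0// sqr_ge0.
exists (2 * D0 + 2 * (D0 + 1) ^+ 2).
  apply: ltr_wpDl; first by rewrite mulr_ge0.
  by rewrite mulr_gt0// exprn_gt0// ltr_wpDl.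
move=> U w oU mw w0 li nv rH dbl x r r0 xU.
have pos := doubling_positive n0 mw w0 dbl oU nv.
pose V : set (Rn R n) := eball x (3 / 2 * r).
have VU : V `<=` U by apply: subset_trans xU; apply: eball_le; lra.
have mV : measurable V by exact: measurable_eball.
have muV : (mu V < +oo)%E by rewrite ltey_eq lebesgueRn_eball_fin.
have nuV : (weighted mu mw w0 V < +oo)%E.
  by apply: (loc_integrable_eball li w0 mw _ xU); lra.
have finB y p : mu (eball y p) \is a fin_num by exact: lebesgueRn_eball_fin.
have finW A' : measurable A' -> A' `<=` V -> weighted mu mw w0 A' \is a fin_num.
  move=> mA' A'V; rewrite ge0_fin_numE//; apply: le_lt_trans nuV.
  by apply: le_measure; rewrite ?inE.
have dblW y s : 0 < s -> eball y (4 * s) `<=` U -> eball y (2 * s) `<=` V ->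
    fine (weighted mu mw w0 (eball y (2 * s))) <=
    A1 * fine (weighted mu mw w0 (eball y s)).
  move=> s0 yU yV; have := dbl y s s0 yU.
  change (((mu (eball y (2 * s)))^-1 * weighted mu mw w0 (eball y (2 * s)) <=
    A%:E * ((mu (eball y s))^-1 * weighted mu mw w0 (eball y s)))%E -> 
    fine (weighted mu mw w0 (eball y (2 * s))) <=
    A1 * fine (weighted mu mw w0 (eball y s))).
  have s20 : 0 < 2 * s by rewrite mulr_gt0.
  have yV1 : eball y s `<=` V.
    by apply: subset_trans yV; apply: eball_le; rewrite ler_peMl ?ler1n// ltW.
  have f1 := finW _ (@measurable_eball _ _ y s) yV1.
  have f2 := finW _ (@measurable_eball _ _ y (2 * s)) yV.
  have g1 := lebesgueRn_eball_ge y n0 s0.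
  have g2 := lebesgueRn_eball_le y s20.
  rewrite -(fineK f1) -(fineK f2) -(fineK (finB y s)) -(fineK (finB y (2 * s))).
  rewrite -(fineK (finB y s)) lee_fin in g1.
  rewrite -(fineK (finB y (2 * s))) lee_fin in g2.
  have a1 : 0 < fine (mu (eball y s)).
    by apply: lt_le_trans g1; rewrite exprn_gt0// divr_gt0.
  have a2 : 0 < fine (mu (eball y (2 * s))).
    apply: lt_le_trans a1 _; rewrite fine_le// le_measure ?inE//.
    - exact: measurable_eball.
    - exact: measurable_eball.
    - by apply: eball_le; rewrite ler_peMl ?ler1n// ltW.
  have W1 : 0 <= fine (weighted mu mw w0 (eball y s)) by exact/fine_ge0/measure_ge0.
  move: W1 g1 g2 a1 a2; move: (fine (weighted _ _ _ (eball y s))) => W1.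
  move: (fine (weighted _ _ _ (eball y (2 * s)))) => W2.
  move: (fine (mu (eball y s))) => m1; move: (fine (mu (eball y (2 * s)))) => m2.
  move=> W10 g1 g2 m10 m20; rewrite !inver !gt_eqF// -!EFinM lee_fin.
  rewrite mulrC ler_pdivrMr// => /le_trans; apply.
  have m21 : m2 <= (4 * n%:R) ^+ n * m1.
    apply: le_trans g2 _; apply: le_trans (_ : (4 * n%:R) ^+ n * (s / n%:R) ^+ n <= _).
      rewrite -exprMn (_ : 2 * (2 * s) = 4 * n%:R * (s / n%:R))//.
      by field; rewrite gt_eqF.
    by rewrite ler_wpM2l// exprn_ge0// mulr_ge0.
  apply: (@le_trans _ _ (A * (m1^-1 * W1) * ((4 * n%:R) ^+ n * m1))).
    rewrite ler_wpM2l// mulr_ge0 ?(ltW A0)// mulr_ge0// invr_ge0 ltW//.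
  have -> : A * (m1^-1 * W1) * ((4 * n%:R) ^+ n * m1) = A * (4 * n%:R) ^+ n * W1.
    by field; rewrite gt_eqF.
  by rewrite ler_wpM2r// /A1 lerDl.
have smallW y s E : 0 < s -> eball y (2 * s) `<=` V -> measurable E ->
    E `<=` eball y s -> fine (mu E) <= dl * fine (mu (eball y s)) ->
    fine (weighted mu mw w0 E) <=
      (4 * A1 ^+ K)^-1 * fine (weighted mu mw w0 (eball y (2 * s))).
  move=> s0 yV mE Ey mEs.
  have yp : eball y s `<=` eball y (2 * s).
    by apply: eball_le; rewrite ler_peMl ?ler1n// ltW.
  have yV1 := subset_trans yp yV; have EV := subset_trans Ey yV1.
  have fE : mu E \is a fin_num.
    rewrite ge0_fin_numE//; apply: le_lt_trans muV.
    by apply: le_measure; rewrite ?inE.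
  have f2 := finW _ (@measurable_eball _ _ y (2 * s)) yV.
  have fW := finW _ mE EV.
  have hE : (mu E <= dl'%:E * mu (eball y s))%E.
    rewrite -(fineK fE) -(fineK (finB y s)) -EFinM lee_fin (le_trans mEs)//.
    by rewrite ler_wpM2r//; exact/fine_ge0/measure_ge0.
  have W2 : (weighted mu mw w0 (eball y (2 * s)) < +oo)%E by rewrite -ge0_fin_numE.
  have := small _ _ mu w (eball y s) (eball y (2 * s)) E mw w0
    (@measurable_eball _ _ _ _) (@measurable_eball _ _ _ _) mE yp Ey
    (lebesgueRn_eball_gt0 n0 y s0) _ W2 (rH y s s0 (subset_trans yV VU)).
  rewrite ltey_eq finB => /(_ isT) h.
  rewrite -lee_fin EFinM (fineK fW) (fineK f2); exact: h hE.
have posW y s : 0 < s -> eball y s `<=` V -> 0 < fine (weighted mu mw w0 (eball y s)).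
  move=> s0 yV; rewrite fine_gt0// pos//=; last exact: subset_trans VU.
  by rewrite -ge0_fin_numE// finW//; exact: measurable_eball.
have iter := iterated_doubling r0 xU A1_ge1 dblW.
have hops := four_hops r0 xU nuV A1_ge1 dblW.
have [z [z1 z2]] := hN x r r0.
have lr0 : 0 < lam * r by rewrite mulr_gt0.
have Klr : 2 ^+ K * (lam * r) = r / 32.
  rewrite /lam exprD; field. by rewrite expf_neq0.
have Klr' : 2 ^+ K * (lam * r) <= r / 32 by rewrite Klr.
pose Q i := cube (z i) (lam * r).
have qQ i : quasicube (Q i) by exact: quasicube_cube.
pose v := (2 * (lam * r)) ^+ n.
have v0 : 0 < v by rewrite exprn_gt0// mulr_gt0.
have muQ i : mu (bset (Q i)) = v%:E by exact: lebesgueRn_cube (ltW lr0).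
have xz i : eudist x (z i) < r by exact/eballE.
have QV i : bset (Q i) `<=` V.
  have sQ : sub_quasicube (Q i) (Q i) by split.
  apply: subset_trans (cube_inside lr0 (xz i) K_large _ sQ); last by rewrite Klr.
  apply: subset_trans (bset_sub_eball n0 (qQ i) (bset_box_center (qQ i))) _.
  apply: eball_le; rewrite side_cube; set l := 2 * (lam * r).
  have l0 : 0 <= 2 * l by rewrite !mulr_ge0// ltW.
  rewrite (_ : 2 * n%:R * l = n%:R * (2 * l)); last by ring.
  apply: ler_wpM2r => //.
  by apply: le_trans K_large; rewrite ler_peMl// ler1n.
pose g := fine (weighted mu mw w0 (eball x (r / 4))).
have g0 : 0 < g by apply: posW; [rewrite divr_gt0|apply: eball_le; lra].
have Qg i : A1 ^- (K + 7) * g <= fine (weighted mu mw w0 (bset (Q i))) /\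
    fine (weighted mu mw w0 (bset (Q i))) <= A1 ^+ (K + 7) * g.
  have [h1 h2] := hops _ (xz i).
  have zV : eball (z i) (r / 2) `<=` V.
    by apply: eball_subset; move: (xz i) r0; clear; move=> *; lra.
  have E1 : 2 ^+ (K + 3) * (lam * r) = r / 4.
    by rewrite exprD mulrAC Klr; field.
  have E2 : 2 ^+ (K + 3) * (2 * (lam * r)) = r / 2 by rewrite mulrCA E1; field.
  have zQ : eball (z i) (lam * r) `<=` bset (Q i) by exact: eball_sub_cube.
  have h3 : fine (weighted mu mw w0 (eball (z i) (lam * r))) <=
      fine (weighted mu mw w0 (bset (Q i))).
    by apply: (fine_measure_le mV nuV) => //; [exact: measurable_eball|exact: measurable_bset].
  have h4 := iter (K + 3)%N (z i) _ lr0; rewrite E1 E2 in h4.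
  split.
    rewrite mulrC ler_pdivrMr ?exprn_gt0// mulrC.
    have -> : A1 ^+ (K + 7) = A1 ^+ 4 * A1 ^+ (K + 3) by rewrite -exprD; congr (_ ^+ _); rewrite addnCA.
    apply: le_trans h1 _; rewrite -[leRHS]mulrA.
    apply: ler_wpM2l; first by rewrite exprn_ge0// ltW.
    by apply: le_trans (h4 zV) _; apply: ler_wpM2l => //; rewrite exprn_ge0// ltW.
  apply: (@le_trans _ _ (A1 ^+ 4 * g)); last first.
    by rewrite ler_wpM2r ?(ltW g0)// ler_weXn2l// addnC.
  apply: le_trans h2; apply: (fine_measure_le mV nuV) => //.
  - exact: measurable_bset.
  - exact: measurable_eball.
  - have zc : bset (Q i) (z i).
      exact: cube_center.
    apply: subset_trans (bset_sub_eball n0 (qQ i) zc) _; apply: eball_le.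
    rewrite side_cube; have := ler_wpM2r (ltW lr0) K_large; rewrite Klr.
    by move: r0; clear; move=> *; lra.
  - by apply: subset_trans zV; apply: eball_le; move: r0; clear; move=> *; lra.
(* A common centre for all cubes. They have the same volume [v], so their logarithmic averages
   differ from [c0] only through the masses, by at most [kap]. *)
pose c0 := ln (g / v).
have onQ i : (\int[mu]_(y in bset (Q i)) `|lne (w y)%:E - c0%:E| ^+ 2 <=
    (2 * C1 + 2 * kap ^+ 2)%:E * mu (bset (Q i)))%E.
  have [l1 l2] := Qg i; set Wi := fine (weighted mu mw w0 (bset (Q i))) in l1 l2.
  have mQ := measurable_bset (Q i).
  have fWi := finW _ mQ (QV i).
  have Wi0 : 0 < Wi by apply: lt_le_trans l1; rewrite mulr_gt0// invr_gt0 exprn_gt0.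
  have a0 : 0 < Wi / v by rewrite divr_gt0.
  have muoo : (mu (bset (Q i)) < +oo)%E by rewrite muQ ltry.
  have kapE : `|ln (Wi / v) - c0| <= kap.
    rewrite /c0 !ln_div ?posrE// opprB addrA subrK.
    exact: ln_ratio_le.
  apply: (integral_sqr_shift mw mQ kapE _ muoo).
  have mE' : fine (mu (bset (Q i))) = v by rewrite muQ.
  apply: (second_moment_of_tails mw w0 _ dl01 a0 mQ muoo).
  - by rewrite u0.
  - change (weighted mu mw w0 (bset (Q i)) <= (Wi / v)%:E * mu (bset (Q i)))%E.
    by rewrite (muQ i) -EFinM divfK ?gt_eqF// (fineK fWi).
  - move=> j; have := box_sublevel_decay mV nuV muV A1_ge2 dl01 K_large
      (fun y s => iter K y s) smallW posW (qQ i) (fun Q' => cube_inside lr0 (xz i) K_large Klr') j.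
    rewrite mE' -/Wi -/u; set S := bset (Q i) `&` _ => h.
    change (mu S <= ((1 - dl) ^+ j)%:E * mu (bset (Q i)))%E.
    have fS : mu S \is a fin_num.
      rewrite ge0_fin_numE//; apply: le_lt_trans muoo; apply: le_measure; rewrite ?inE//.
        by apply: measurableI => //; exact: measurable_sublevel.
      exact: subIsetl.
    by rewrite (muQ i) -(fineK fS) -EFinM lee_fin.
have onB : (\int[mu]_(y in eball x r) `|lne (w y)%:E - c0%:E| ^+ 2 <=
    D0%:E * mu (eball x r))%E.
  have mg : measurable_fun setT (fun y => `|lne (w y)%:E - c0%:E| ^+ 2)%E.
    exact: measurable_sqdist_lne mw _.
  have cov : eball x r `<=` \bigcup_i bset (Q i).
    by apply: subset_trans z2 _ => y [i _ yi]; exists i => //; exact: eball_sub_cube.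
  have g_ge0 y : (0 <= `|lne (w y)%:E - c0%:E| ^+ 2)%E by exact: expe_ge0.
  have sum_cover : (\int[mu]_(y in eball x r) `|lne (w y)%:E - c0%:E| ^+ 2 <=
      \sum_(i < N) \int[mu]_(y in bset (Q i)) `|lne (w y)%:E - c0%:E| ^+ 2)%E.
    exact: (ge0_integral_cover mu mg g_ge0 (@measurable_eball _ _ x r)
      (fun i => measurable_bset (Q i)) cov).
  apply: le_trans sum_cover _.
  apply: (@le_trans _ _ (\sum_(i < N) ((2 * C1 + 2 * kap ^+ 2) * v)%:E)%E).
    by apply: lee_sum => i _; rewrite EFinM -(muQ i).
  rewrite sumEFin sumr_const card_ord -(fineK (finB x r)) -EFinM lee_fin -[leLHS]mulr_natl.
  rewrite /D0 -mulrA ler_wpM2l// ler_wpM2l//; first by rewrite addr_ge0// mulr_ge0// sqr_ge0.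
  have g1 := lebesgueRn_eball_ge x n0 r0.
  rewrite -(fineK (finB x r)) lee_fin in g1; apply: le_trans g1.
  (* Each of the [N] cubes is smaller than the cube inscribed in the ball, as 2 lam r <= r/n; so [N]
     enters the constant as a mere factor. *)
  apply: lerXn2r; rewrite ?nnegrE ?mulr_ge0 ?divr_ge0 ?(ltW lam0) ?(ltW r0)//.
  rewrite ler_pdivlMr//; have := ler_wpM2r (ltW lr0) K_large; rewrite Klr.
  by move: r0; clear; move=> *; lra.
apply: (mean_oscillation_of_center mw (@measurable_eball _ _ x r)
  (lebesgueRn_eball_gt0 n0 x r0) _ D00 onB) => //.
by rewrite ltey_eq finB.
Qed.

End doubling_implies_bmo.

Theorem proposition2p3 (R : realType) (n : nat) (hn : (0 < n)%N) :
  (forall (U : set (Rn R n)) (w : Rn R n -> R),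
    open U ->
    measurable_fun U w -> (forall x, U x -> 0 <= w x) ->
    loc_integrable U w -> nonvanishing U w ->
    (exists q B : R, [/\ 1 < q, 0 < B & weak_reverse_Holder U w q B]) ->
    (doubling U w <-> BMO U (log w)))
  /\
  (forall q B D : R, 1 < q -> 0 < B -> 0 < D ->
    exists C : R, 0 < C /\
      forall (U : set (Rn R n)) (w : Rn R n -> R),
        open U ->
        measurable_fun U w -> (forall x, U x -> 0 <= w x) ->
        loc_integrable U w ->
        weak_reverse_Holder U w q B ->
        BMO_with U (log w) D ->
        doubling_with U w C).
Proof.
(* The quantitative statement also supplies the implication from BMO to doubling in the
   equivalence. *)
have part2 (q B D : R) : 1 < q -> 0 < B -> 0 < D ->
    exists C : R, 0 < C /\
      forall (U : set (Rn R n)) (w : Rn R n -> R),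
        open U ->
        measurable_fun U w -> (forall x, U x -> 0 <= w x) ->
        loc_integrable U w -> weak_reverse_Holder U w q B ->
        BMO_with U (log w) D -> doubling_with U w C.
  move=> q1 B0 D0; have [C C0 hC] := BMO_doubling hn q1 B0 D0.
  exists C; split=> // U w oU mw w0 li rH bmo.
  (* From here on [w] is replaced by its extension by zero off U, and the conclusion is carried back
     by agreement on U. *)
  have [mv [v0 vw]] := restrict_nonneg (measurable_open oU) mw w0.
  have wv y : U y -> w y = (w \_ U) y by move=> /vw.
  apply: (eq_doubling_with vw); apply: (hC _ _ mv v0).
  - exact: eq_loc_integrable wv li.
  - exact: eq_weak_reverse_Holder wv _ _ rH.
  - exact: eq_BMO_with wv _ bmo.
split=> // U w oU mw w0 li nv [q [B [q1 B0 rH]]]; split=> [[A A0 dA]|[D D0 bmo]].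
  have [D D0 hD] := doubling_BMO hn q1 B0 A0.
  have [mv [v0 vw]] := restrict_nonneg (measurable_open oU) mw w0.
  have wv y : U y -> w y = (w \_ U) y by move=> /vw.
  exists D => //; apply: (eq_BMO_with vw); apply: (hD _ _ oU mv v0).
  - exact: eq_loc_integrable wv li.
  - exact: eq_nonvanishing wv nv.
  - exact: eq_weak_reverse_Holder wv _ _ rH.
  - exact: eq_doubling_with wv _ dA.
have [C [C0 hC]] := part2 q B D q1 B0 D0.
by exists C => //; exact: hC.
Qed.
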